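(* Let $G$ be a connected compact abelian group with character group $\Gamma$, let $\preceq$ be a linear order making $\Gamma$ an ordered group, and let $\mathcal{B}\subseteq C(G)$ be an admissible algebra. Then: (a) the set $GLF(\mathcal{B})$ of $\mathcal{B}$-factorable scalar functions is dense in $GL(\mathcal{B})$; (b) the equality $GLF(\mathcal{B})=GL(\mathcal{B})$ holds if and only if $\mathcal{B}$ is decomposing.
   Context: $G$ is a connected compact abelian group (written multiplicatively) with (discrete, torsion free, additively written) character group $\Gamma$; $\langle j,g\rangle\in\mathbb{T}$ is the value of the character $j\in\Gamma$ at $g\in G$. A linear order $\preceq$ on $\Gamma$ making it an ordered group is fixed; $\Gamma_+=\{x\in\Gamma: x\succeq 0\}$, $\Gamma_-=\{x\in\Gamma: x\preceq 0\}$. $C(G)$ is the algebra of continuous complex functions on $G$ with the sup norm, and $P(G)$ is its subalgebra of finite linear combinations of the functions $\langle j,\cdot\rangle$, $j\in\Gamma$. The Bohr-Fourier spectrum of $a\in C(G)$ is the set $\sigma(a)$ of $j\in\Gamma$ for which the Bohr-Fourier coefficient $\int_G a(g)\overline{\langle j,g\rangle}\,dg$ (normalized Haar measure) is nonzero. $GL(U)$ denotes the group of invertible elements of a unital ring $U$. Admissible algebra: a unital Banach algebra $\mathcal{B}\subseteq C(G)$ (a subalgebra containing the constants, with its own Banach algebra norm) such that (1) $P(G)$ is contained and dense in $\mathcal{B}$ (in the norm of $\mathcal{B}$), and (2) $\mathcal{B}$ is inverse closed: $X\in\mathcal{B}\cap GL(C(G))$ implies $X\in GL(\mathcal{B})$.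 Density is in the norm of $\mathcal{B}$. $\mathcal{B}_\pm$ is the closed unital subalgebra of $a\in\mathcal{B}$ with $\sigma(a)\subseteq\Gamma_\pm$. $\mathcal{B}$ is decomposing (with respect to $\preceq$) if $\mathcal{B}=\mathcal{B}_++\mathcal{B}_-$. A function $a\in\mathcal{B}$ is $\mathcal{B}$-factorable if $a(g)=a_-(g)\langle j,g\rangle a_+(g)$ for all $g\in G$, for some $a_\pm$ with $a_\pm,a_\pm^{-1}\in\mathcal{B}_\pm$ and some $j\in\Gamma$; $GLF(\mathcal{B})$ is the set of $\mathcal{B}$-factorable elements of $\mathcal{B}$. *)

(* Defs.v *)
From HB Require Import structures.
From mathcomp Require Import all_boot all_order all_algebra.
From mathcomp Require Import complex.
From mathcomp Require Import all_classical all_reals all_analysis.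

Set Implicit Arguments.
Unset Strict Implicit.
Unset Printing Implicit Defensive.
Import Order.TTheory GRing.Theory Num.Theory.
Import numFieldNormedType.Exports.

Local Open Scope classical_set_scope.
Local Open Scope complex_scope.
Local Open Scope ring_scope.

(* The library puts a topology on the sort of an abstract numFieldType only;
   this gives the concrete type R[i] the same (modulus) topology. *)
HB.instance Definition _ (R : realType) := NormedModule.copy R[i] R[i]^o.

(* The group law of G is written additively, as topologicalZmodType requires. *)
Definition is_character (R : realType) (G : topologicalZmodType)
    (f : G -> R[i]) : Prop :=
  [/\ continuous f,
      forall g h, f (g + h) = f g * f h &
      forall g, `|f g| = 1].

Record character (R : realType) (G : topologicalZmodType) := Character {
  char_fun :> G -> R[i];
  characterP : is_character char_fun }.

Section CharacterGroup.
Variables (R : realType) (G : topologicalZmodType).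
Implicit Types j k l : character R G.

Lemma char_eq j k : (forall g, j g = k g) -> j = k.
Proof.
case: j k => [j jP] [k kP] /= /funext jk.
by subst k; congr Character; exact: Prop_irrelevance.
Qed.

HB.instance Definition _ := gen_eqMixin (character R G).
HB.instance Definition _ := gen_choiceMixin (character R G).

Lemma char_zero_subproof : is_character (fun _ : G => 1 : R[i]).
Proof.
split=> [g|g h|g]; [exact: cst_continuous|by rewrite mulr1|by rewrite normr1].
Qed.

Lemma char_opp_subproof j : is_character (fun g => j (- g)).
Proof.
have [cj jD j1] := characterP j; split=> [g|g h|g]; last exact: j1.
  by apply: continuous_comp; [exact: opp_continuous|exact: cj].
by rewrite opprD jD.
Qed.

Lemma char_add_subproof j k : is_character (fun g => j g * k g).
Proof.
have [[cj jD j1] [ck kD k1]] := (characterP j, characterP k).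
split=> [g|g h|g].
- exact: (@continuousM R[i] G j k g (cj g) (ck g)).
- by rewrite jD kD mulrACA.
- by rewrite normrM j1 k1 mulr1.
Qed.

Let char_zero := Character char_zero_subproof.
Let char_opp j := Character (char_opp_subproof j).
Let char_add j k := Character (char_add_subproof j k).

Let char_addA : associative char_add.
Proof. by move=> j k l; apply: char_eq => g /=; rewrite mulrA. Qed.

Let char_addC : commutative char_add.
Proof. by move=> j k; apply: char_eq => g /=; rewrite mulrC. Qed.

Let char_add0 : left_id char_zero char_add.
Proof. by move=> j; apply: char_eq => g /=; rewrite mul1r. Qed.

Let char_addN : left_inverse char_zero char_opp char_add.
Proof.
move=> j; apply: char_eq => g /=; have [_ jD j1] := characterP j.
rewrite -jD addNr; apply: (@mulfI _ (j 0)); first by rewrite -normr_gt0 j1.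
by rewrite -jD addr0 mulr1.
Qed.

HB.instance Definition _ :=
  GRing.isZmodule.Build (character R G)
    char_addA char_addC char_add0 char_addN.

End CharacterGroup.

Record is_group_order (T : zmodType) (le : rel T) : Prop := {
  group_order_refl : reflexive le;
  group_order_anti : antisymmetric le;
  group_order_trans : transitive le;
  group_order_total : total le;
  group_order_add : forall x y z, le x y -> le (x + z) (y + z) }.

(* Copy of G carrying the base point 0 that g_sigma_algebraType asks for. *)
Definition pointed_group (G : topologicalZmodType) : Type := G.
HB.instance Definition _ (G : topologicalZmodType) :=
  Topological.on (pointed_group G).
HB.instance Definition _ (G : topologicalZmodType) :=
  isPointed.Build (pointed_group G) (0 : G).

Notation borel G := (g_sigma_algebraType (@open (pointed_group G))).

(* Invariant Radon measure; the normalization is the probability structure that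
   mu carries wherever this predicate is used. *)
Record is_haar (R : realType) (G : topologicalZmodType)
    (mu : probability (borel G) R) : Prop := {
  haar_shift : forall (g : G) (A : set (borel G)), measurable A ->
    mu [set (g + x : G) | x in A] = mu A;
  haar_outer : forall A : set (borel G), measurable A ->
    mu A = ereal_inf [set mu U | U in [set U : set G | open U /\ A `<=` U]];
  haar_inner : forall U : set G, open U ->
    mu U = ereal_sup [set mu K | K in [set K : set G | compact K /\ K `<=` U]] }.

Section FunctionAlgebras.
Variables (R : realType) (G : topologicalZmodType).
Implicit Types (a b : G -> R[i]) (U B S T : set (G -> R[i])).
Implicit Types (N : (G -> R[i]) -> R).

Definition CG : set (G -> R[i]) := [set a | continuous a].

Definition trig_poly : set (G -> R[i]) :=
  [set a | exists (s : seq (character R G)) (c : character R G -> R[i]),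
     forall g, a g = \sum_(j <- s) c j * j g].

(* U is meant to be a unital subalgebra of C(G), with unit the constant 1. *)
Definition GL U : set (G -> R[i]) :=
  [set a | U a /\ exists2 b, U b & a * b = 1].

Definition dense_in N S T : Prop :=
  S `<=` T /\
  forall a, T a -> forall e : R, 0 < e -> exists2 b, S b & N (a - b) < e.

(* B, with the norm N (only the values of N on B matter), is a unital Banach
   algebra contained in C(G); N need not be the sup norm, and N 1 = 1 is not
   required. *)
Record is_banach_subalgebra B N : Prop := {
  balg_sub : B `<=` CG;
  balg1 : B 1;
  balgD : forall a b, B a -> B b -> B (a + b);
  balgM : forall a b, B a -> B b -> B (a * b);
  balgZ : forall (c : R[i]) a, B a -> B (c *: a);
  bnorm_ge0 : forall a, B a -> 0 <= N a;
  bnorm0_eq0 : forall a, B a -> N a = 0 -> a = 0;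
  bnormD : forall a b, B a -> B b -> N (a + b) <= N a + N b;
  bnormZ : forall (c : R[i]) a, B a -> (N (c *: a))%:C = `|c| * (N a)%:C;
  bnormM : forall a b, B a -> B b -> N (a * b) <= N a * N b;
  bnorm_complete : forall u : nat -> G -> R[i], (forall n, B (u n)) ->
    (forall e : R, 0 < e ->
       exists n0, forall m n, (n0 <= m)%N -> (n0 <= n)%N ->
         N (u m - u n) < e) ->
    exists2 a, B a & (fun n => N (u n - a)) @ \oo --> (0 : R) }.

Record admissible B N : Prop := {
  admissible_banach : is_banach_subalgebra B N;
  admissible_dense : dense_in N trig_poly B;
  admissible_inverse_closed : B `&` GL CG `<=` GL B }.

Variables (mu : probability (borel G) R) (le : rel (character R G)).
Implicit Types j : character R G.

Definition cintegral (f : G -> R[i]) : R[i] :=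
  (\int[mu]_x complex.Re (f x)) +i* (\int[mu]_x complex.Im (f x)).

Definition fourier_coef a j : R[i] := cintegral (fun g => a g * (j g)^*).

Definition spectrum a : set (character R G) :=
  [set j | fourier_coef a j != 0].

Definition Gamma_plus : set (character R G) := [set j | le 0 j].
Definition Gamma_minus : set (character R G) := [set j | le j 0].

Definition Bplus B : set (G -> R[i]) :=
  [set a | B a /\ spectrum a `<=` Gamma_plus].
Definition Bminus B : set (G -> R[i]) :=
  [set a | B a /\ spectrum a `<=` Gamma_minus].

Definition decomposing B : Prop :=
  B = [set p + m | p in Bplus B & m in Bminus B].

Definition GLF B : set (G -> R[i]) :=
  [set a | B a /\ exists am ap j,
     [/\ GL (Bminus B) am, GL (Bplus B) ap &
         forall g, a g = am g * j g * ap g]].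

End FunctionAlgebras.

(* Main.v *)
(** Proof idea.  Writing [x ~ y] for [x = y exp(h)] with [h] in [B], a unit that
    is uniformly close to 1 is [~ 1]: inverse closedness keeps the segment from 1
    to it inside the units of [B].  Hence a unit may be replaced by a trigonometric
    polynomial, that is, by a Laurent polynomial in finitely many independent
    characters, which map [G] onto a torus; lifting its logarithm to the universal
    cover of the torus and reading off the periods gives the Bohr-van Kampen
    theorem [a = <j,.> exp(h)] with [h] in [B].  Approximating [h] by a
    trigonometric polynomial [s = s_- + s_+] yields (a), and one half of (b).

    For the other half let [exp(f) = a_- <j,.> a_+].  An L2 positivity argument for
    elements close to 1 gives [j = 0] and shows that [a_-] and [a_+] have
    logarithms in [B].  If [exp(h)] has spectrum in [Gamma_+] then so does [h]: for
    [s] close to [h] the function [exp(s_-)] is close to 1 in L2, and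
    [log |exp(s_-)| <= |exp(s_-)| - 1] has mean zero, so the real part of [s_-] is
    small in L1, and hence so are the Fourier coefficients of [s_-].  Thus [f] is
    the sum of the two logarithms, up to a constant because [G] is connected. *)
Require Import Defs.
From HB Require Import structures.
From mathcomp Require Import all_boot all_order all_algebra.
From mathcomp Require Import complex.
From mathcomp Require Import all_classical all_reals all_analysis.
From mathcomp Require Import ring lra zify intdiv.

Set Implicit Arguments.
Unset Strict Implicit.
Unset Printing Implicit Defensive.
Import Order.TTheory GRing.Theory Num.Theory.
Import numFieldNormedType.Exports.

Local Open Scope classical_set_scope.
Local Open Scope complex_scope.
Local Open Scope ring_scope.

(** The norm of [B] dominates the sup norm ([nm_le_bnorm]), but not conversely, and cutting a
    spectrum down to [Gamma_plus] need not even map [B] into itself. Hence spectra are cut only on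
    trigonometric polynomials, where this is algebra, and the pieces are estimated in L2 or L1,
    never in the norm of [B]. For the same reason the spectrum of a product is located by
    orthogonality ([ip_disjoint]) and not by multiplying series. There are two ways of being close
    to 1. A logarithm in [B] comes directly from closeness in norm ([exists_flog]); the lifted
    logarithm of a unit is only a continuous function on [G], so correcting by it leaves a unit that
    is merely uniformly close to 1, and [fexp_segment] bridges the gap. A single kernel replaces the
    structure theory of [G]: its mean decays polynomially in the degree while its values away from
    the centre decay geometrically. This gives both the surjectivity onto the torus and the uniform
    approximation by trigonometric polynomials. Statements about [Gamma_minus] are those about
    [Gamma_plus] for the reversed order. *)

Notation nm := Normc.normc.

(** * The complex exponential and its local inverse, with explicit constants *)

Section ComplexExponential.
Variable R : realType.
Implicit Types (x y : R) (z w : R[i]).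

Lemma normcE z : `|z| = (nm z)%:C. Proof. by []. Qed.

Lemma nm_ge0 z : 0 <= nm z.
Proof. by case: z => a b; exact: sqrtr_ge0. Qed.

Lemma nm0 : nm (0 : R[i]) = 0. Proof. exact: Normc.normc0. Qed.

Lemma nm1 : nm (1 : R[i]) = 1. Proof. exact: Normc.normc1. Qed.

Lemma nmM z w : nm (z * w) = nm z * nm w. Proof. exact: Normc.normcM. Qed.

Lemma nmV z : nm z^-1 = (nm z)^-1. Proof. exact: Normc.normcV. Qed.

Lemma nmX z n : nm (z ^+ n) = nm z ^+ n.
Proof. by elim: n => [|n IH]; rewrite ?expr0 ?nm1// !exprS nmM IH. Qed.

Lemma nmD z w : nm (z + w) <= nm z + nm w. Proof. exact: le_normcD. Qed.

Lemma nmN z : nm (- z) = nm z. Proof. exact: normcN. Qed.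

Lemma nm_distC z w : nm (z - w) = nm (w - z).
Proof. by rewrite -nmN opprB. Qed.

Lemma nm_triangle z w t : nm (z - t) <= nm (z - w) + nm (w - t).
Proof. by rewrite -[z - t](subrKA w); exact: nmD. Qed.

Lemma nm_eq0 z : (nm z == 0) = (z == 0).
Proof.
by apply/eqP/eqP => [/Normc.eq0_normc//|->]; exact: nm0.
Qed.

Lemma nm_gt0 z : (0 < nm z) = (z != 0).
Proof. by rewrite lt_def nm_ge0 andbT nm_eq0. Qed.

Lemma nm_real x : nm x%:C = `|x|.
Proof. by rewrite /= expr0n addr0 sqrtr_sqr. Qed.

Lemma conjcE z : z^* = (complex.Re z) -i* (complex.Im z).
Proof. by case: z. Qed.

Lemma nm_conj z : nm z^* = nm z.
Proof. by case: z => a b /=; rewrite sqrrN. Qed.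

Lemma nm_sqr z : nm z ^+ 2 = complex.Re z ^+ 2 + complex.Im z ^+ 2.
Proof. by case: z => a b /=; rewrite sqr_sqrtr// addr_ge0 ?sqr_ge0. Qed.

Lemma mulcJ_nm z : z * z^* = (nm z ^+ 2)%:C.
Proof. by rewrite -sqr_normc normcE rmorphXn. Qed.

Lemma abs_Re_le z : `|complex.Re z| <= nm z.
Proof.
rewrite -(@ler_pXn2r _ 2) ?nnegrE ?nm_ge0// nm_sqr real_normK ?num_real//.
by rewrite lerDl sqr_ge0.
Qed.

Lemma abs_Im_le z : `|complex.Im z| <= nm z.
Proof.
rewrite -(@ler_pXn2r _ 2) ?nnegrE ?nm_ge0// nm_sqr real_normK ?num_real//.
by rewrite lerDr sqr_ge0.
Qed.

Lemma nm_le_Re_Im z : nm z <= `|complex.Re z| + `|complex.Im z|.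
Proof.
rewrite -(@ler_pXn2r _ 2) ?nnegrE ?nm_ge0 ?addr_ge0// nm_sqr sqrrD.
rewrite !real_normK ?num_real// lerD2r lerDl mulrn_wge0//.
Qed.

Lemma nm_sum (I : Type) (s : seq I) (P : pred I) (F : I -> R[i]) :
  nm (\sum_(i <- s | P i) F i) <= \sum_(i <- s | P i) nm (F i).
Proof.
elim/big_rec2: _ => [|i y z _ le_yz]; first by rewrite nm0.
by apply: le_trans (nmD _ _) _; rewrite lerD2l.
Qed.

Lemma ReD z w : complex.Re (z + w) = complex.Re z + complex.Re w.
Proof. by case: z w => a b [c d]. Qed.

Lemma ImD z w : complex.Im (z + w) = complex.Im z + complex.Im w.
Proof. by case: z w => a b [c d]. Qed.

Lemma ReN z : complex.Re (- z) = - complex.Re z. Proof. by case: z. Qed.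

Lemma ImN z : complex.Im (- z) = - complex.Im z. Proof. by case: z. Qed.

Lemma ReM_real x z : complex.Re (x%:C * z) = x * complex.Re z.
Proof. by case: z => a b /=; rewrite mul0r subr0. Qed.

Definition cexp z : R[i] :=
  (expR (complex.Re z))%:C * (cos (complex.Im z) +i* sin (complex.Im z)).

Lemma cexpD z w : cexp (z + w) = cexp z * cexp w.
Proof.
rewrite /cexp ReD ImD expRD cosD sinD rmorphM/= mulrACA; congr (_ * _).
by rewrite -[RHS]/(Complex _ _) [cos _ * sin _ + _]addrC.
Qed.

Lemma cexp0 : cexp 0 = 1.
Proof. by rewrite /cexp/= expR0 cos0 sin0 mul1r. Qed.

Lemma nm_cexp z : nm (cexp z) = expR (complex.Re z).
Proof.
by rewrite /cexp nmM nm_real ger0_norm ?expR_ge0// /= cos2Dsin2 sqrtr1 mulr1.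
Qed.

Lemma cexp_neq0 z : cexp z != 0.
Proof. by rewrite -nm_gt0 nm_cexp expR_gt0. Qed.

Lemma cexpN z : cexp (- z) = (cexp z)^-1.
Proof.
by apply: (mulfI (cexp_neq0 z)); rewrite -cexpD subrr cexp0 divff ?cexp_neq0.
Qed.

Lemma cexpMn z n : cexp (z *+ n) = cexp z ^+ n.
Proof.
by elim: n => [|n IH]; rewrite ?mulr0n ?cexp0 ?expr0// mulrS cexpD IH exprS.
Qed.

Lemma cexpMz z (k : int) : cexp (z *~ k) = cexp z ^ k.
Proof.
by case: k => n; rewrite ?cexpMn// NegzE mulrNz cexpN -pmulrn cexpMn -exprnN.
Qed.

Lemma cexp_sum (I : Type) (s : seq I) (F : I -> R[i]) :
  cexp (\sum_(i <- s) F i) = \prod_(i <- s) cexp (F i).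
Proof. by apply: (big_morph cexp cexpD cexp0). Qed.

Lemma abs_sin_le x : `|sin x| <= `|x|.
Proof.
wlog x0 : x / 0 <= x.
  move=> H; have [/H//|/ltW x0] := leP 0 x.
  by have := H (- x); rewrite sinN !normrN; apply; rewrite oppr_ge0.
have [c _] := MVT_segment x0 (fun y _ => is_derive_sin y)
  (continuous_subspaceT (@continuous_sin R)).
rewrite sin0 !subr0 => ->; rewrite normrM ler_piMl//.
exact: cos_max.
Qed.

Lemma one_sub_cos_le x : `|cos x - 1| <= x ^+ 2 / 2.
Proof.
have -> : cos x - 1 = - (sin (x / 2) ^+ 2 *+ 2).
  have -> : cos x = cos (x / 2 *+ 2) by congr cos; rewrite mulr2n; lra.
  by rewrite cos_mulr2n cos2sin2; ring.
rewrite normrN ger0_norm ?mulrn_wge0 ?sqr_ge0//.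
have : sin (x / 2) ^+ 2 <= (x / 2) ^+ 2.
  rewrite -[leLHS]real_normK ?num_real// -[leRHS]real_normK ?num_real//.
  by rewrite ler_pXn2r ?nnegrE// abs_sin_le.
by lra.
Qed.

(** For [x >= 0] the mean value theorem gives [sin x - x = (cos c - 1) * x] with [c] between 0 and
    [x], and [c ^ 2 / 2 <= x] as soon as [x <= 2]. A quadratic bound is all that [cexp_sub_le]
    needs. *)
Lemma abs_sin_sub_le x : `|x| <= 2 -> `|sin x - x| <= x ^+ 2.
Proof.
wlog x0 : x / 0 <= x.
  move=> H; have [/H//|/ltW x0] := leP 0 x.
  have := H (- x); rewrite sinN normrN sqrrN -opprD normrN; apply.
  by rewrite oppr_ge0.
move=> x2.
have d y : is_derive y 1 (fun t : R => sin t - t) (cos y - 1).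
  by apply: is_deriveB.
have cont : {within `[0, x], continuous (fun t : R => sin t - t)}.
  by apply: continuous_subspaceT => t; apply: cvgB => //; exact: continuous_sin.
have [c cI] := MVT_segment x0 (fun y _ => d y) cont.
rewrite sin0 !subr0 => ->; rewrite normrM expr2 (ger0_norm x0).
rewrite ler_wpM2r//.
  apply: le_trans (one_sub_cos_le _) _.
  move: cI; rewrite in_itv/= => /andP[c0 cx].
  move: x2; rewrite ger0_norm// => x2.
  rewrite -(ger0_norm x0) ger0_norm//.
  have : c * c <= x * 2 by apply: ler_pM => //; exact: le_trans cx _.
  by rewrite -expr2; lra.
Qed.

(** Both bounds come from [1 + t <= expR t]: at [t = x] for the lower one, at [t = - x] and
    inverted, [expR x <= 1 / (1 - x)], for the upper one. *)
Lemma expR_sub_le x : `|x| <= 2^-1 -> 0 <= expR x - 1 - x <= 2 * x ^+ 2.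
Proof.
move=> xh; have := expR_ge1Dx x; have := expR_ge1Dx (- x).
rewrite expRN => h1 h2; apply/andP; split; first by lra.
have /andP[xl xu] : - 2^-1 <= x <= 2^-1 by rewrite -ler_norml.
have : expR x <= (1 - x)^-1 by rewrite -[leLHS]invrK lef_pV2 ?posrE ?invr_gt0 ?expR_gt0//; lra.
move=> h; suff : (1 - x)^-1 <= 1 + x + 2 * x ^+ 2 by lra.
rewrite -[leLHS]mul1r ler_pdivrMr; last by lra.
have -> : (1 + x + 2 * x ^+ 2) * (1 - x) = 1 + x ^+ 2 * (1 - 2 * x) by ring.
by rewrite lerDl mulr_ge0 ?sqr_ge0//; lra.
Qed.

(** As [cexp] is built from [expR], [cos] and [sin], its second-order remainder is assembled from
    theirs; 3 is a round bound for the sum of the four pieces. *)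
Lemma cexp_sub_le z : nm z <= 2^-1 -> nm (cexp z - 1 - z) <= 3 * nm z ^+ 2.
Proof.
move=> zh; apply: le_trans (nm_le_Re_Im _) _; rewrite nm_sqr.
move: (le_trans (abs_Re_le z) zh) (le_trans (abs_Im_le z) zh).
case: z {zh} => x y /= xh yh.
rewrite ?mul0r ?subr0 ?mul0r ?addr0 ?subr0 ?oppr0 ?addr0.
have /andP[e0 e1] := expR_sub_le xh.
have c1 := one_sub_cos_le y; have s1 := @abs_sin_sub_le y.
have {}s1 : `|sin y - y| <= y ^+ 2 by apply: s1; apply: le_trans yh _; lra.
have sy := abs_sin_le y.
have xl : `|x| ^+ 2 = x ^+ 2 by rewrite real_normK ?num_real.
have yl : `|y| ^+ 2 = y ^+ 2 by rewrite real_normK ?num_real.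
have -> : expR x * cos y - 1 - x = (expR x - 1 - x) * cos y + (1 + x) * (cos y - 1).
  by ring.
have -> : expR x * sin y - y = (expR x - 1) * sin y + (sin y - y) by ring.
have a1 : `|(expR x - 1 - x) * cos y| <= 2 * x ^+ 2.
  rewrite normrM (ger0_norm e0) -[leRHS]mulr1; apply: ler_pM => //.
  exact: cos_max.
have a2 : `|(1 + x) * (cos y - 1)| <= 3 / 2 * (y ^+ 2 / 2).
  rewrite normrM; apply: ler_pM => //.
  by apply: le_trans (ler_normD _ _) _; rewrite normr1; lra.
have a3 : `|(expR x - 1) * sin y| <= 2 * `|x| * `|y|.
  rewrite normrM; apply: ler_pM => //.
  have -> : expR x - 1 = (expR x - 1 - x) + x by ring.
  apply: le_trans (ler_normD _ _) _; rewrite (ger0_norm e0) mulr_natl mulr2n lerD2r.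
  apply: le_trans e1 _; rewrite -xl expr2.
  have : `|x| * `|x| <= 2^-1 * `|x| by rewrite ler_wpM2r.
  by lra.
have := ler_normD ((expR x - 1 - x) * cos y) ((1 + x) * (cos y - 1)).
have := ler_normD ((expR x - 1) * sin y) (sin y - y).
have am : 2 * `|x| * `|y| <= x ^+ 2 + y ^+ 2.
  by rewrite -xl -yl; have := sqr_ge0 (`|x| - `|y|); rewrite sqrrB; lra.
have := sqr_ge0 y; have := sqr_ge0 x.
lra.
Qed.

Lemma cexp_2pi : cexp (0 +i* (pi *+ 2)) = 1 :> R[i].
Proof. by rewrite /cexp/= expR0 cos2pi sin2pi mul1r. Qed.

Lemma cos_eq1_small x : 0 <= x < pi *+ 2 -> cos x = 1 -> x = 0.
Proof.
move=> /andP[x0 x2] cx; have pi0 := pi_gt0 R.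
have inj y : 0 <= y <= pi -> cos y = 1 -> y = 0.
  move=> /andP[y0 y1] cy; apply: cos_inj.
  - by rewrite in_itv/= y0.
  - by rewrite in_itv/= lexx ltW.
  - by rewrite cos0.
have [xpi|xpi] := leP x pi; first by apply: inj => //; rewrite x0.
have : pi *+ 2 - x = 0.
  apply: inj; last by rewrite cosB cos2pi sin2pi cx; ring.
  by apply/andP; split; move: x2; rewrite mulr2n; lra.
by move=> h; move: x2; rewrite -subr_gt0 h ltxx.
Qed.

Lemma cexp_eq1 z : cexp z = 1 ->
  exists k : int, z = 0 +i* (pi *+ 2 *~ k).
Proof.
move=> z1; have p0 : 0 < pi *+ 2 :> R by rewrite mulrn_wgt0// pi_gt0.
have Re0 : complex.Re z = 0.
  by apply: expR_inj; rewrite -nm_cexp z1 nm1 expR0.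
(* Subtracting this multiple of [2 pi] brings the imaginary part into [[0, 2 pi)], where [cos]
   equals 1 only at 0. *)
exists (Num.floor (complex.Im z / (pi *+ 2))); set k := Num.floor _.
have : cexp (z - (0 +i* (pi *+ 2)) *~ k) = 1.
  by rewrite cexpD cexpN cexpMz cexp_2pi exp1rz invr1 mulr1.
have ImMz (y : R) (l : int) : (0 +i* y) *~ l = 0 +i* (y *~ l).
  have E n : (0 +i* y) *+ n = 0 +i* (y *+ n).
    by elim: n => [//|n IH]; rewrite !mulrS IH -[LHS]/(Complex _ _) addr0.
  case: l => n; first by rewrite -!pmulrn E.
  by rewrite NegzE !mulrNz -!pmulrn E -[LHS]/(Complex _ _) oppr0.
rewrite ImMz; move: Re0 {z1}; rewrite /k {k}; case: z => x y /= ->.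
rewrite -[_ - _]/(Complex _ _) /cexp/= subrr expR0 mul1r => -[cy _].
congr (_ +i* _); apply/eqP; rewrite -subr_eq0; apply/eqP.
apply: cos_eq1_small => //.
set k := Num.floor _.
have /andP[k1 k2] : k%:~R <= y / (pi *+ 2) < (k + 1)%:~R.
  by rewrite Num.Theory.ge_floor Num.Theory.floorD1_gt.
move: k1 k2; rewrite ler_pdivlMr// ltr_pdivrMr// => k1 k2.
rewrite -mulrzr subr_ge0 [leLHS]mulrC k1/=.
by move: k2; rewrite intrD mulrDl mul1r -mulrzr; lra.
Qed.

(** A nonzero period has modulus at least [2 pi], and [pi >= 2] already makes this at least 4. *)
Lemma cexp_eq1_small z : cexp z = 1 -> nm z < 4 -> z = 0.
Proof.
move=> /cexp_eq1[k ->] /=; rewrite expr0n add0r sqrtr_sqr => h.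
have [->|k0] := eqVneq k 0; first by rewrite mulr0z.
move: h; rewrite -mulrzr normrM => h.
have : 1 <= `|k%:~R : R| by rewrite -intr_norm -[1]/(1%:~R) ler_int; lia.
have := pi_ge2 R; rewrite mulr2n ger0_norm in h; last by have := pi_ge0 R; lra.
move=> p2 k1.
exfalso; suff : (4 : R) * 1 <= (pi + pi) * `|k%:~R : R| by lra.
by rewrite ler_pM//; lra.
Qed.

(** This uniqueness glues local logarithms: two candidates with the same exponential agree once both
    are short. *)
Lemma cexp_small_inj z w : nm z < 2 -> nm w < 2 -> cexp z = cexp w -> z = w.
Proof.
move=> z2 w2 zw; apply/eqP; rewrite -subr_eq0; apply/eqP.
apply: cexp_eq1_small; first by rewrite cexpD cexpN zw divff ?cexp_neq0.
by apply: le_lt_trans (nmD _ _) _; rewrite nmN; lra.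
Qed.

Lemma exists_angle z : nm z = 1 ->
  exists2 x, - pi <= x <= pi & z = cexp (0 +i* x).
Proof.
case: z => a b /= h.
have ab1 : a ^+ 2 + b ^+ 2 = 1.
  by rewrite -[LHS]sqr_sqrtr ?addr_ge0 ?sqr_ge0// h expr1n.
have a1 : -1 <= a <= 1.
  by rewrite -ler_norml -(@ler_pXn2r _ 2) ?nnegrE// real_normK ?num_real//
    expr1n -ab1 lerDl sqr_ge0.
have sa : sin (acos a) = `|b| by rewrite sin_acos// -ab1 addrAC subrr add0r sqrtr_sqr.
have ca : cos (acos a) = a by rewrite acosK.
have p0 := acos_ge0 a1; have pp := acos_lepi a1; have pi0 := pi_ge0 R.
have [b0|b0] := leP 0 b.
  exists (acos a); first by rewrite pp andbT (le_trans _ p0)// oppr_le0.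
  by rewrite /cexp/= expR0 mul1r ca sa ger0_norm.
exists (- acos a); first by rewrite lerN2 pp/= (le_trans _ pi0)// oppr_le0.
by rewrite /cexp/= expR0 mul1r cosN sinN ca sa ltr0_norm// opprK.
Qed.

Lemma abs_ln_le x : `|x - 1| <= 2^-1 -> `|ln x| <= 2 * `|x - 1|.
Proof.
move=> xh; have /andP[xl xu] : - 2^-1 <= x - 1 <= 2^-1 by rewrite -ler_norml.
have x0 : 0 < x by lra.
have up y : 0 < y -> ln y <= y - 1.
  move=> y0; have := @le_ln1Dx R (y - 1); rewrite [1 + _]addrC subrK; apply; lra.
rewrite ler_norml; apply/andP; split; last first.
  by apply: le_trans (up _ x0) _; have := ler_norm (x - 1); have := normr_ge0 (x - 1); lra.
have := up x^-1; rewrite invr_gt0 => /(_ x0); rewrite lnV ?posrE// => h.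
have : x^-1 - 1 <= 2 * `|x - 1|; last by lra.
have -> : x^-1 - 1 = (1 - x) * x^-1 by rewrite mulrBl mul1r divff ?gt_eqF.
apply: le_trans (ler_norm _) _; rewrite normrM mulrC distrC ler_wpM2r//.
rewrite normfV gtr0_norm// -[leRHS]invrK lef_pV2 ?posrE ?invr_gt0//; lra.
Qed.

Lemma abs_atan_le x : `|atan x| <= `|x|.
Proof.
wlog x0 : x / 0 <= x.
  move=> H; have [/H//|/ltW x0] := leP 0 x.
  by have := H (- x); rewrite atanN !normrN; apply; rewrite oppr_ge0.
have [c _] := MVT_segment x0 (fun y _ => is_derive1_atan y)
  (continuous_subspaceT (@continuous_atan R)).
rewrite atan0 !subr0 => ->; rewrite normrM ler_piMl// normfV.
have : 1 <= 1 + c ^+ 2 by rewrite lerDl sqr_ge0.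
by move=> h; rewrite ger0_norm; [rewrite invf_le1//|]; lra.
Qed.

(** The disc of radius 1/2 about 1 lies in the half plane [Re >= 1/2], where
    [ln |z| + i atan (y / x)] is a logarithm. The factor 4 is 2 for [ln] plus 2 for [atan]. *)
Lemma exists_small_log z : nm (z - 1) <= 2^-1 ->
  exists2 w, cexp w = z & nm w <= 4 * nm (z - 1).
Proof.
move=> zh; case: z zh => x y zh.
have xh : `|x - 1| <= nm ((x +i* y) - 1) by exact: (abs_Re_le ((x +i* y) - 1)).
have yh : `|y| <= nm ((x +i* y) - 1).
  by have := abs_Im_le ((x +i* y) - 1); rewrite /= oppr0 addr0.
set e := nm _ in zh xh yh *.
have /andP[xl xu] : - 2^-1 <= x - 1 <= 2^-1.
  by rewrite -ler_norml; apply: le_trans xh _.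
have x0 : 0 < x by lra.
have z0 : 0 < nm (x +i* y).
  rewrite nm_gt0; apply/eqP => -[x00 _]; move: x0; rewrite x00 ltxx //.
have ze : `|nm (x +i* y) - 1| <= e.
  rewrite -nm1 ler_norml; apply/andP; split.
    have := nmD (1 - (x +i* y)) (x +i* y); rewrite subrK nm_distC -/e; lra.
  have := nmD ((x +i* y) - 1) 1; rewrite subrK -/e; lra.
exists (ln (nm (x +i* y)) +i* atan (y / x)); last first.
  apply: le_trans (nm_le_Re_Im _) _ => /=.
  have a1 := abs_ln_le (le_trans ze zh).
  have a2 := abs_atan_le (y / x).
  have : `|y / x| <= 2 * e; last by lra.
  rewrite normrM mulrC normfV ler_pM ?invr_ge0// gtr0_norm//.
  by rewrite -[leRHS]invrK lef_pV2 ?posrE ?invr_gt0//; lra.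
rewrite /cexp /= lnK ?posrE//.
set t := atan _.
have ct : 0 < cos t by apply: cos_gt0_pihalf; rewrite atan_gtNpi2 atan_ltpi2.
have st : sin t = cos t * (y / x).
  by rewrite -(atanK (y / x)) /tan mulrC divfK ?gt_eqF.
have ct2 : cos t ^+ 2 * (x ^+ 2 + y ^+ 2) = x ^+ 2.
  have := cos2Dsin2 t; rewrite st => h.
  rewrite -[RHS]mulr1 -h; field; lra.
have nct : Num.sqrt (x ^+ 2 + y ^+ 2) * cos t = x.
  apply/eqP; rewrite -(@eqrXn2 _ 2)// ?mulr_ge0 ?sqrtr_ge0 ?ltW//.
  by rewrite exprMn sqr_sqrtr ?addr_ge0 ?sqr_ge0// mulrC ct2.
rewrite -[LHS]/(Complex _ _) !mul0r subr0 addr0 st mulrA.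
congr (_ +i* _) => //; rewrite !mulrA nct mulrC mulKf ?gt_eqF//.
Qed.

Lemma nm_cexp_sub1_le z (e : R) : nm z <= e -> e <= 8^-1 -> nm (cexp z - 1) <= 2 * e.
Proof.
move=> ze e8; have z2 : nm z <= 2^-1 by lra.
have h := cexp_sub_le z2; have n0 := nm_ge0 z.
have -> : cexp z - 1 = (cexp z - 1 - z) + z by rewrite subrK.
apply: le_trans (nmD _ _) _.
have : nm z ^+ 2 <= 8^-1 * nm z by rewrite expr2 ler_wpM2r//; lra.
lra.
Qed.

End ComplexExponential.

(** * Continuous complex functions, with real epsilons *)

Section ComplexContinuity.
Variables (R : realType) (T : topologicalType).
Implicit Types (f h : T -> R[i]).

(** In the norm topology of [R[i]] epsilon is a positive element of [R[i]]; positivity forces it to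
    be real. *)
Lemma continuousCP f : continuous f <->
  forall x (e : R), 0 < e -> \forall y \near x, nm (f x - f y) < e.
Proof.
split=> [cf x e e0|H x].
  have := cf x; move/cvgrPdist_lt => /(_ e%:C); rewrite ltcR => /(_ e0).
  by apply: filterS => y; rewrite normcE ltcR.
apply/cvgrPdist_lt => -[e e'] e0.
move: e0; rewrite ltcE /= => /andP[/eqP -> e0].
apply: filterS (H x e e0) => y; rewrite -/(real_complex _ e).
by rewrite normcE ltcR.
Qed.

Lemma continuous_nm_le f (u : T -> R) :
  continuous f -> (forall x y, `|u x - u y| <= nm (f x - f y)) -> continuous u.
Proof.
move=> /continuousCP cf ule x; apply/cvgrPdist_lt => e e0.
by apply: filterS (cf x e e0) => y; apply: le_lt_trans.
Qed.

Lemma continuous_nm_lip f h (k : R) :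
  continuous f -> (forall x y, nm (h x - h y) <= k * nm (f x - f y)) -> continuous h.
Proof.
move=> /continuousCP cf hle; apply/continuousCP => x e e0.
have k0 : 0 < `|k| + 1 by rewrite ltr_wpDl.
apply: filterS (cf x _ (divr_gt0 e0 k0)) => y; rewrite ltr_pdivlMr// => h1.
apply: le_lt_trans (hle x y) _; apply: le_lt_trans _ h1.
rewrite mulrC ler_wpM2l ?nm_ge0//.
by apply: le_trans (ler_norm _) _; rewrite lerDl.
Qed.

Lemma continuous_Re f : continuous f -> continuous (fun x => complex.Re (f x)).
Proof.
move=> cf; apply: (continuous_nm_le cf) => x y.
by rewrite -ReN -ReD abs_Re_le.
Qed.

Lemma continuous_Im f : continuous f -> continuous (fun x => complex.Im (f x)).
Proof.
move=> cf; apply: (continuous_nm_le cf) => x y.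
by rewrite -ImN -ImD abs_Im_le.
Qed.

Lemma continuous_real_complex (u : T -> R) :
  continuous u -> continuous (fun x => (u x)%:C).
Proof.
move=> cu; apply/continuousCP => x e e0.
move: (cu x) => /cvgrPdist_lt/(_ e e0); apply: filterS => y.
by rewrite -rmorphB nm_real.
Qed.

Lemma continuous_nm f : continuous f -> continuous (fun x => nm (f x)).
Proof.
move=> cf; apply: (continuous_nm_le cf) => x y.
rewrite ler_norml; apply/andP; split.
  have := nmD (f y - f x) (f x); rewrite subrK nm_distC; lra.
have := nmD (f x - f y) (f y); rewrite subrK; lra.
Qed.

Lemma continuous_conj f : continuous f -> continuous (fun x => (f x)^*).
Proof.
move=> cf; apply: (continuous_nm_lip (k := 1) cf) => x y.
by rewrite mul1r -rmorphB nm_conj.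
Qed.

Lemma continuousCD f h : continuous f -> continuous h -> continuous (f + h).
Proof. by move=> cf ch x; apply: cvgD; [exact: cf|exact: ch]. Qed.

Lemma continuousCM f h : continuous f -> continuous h -> continuous (f * h).
Proof.
by move=> cf ch x; exact: (@continuousM R[i] T f h x (cf x) (ch x)).
Qed.

Lemma continuousCZ f (c : R[i]) : continuous f -> continuous (c *: f).
Proof.
move=> cf; apply: (continuous_nm_lip (k := nm c) cf) => x y.
by rewrite -nmM mulrBr.
Qed.

Lemma continuousCN f : continuous f -> continuous (- f).
Proof. by move=> cf; rewrite -scaleN1r; exact: continuousCZ. Qed.

Lemma continuousCB f h : continuous f -> continuous h -> continuous (f - h).
Proof. by move=> cf ch; exact: (continuousCD cf (continuousCN ch)). Qed.

Lemma continuousC_cst (c : R[i]) : continuous (cst c : T -> R[i]).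
Proof. by move=> x; exact: cvg_cst. Qed.

Lemma compact_nm_bounded f : compact [set: T] -> continuous f ->
  exists M : R, forall x, nm (f x) <= M.
Proof.
move=> cT /continuous_nm cf.
have /compact_bounded : compact [set nm (f x) | x in [set: T]].
  by apply: continuous_compact => //; exact: continuous_subspaceT.
move=> [M [_ HM]]; exists (M + 1) => x.
have := HM (M + 1); rewrite ltrDl ltr01 => /(_ isT (nm (f x))) /=.
rewrite ger0_norm ?nm_ge0//; apply; by exists x.
Qed.

Lemma compact_nm_bounded_below f : compact [set: T] -> continuous f ->
  (forall x, f x != 0) -> exists2 d : R, 0 < d & forall x, d <= nm (f x).
Proof.
move=> cT cf f0.
have cfi : continuous (fun x => (f x)^-1).
  by move=> x; apply: cvgV; [exact: f0|exact: cf].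
have [M HM] := compact_nm_bounded cT cfi.
exists (`|M| + 1)^-1; first by rewrite invr_gt0 ltr_wpDl.
move=> x; have n0 : 0 < nm (f x) by rewrite nm_gt0.
rewrite -[leRHS]invrK lef_pV2 ?posrE ?invr_gt0 ?ltr_wpDl//.
rewrite -nmV; apply: le_trans (HM x) _; apply: le_trans (ler_norm _) _.
by rewrite lerDl.
Qed.

End ComplexContinuity.

(** * The complex integral of continuous functions *)

Section HaarIntegral.
Variables (R : realType) (G : topologicalZmodType).
Variable mu : probability (borel G) R.
Hypothesis G_compact : compact [set: G].
Implicit Types (a b f h : G -> R[i]) (u v : G -> R).

Local Notation I := (cintegral mu).

Lemma continuous_borel_measurable u :
  continuous u -> measurable_fun [set: borel G] (u : borel G -> R).
Proof.
move=> /continuousP cu; apply: (measurability _ (measurable_realfun.RGenOpens.measurableE R)).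
move=> _ [_ [x [y ->] <-]]; rewrite setTI.
by apply: sub_sigma_algebra; apply: cu; exact: interval_open.
Qed.

Lemma compact_abs_bounded u : continuous u -> exists M : R, forall x, `|u x| <= M.
Proof.
move=> /continuous_real_complex cu.
have [M HM] := compact_nm_bounded G_compact cu.
by exists M => x; rewrite -nm_real.
Qed.

Lemma continuous_integrable u :
  continuous u -> mu.-integrable [set: borel G] (EFin \o (u : borel G -> R)).
Proof.
move=> cu; apply: measurable_bounded_integrable => //.
- by rewrite -ge0_fin_numE//; exact: fin_num_measure.
- exact: continuous_borel_measurable.
- have [M HM] := compact_abs_bounded cu.
  exists M; split; first exact: num_real.
  by move=> x xM y _ /=; apply: le_trans (HM y) (ltW xM).
Qed.

Lemma integrable_Re f : continuous f ->
  mu.-integrable [set: borel G] (EFin \o (fun x : borel G => complex.Re (f x))).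
Proof. by move=> cf; exact: (continuous_integrable (continuous_Re cf)). Qed.

Lemma integrable_Im f : continuous f ->
  mu.-integrable [set: borel G] (EFin \o (fun x : borel G => complex.Im (f x))).
Proof. by move=> cf; exact: (continuous_integrable (continuous_Im cf)). Qed.

Lemma cintegralD f h : continuous f -> continuous h -> I (f + h) = I f + I h.
Proof.
move=> cf ch; rewrite /cintegral -[RHS]/(Complex _ _); congr (_ +i* _).
  rewrite -(RintegralD _ (integrable_Re cf) (integrable_Re ch))//.
  by apply: eq_Rintegral => x _; rewrite /= -ReD.
rewrite -(RintegralD _ (integrable_Im cf) (integrable_Im ch))//.
by apply: eq_Rintegral => x _; rewrite /= -ImD.
Qed.

Lemma cintegralZ c f : continuous f -> I (c *: f) = c * I f.
Proof.
move=> cf; have iR := integrable_Re cf; have iI := integrable_Im cf.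
have iRZ k : mu.-integrable [set: borel G]
    (EFin \o (fun x : borel G => k * complex.Re (f x))).
  apply: continuous_integrable => x; apply: cvgM; first exact: cvg_cst.
  exact: (continuous_Re cf).
have iIZ k : mu.-integrable [set: borel G]
    (EFin \o (fun x : borel G => k * complex.Im (f x))).
  apply: continuous_integrable => x; apply: cvgM; first exact: cvg_cst.
  exact: (continuous_Im cf).
case: c => p q; rewrite /cintegral -[RHS]/(Complex _ _); congr (_ +i* _).
  rewrite -!RintegralZl// -RintegralB//.
  by apply: eq_Rintegral => x _ /=; rewrite -[(_ *: f) x]/((p +i* q) * f x); case: (f x).
rewrite -!RintegralZl// -RintegralD//.
by apply: eq_Rintegral => x _ /=; rewrite -[(_ *: f) x]/((p +i* q) * f x); case: (f x).
Qed.

Lemma cintegral_cst c : I (cst c) = c.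
Proof.
have E (r : R) : \int[mu]_x r = r.
  by rewrite Rintegral_cst// (congr1 fine (@probability_setT _ _ _ mu)) mulr1.
by rewrite /cintegral !E; case: c.
Qed.

Lemma cintegral_conj f : continuous f -> I (fun x => (f x)^*) = (I f)^*.
Proof.
move=> cf; rewrite /cintegral -[RHS]/(Complex _ _); congr (_ +i* _).
  by apply: eq_Rintegral => x _; rewrite conjcE.
rewrite -mulN1r -(RintegralZl _ _ (integrable_Im cf))//.
by apply: eq_Rintegral => x _; rewrite conjcE mulN1r.
Qed.

Lemma Re_cintegral_le f h : continuous f -> continuous h ->
  (forall x, complex.Re (f x) <= complex.Re (h x)) ->
  complex.Re (I f) <= complex.Re (I h).
Proof.
move=> cf ch fh.
by apply: (le_Rintegral _ (integrable_Re cf) (integrable_Re ch)).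
Qed.

Lemma cintegralN f : continuous f -> I (- f) = - I f.
Proof. by move=> cf; rewrite -scaleN1r cintegralZ// mulN1r. Qed.

Lemma cintegralB f h : continuous f -> continuous h -> I (f - h) = I f - I h.
Proof.
by move=> cf ch; rewrite (cintegralD cf (continuousCN ch)) (cintegralN ch).
Qed.

(* The factor 2 bounds real and imaginary parts separately. *)
Lemma nm_cintegral_le f u : continuous f -> continuous u ->
  (forall x, nm (f x) <= u x) -> nm (I f) <= 2 * complex.Re (I (fun x => (u x)%:C)).
Proof.
move=> cf cu fu; have cuC := continuous_real_complex cu.
have key h : continuous h -> (forall x, nm (h x) <= u x) ->
    `|complex.Re (I h)| <= complex.Re (I (fun x => (u x)%:C)).
  move=> ch hu; rewrite ler_norml -ReN -(cintegralN cuC); apply/andP; split.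
    apply: (Re_cintegral_le (continuousCN cuC) ch) => x.
    rewrite -[leLHS]/(- u x).
    have := ler_norm (- complex.Re (h x)); rewrite normrN.
    by have := abs_Re_le (h x); have := hu x; lra.
  apply: (Re_cintegral_le ch cuC) => x /=.
  by have := ler_norm (complex.Re (h x)); have := abs_Re_le (h x); have := hu x; lra.
have := key f cf fu.
(* The real part of the integral of [i f] is minus the imaginary part of the integral of [f], so
   [key] bounds both parts. *)
have := key ('i%C *: f) (@continuousCZ _ _ f _ cf).
rewrite (cintegralZ _ cf) => H1 H2; move: H1.
have n1 : forall x, nm (('i%C *: f) x) <= u x.
  move=> x; rewrite -[('i%C *: f) x]/('i%C * f x) nmM /= expr0n expr1n add0r.
  by rewrite sqrtr1 mul1r.
move: (I f) H2 => z H2.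
have -> : complex.Re ('i%C * z) = - complex.Im z by case: (z) => p q /=; ring.
by rewrite normrN => /(_ n1); move: H2; have := nm_le_Re_Im z; lra.
Qed.

Lemma nm_cintegral_le_cst f (M : R) : continuous f ->
  (forall x, nm (f x) <= M) -> nm (I f) <= 2 * M.
Proof.
move=> cf fM; have := nm_cintegral_le cf (@cst_continuous G R M) fM.
by rewrite -[fun x => _]/(cst M%:C) cintegral_cst.
Qed.

End HaarIntegral.

(** * Translation invariance and orthogonality of characters *)

Section HaarOrthogonality.
Variables (R : realType) (G : topologicalZmodType).
Variable mu : probability (borel G) R.
Hypothesis G_compact : compact [set: G].
Hypothesis mu_haar : is_haar mu.
Implicit Types (j k : character R G).

Lemma continuous_translate (g : G) : continuous (fun x => g + x).
Proof.
move=> x; apply: (@continuous_comp _ _ _ (fun y : G => (g, y))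
  (fun z : G * G => z.1 + z.2)); last exact: add_continuous.
by apply: cvg_pair; [exact: cvg_cst|exact: cvg_id].
Qed.

Lemma measurable_translate (g : G) :
  measurable_fun [set: borel G] (fun x : borel G => (g + x : G) : borel G).
Proof.
refine (@measurability _ _ (borel G) (borel G) setT
  (fun x : borel G => (g + x : G) : borel G) (@open (pointed_group G)) erefl _).
move=> _ [A oA <-]; rewrite setTI; apply: sub_sigma_algebra.
have /continuousP := @continuous_translate g.
by apply.
Qed.

Lemma Rintegral_translate (g : G) (u : G -> R) : continuous u ->
  \int[mu]_x u (g + x) = \int[mu]_x u x.
Proof.
move=> cu; rewrite /Rintegral; congr fine.
have cug : continuous (fun x => u (g + x)).
  by move=> x; apply: continuous_comp; [exact: continuous_translate|exact: cu].
have := @integral_pushforward _ _ _ _ _ _ (measurable_translate g) mu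
  [set: borel G] (EFin \o u).
rewrite preimage_setT => <- //; last 2 first.
- by apply/measurable_realfun.measurable_EFinP; exact: continuous_borel_measurable.
- exact: (continuous_integrable mu G_compact cug).
apply: eq_measure_integral; first exact: measurable_translate.
move=> ? A mA _.
(* The preimage of [A] under [x |-> g + x] is the image of [A] under translation by [- g]. *)
refine (etrans _ (haar_shift mu_haar (- g) mA)); rewrite /= /pushforward; congr (mu _).
apply/seteqP; split => x /=.
  by move=> Ax; exists (g + x) => //; rewrite addKr.
by move=> [y Ay <-]; rewrite addNKr.
Qed.

Lemma character_continuous j : continuous j.
Proof. by have [] := characterP j. Qed.

Lemma characterD j x y : j (x + y) = j x * j y.
Proof. by have [] := characterP j. Qed.

Lemma nm_character j x : nm (j x) = 1.
Proof. by have [_ _ /(_ x) h] := characterP j; move: h => -[]. Qed.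

Lemma character_neq0 j x : j x != 0.
Proof. by rewrite -nm_gt0 nm_character. Qed.

Lemma cintegral_character j : j != 0 -> cintegral mu j = 0.
Proof.
move=> j0; have cj := @character_continuous j.
have [g jg] : exists g, j g != 1.
  apply: contrapT => /forallNP h; move/eqP: j0; apply; apply: char_eq => g.
  by apply/eqP/negPn/negP => /h.
have : cintegral mu (fun x => j (g + x)) = cintegral mu j.
  rewrite /cintegral (Rintegral_translate g (continuous_Re cj)).
  by rewrite (Rintegral_translate g (continuous_Im cj)).
have -> : (fun x => j (g + x)) = j g *: (j : G -> R[i]).
  by apply/funext => x; rewrite characterD.
rewrite cintegralZ// => /eqP; rewrite -subr_eq0 -{2}[cintegral _ _]mul1r -mulrBl.
by rewrite mulf_eq0 subr_eq0 (negPf jg) => /eqP.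
Qed.

End HaarOrthogonality.

(** * Finitely many elements of an ordered group lie in the span of an independent family *)

Definition independent (T : zmodType) (n : nat) (x : 'I_n -> T) := forall k : 'I_n -> int,
  \sum_i x i *~ k i = 0 -> forall i, k i = 0.

Section IndependentGenerators.
Variable T : zmodType.
Variable le : rel T.
Hypothesis le_order : is_group_order le.
Implicit Types (a b c : T) (k : int).

(** An ordered group is torsion free: if [b >= 0] then [0 <= b <= b *+ n.+1 = 0]. *)
Lemma group_order_mulrn_eq0 a (n : nat) : a *+ n.+1 = 0 -> a = 0.
Proof.
have key b : le 0 b -> b *+ n.+1 = 0 -> b = 0.
  move=> b0 bn; apply: (group_order_anti le_order); rewrite b0 andbT -bn.
  have pos m : le 0 (b *+ m).
    elim: m => [|m IH]; first exact: (group_order_refl le_order).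
    have := group_order_add le_order b IH; rewrite add0r mulrSr.
    exact: (group_order_trans le_order b0).
  by have := group_order_add le_order b (pos n); rewrite add0r -mulrSr.
move=> an; have /orP[a0|a0] := group_order_total le_order 0 a; first exact: key.
apply/eqP; rewrite -oppr_eq0; apply/eqP; apply: key; last by rewrite mulNrn an oppr0.
by have := group_order_add le_order (- a) a0; rewrite subrr add0r.
Qed.

Lemma group_order_mulrz_eq0 a k : k != 0 -> a *~ k = 0 -> a = 0.
Proof.
case: k => [[|n]|n] // _; first exact: group_order_mulrn_eq0.
by rewrite NegzE mulrNz => /eqP; rewrite oppr_eq0 => /eqP; exact: group_order_mulrn_eq0.
Qed.

Definition generates (n : nat) (x : 'I_n -> T) (s : seq T) :=
  forall a, a \in s -> exists k : 'I_n -> int, a = \sum_i x i *~ k i.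

(* A nontrivial relation becomes, after the unimodular change of generators given
   by the Smith normal form, a multiple of one generator, which is then zero. *)
Lemma drop_generator (n : nat) (x : 'I_n.+1 -> T) (s : seq T) (k : 'I_n.+1 -> int) i0 :
  generates x s -> \sum_i x i *~ k i = 0 -> k i0 != 0 ->
  exists y : 'I_n -> T, generates y s.
Proof.
move=> xs xk ki0; pose M : 'M[int]_(1, n.+1) := \row_j k j.
have [L _ [P Pu [d _ E]]] := int_Smith_normal_form M.
pose Q := invmx P; pose y l := \sum_j x j *~ P l j.
have xy j : x j = \sum_l y l *~ Q j l.
  transitivity (\sum_i x i *~ (Q *m P) j i).
    rewrite mulVmx// (bigD1 j)//= big1 => [|i ij]; first by rewrite mxE eqxx addr0.
    by rewrite mxE eq_sym (negPf ij).
  under eq_bigr do rewrite mxE mulrz_sumr.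
  rewrite exchange_big; apply: eq_bigr => l _; rewrite mulrz_suml.
  by apply: eq_bigr => i _; rewrite mulrC mulrzA.
(* Since [M = L D P], the row [M Q = L D] vanishes outside its first entry, so in the generators [y]
   the relation involves only [y 0]. *)
have MQ l : \sum_j k j * Q j l = L 0 0 * d`_0 *+ (l == 0).
  have : (M *m Q) 0 l = (L *m \matrix_(i, j) (d`_i *+ (i == j :> nat))) 0 l.
    by rewrite E mulmxK.
  rewrite !mxE big_ord1 mxE /= => h.
  transitivity (\sum_j M 0 j * Q j l); first by apply: eq_bigr => j _; rewrite mxE.
  by rewrite h eq_sym mulrnAr.
have rel0 : y 0 *~ (L 0 0 * d`_0) = 0.
  rewrite -xk; transitivity (\sum_l y l *~ (\sum_j k j * Q j l)).
    by rewrite (bigD1 0)//= MQ eqxx big1 ?addr0// => l l0; rewrite MQ (negPf l0).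
  under eq_bigr do rewrite mulrz_sumr.
  rewrite exchange_big; apply: eq_bigr => j _; rewrite xy mulrz_suml.
  by apply: eq_bigr => l _; rewrite mulrC mulrzA.
have Ld0 : L 0 0 * d`_0 != 0.
  apply: contra ki0 => /eqP Ld; have MQ0 : M *m Q = 0.
    apply/matrixP => i l; rewrite !mxE ord1.
    by under eq_bigr do rewrite mxE; rewrite MQ Ld mul0rn.
  have : M = 0 by rewrite -[M](mulmxKV Pu) -/Q MQ0 mul0mx.
  by move=> /matrixP/(_ 0 i0); rewrite !mxE => ->.
have y0 := group_order_mulrz_eq0 Ld0 rel0.
exists (fun i => y (lift 0 i)) => a /xs[c ->].
exists (fun i => \sum_j Q j (lift 0 i) * c j).
transitivity (\sum_l y l *~ (\sum_j Q j l * c j)).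
  under eq_bigr do rewrite xy mulrz_suml.
  rewrite exchange_big; apply: eq_bigr => l _; rewrite mulrz_sumr.
  by apply: eq_bigr => j _; rewrite mulrzA.
by rewrite big_ord_recl y0 mul0rz add0r.
Qed.

(** A generating family of least size is independent, as a nontrivial relation would let
    [drop_generator] shorten it. *)
Lemma exists_independent_generators (s : seq T) :
  exists (n : nat) (x : 'I_n -> T), independent x /\ generates x s.
Proof.
pose P n := `[< exists x : 'I_n -> T, generates x s >].
have exP : exists n, P n.
  exists (size s); apply/asboolP; exists (fun i => s`_i) => a as_.
  have ia : (index a s < size s)%N by rewrite index_mem.
  exists (fun i => (i == Ordinal ia)%:Z).
  rewrite (bigD1 (Ordinal ia))//= big1 => [|i ii0]; last by rewrite (negPf ii0).
  by rewrite eqxx addr0 mulr1z nth_index.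
case: (ex_minnP exP) => n /asboolP[x xs] min_n.
exists n, x; split=> // k xk i; apply/eqP/negPn/negP => ki.
case: n x xs min_n k xk i ki => [|n] x xs min_n k xk i ki; first by case: i ki.
have [y ys] := drop_generator xs xk ki.
by have := min_n n; rewrite ltnn => /(_ _)H; have := H (introT (asboolP _) (ex_intro _ y ys)).
Qed.

End IndependentGenerators.

(** * Geometric sequences as a tool for limits *)

Section GeometricDecay.
Variable R : realType.
Implicit Types (x y C q e : R).

Lemma small_geometric C q e : 0 <= C -> 0 <= q < 1 -> 0 < e ->
  exists n0, forall n, (n0 <= n)%N -> C * q ^+ n < e.
Proof.
move=> C0 /andP[q0 q1] e0.
have nq : `|q| < 1 by rewrite ger0_norm.
have e1 : 0 < e / (C + 1) by rewrite divr_gt0// ltr_wpDl.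
have := cvg_expr nq; move/cvgrPdist_lt => /(_ _ e1)[n0 _ H].
exists n0 => n /H /=; rewrite sub0r normrN ger0_norm ?exprn_ge0//.
rewrite ltr_pdivlMr ?ltr_wpDl// mulrC; apply: le_lt_trans.
by rewrite ler_wpM2r ?exprn_ge0// lerDl.
Qed.

Lemma le0_geometric x C q : 0 <= q < 1 ->
  (exists n0, forall n, (n0 <= n)%N -> x <= C * q ^+ n) -> x <= 0.
Proof.
move=> q01 [n0 H]; rewrite leNgt; apply/negP => x0.
have [n1 H1] := small_geometric (normr_ge0 C) q01 x0.
have /andP[q0 _] := q01.
have := H _ (leq_maxl n0 n1); have := H1 _ (leq_maxr n0 n1).
set m := maxn _ _; have : C * q ^+ m <= `|C| * q ^+ m.
  by rewrite ler_wpM2r ?exprn_ge0// ler_norm.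
lra.
Qed.

Lemma half01 : (0 : R) <= (2^-1 : R) < 1. Proof. by apply/andP; split; lra. Qed.

End GeometricDecay.

(** * The exponential in a Banach algebra of functions *)

Section FunctionBanachAlgebra.
Variables (R : realType) (G : topologicalZmodType).
Variables (B : set (G -> R[i])) (N : (G -> R[i]) -> R).
Hypothesis Balg : is_banach_subalgebra B N.
Implicit Types (a b x u w : G -> R[i]) (c : R[i]).

(** The exponential is pointwise; that it stays in [B], with norm estimates, is the content of
    [fexp_approx]. *)
Definition fexp x : G -> R[i] := fun g => cexp (x g).

Lemma fexpD x u : fexp (x + u) = fexp x * fexp u.
Proof. by apply/funext => g; exact: cexpD. Qed.

Lemma fexp0 : fexp 0 = 1.
Proof. by apply/funext => g; exact: cexp0. Qed.

Lemma fexpVr x : fexp x * fexp (- x) = 1.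
Proof. by rewrite -fexpD subrr fexp0. Qed.

Lemma balgN a : B a -> B (- a).
Proof. by move=> Ba; rewrite -scaleN1r; exact: (balgZ Balg). Qed.

Lemma balgB a b : B a -> B b -> B (a - b).
Proof. by move=> Ba Bb; apply: (balgD Balg) => //; exact: balgN. Qed.

Lemma balg_cst c : B (cst c).
Proof.
rewrite (_ : cst c = c *: (1 : G -> R[i])); first by apply: (balgZ Balg) => //; exact: (balg1 Balg).
by apply/funext => g; rewrite -[RHS]/(c * 1) mulr1.
Qed.

Lemma balg0 : B 0. Proof. exact: (balg_cst 0). Qed.

Lemma balgX a n : B a -> B (a ^+ n).
Proof.
move=> Ba; elim: n => [|n IH]; first exact: (balg1 Balg).
by rewrite exprS; exact: (balgM Balg).
Qed.

Lemma balg_sum (I : Type) (s : seq I) (F : I -> G -> R[i]) :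
  (forall i, B (F i)) -> B (\sum_(i <- s) F i).
Proof.
by move=> BF; elim/big_rec: _ => [|i x _ Bx]; [exact: balg0|exact: (balgD Balg)].
Qed.

Lemma balg_continuous a : B a -> continuous a.
Proof. exact: (balg_sub Balg). Qed.

Lemma bnormZnm c a : B a -> N (c *: a) = nm c * N a.
Proof.
by move=> Ba; apply: complexI; rewrite (bnormZ Balg)// normcE -rmorphM.
Qed.

Lemma bnormN a : B a -> N (- a) = N a.
Proof. by move=> Ba; rewrite -scaleN1r bnormZnm// nmN nm1 mul1r. Qed.

Lemma bnorm0 : N 0 = 0.
Proof. by rewrite -(scale0r (1 : G -> R[i])) bnormZnm ?nm0 ?mul0r//; exact: (balg1 Balg). Qed.

Lemma bnorm_distC a b : B a -> B b -> N (a - b) = N (b - a).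
Proof. by move=> Ba Bb; rewrite -bnormN ?opprB//; exact: balgB. Qed.

Lemma bnorm_triangle a b x : B a -> B b -> B x -> N (a - x) <= N (a - b) + N (b - x).
Proof.
by move=> Ba Bb Bx; rewrite -[a - x](subrKA b); apply: (bnormD Balg) => //; exact: balgB.
Qed.

Lemma bnorm_sum (I : Type) (s : seq I) (F : I -> G -> R[i]) :
  (forall i, B (F i)) -> N (\sum_(i <- s) F i) <= \sum_(i <- s) N (F i).
Proof.
move=> BF; elim: s => [|i s IH]; first by rewrite !big_nil bnorm0.
rewrite !big_cons; apply: le_trans (bnormD Balg _ _) _ => //.
  exact: balg_sum.
by rewrite lerD2l.
Qed.

(* N(1) may exceed 1, so powers are estimated relative to a factor a. *)
Lemma bnormMX a x n : B a -> B x -> N (a * x ^+ n) <= N a * N x ^+ n.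
Proof.
move=> Ba Bx; elim: n => [|n IH]; first by rewrite !expr0 !mulr1.
rewrite !exprSr !mulrA; apply: le_trans (bnormM Balg _ _) _ => //.
  by apply: (balgM Balg) => //; exact: balgX.
by rewrite ler_wpM2r// (bnorm_ge0 Balg).
Qed.

(** The increments telescope to a geometric tail. The explicit rate is kept because it is evaluated
    later, at [n = 0] for the remainder of the exponential and at every [n] for pointwise limits. *)
Lemma bnorm_geometric_cvg (u : nat -> G -> R[i]) (K q : R) :
  (forall n, B (u n)) -> 0 <= q < 1 -> 0 <= K ->
  (forall n, N (u n.+1 - u n) <= K * q ^+ n) ->
  exists2 a, B a & forall n, N (u n - a) <= K / (1 - q) * q ^+ n.
Proof.
move=> Bu q01 K0 Hu; have /andP[q0 q1] := q01.
have q1' : 0 < 1 - q by rewrite subr_gt0.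
have K1 : 0 <= K / (1 - q) by rewrite divr_ge0// ltW.
have tail n k : N (u (n + k)%N - u n) <= K / (1 - q) * (q ^+ n - q ^+ (n + k)%N).
  elim: k => [|k IH]; first by rewrite addn0 !subrr bnorm0 mulr0.
  apply: le_trans (bnorm_triangle (Bu (n + k.+1)%N) (Bu (n + k)%N) (Bu n)) _.
  rewrite addnS; apply: le_trans (lerD (Hu _) IH) _; rewrite exprS.
  rewrite -subr_ge0 le_eqVlt; apply/orP; left; rewrite eq_sym; apply/eqP.
  by field; rewrite gt_eqF.
have tail' n m : (n <= m)%N -> N (u m - u n) <= K / (1 - q) * q ^+ n.
  move=> /subnKC <-; apply: le_trans (tail _ _) _.
  by rewrite ler_wpM2l// gerBl exprn_ge0.
have [e e0|a Ba ua] := bnorm_complete Balg Bu.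
  have [n0 Hn0] := small_geometric K1 q01 e0; exists n0.
  move=> m n n0m n0n; have [mn|/ltnW nm] := leqP m n.
    rewrite bnorm_distC//; exact: le_lt_trans (tail' _ _ mn) (Hn0 _ n0m).
  exact: le_lt_trans (tail' _ _ nm) (Hn0 _ n0n).
exists a => // n; apply/ler_addgt0Pr => e e0.
move/cvgrPdist_lt: ua => /(_ _ e0)[m0 _ Hm].
have := Hm _ (leq_maxl m0 n); rewrite /= sub0r normrN => h.
apply: le_trans (bnorm_triangle (Bu n) (Bu (maxn m0 n)) Ba) _; apply: lerD.
  by rewrite bnorm_distC//; apply: tail'; exact: leq_maxr.
by apply: le_trans (ler_norm _) (ltW h).
Qed.

(** Otherwise [c = a / a(g)] has norm below 1 and value 1 at [g]. Its geometric series converges in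
    [B] to some [s] with [s = 1 + c * s], and evaluation at [g] gives [0 = 1]. The size of [N 1]
    affects only the constant [K]. *)
Lemma nm_le_bnorm a g : B a -> nm (a g) <= N a.
Proof.
move=> Ba; rewrite leNgt; apply/negP => ltNa.
have ag0 : 0 < nm (a g) by apply: le_lt_trans ltNa; exact: (bnorm_ge0 Balg).
pose c := (a g)^-1 *: a; have Bc : B c by exact: (balgZ Balg).
have cg : c g = 1 by rewrite /c -[LHS]/(_ * _) mulVf// -nm_gt0.
have q01 : 0 <= N c < 1.
  rewrite (bnorm_ge0 Balg)//= /c bnormZnm// nmV mulrC ltr_pdivrMr//.
  by rewrite mul1r.
pose u n := \sum_(i < n) c ^+ i.
have Bu n : B (u n) by apply: balg_sum => i; exact: balgX.
have B1 := balg1 Balg.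
have [n|s Bs Hs] := bnorm_geometric_cvg Bu q01 (bnorm_ge0 Balg B1).
  rewrite /u big_ord_recr /= addrAC subrr add0r -[c ^+ n]mul1r.
  exact: bnormMX.
have uS n : u n.+1 = 1 + c * u n.
  rewrite /u big_ord_recl expr0 mulr_sumr; congr (_ + _).
  by apply: eq_bigr => i _; rewrite -exprS.
have Bt : B (1 + c * s) by apply: (balgD Balg) => //; exact: (balgM Balg).
have : N (s - (1 + c * s)) <= 0.
  have /andP[q0 q1] := q01.
  set K := N 1 / (1 - N c) in Hs.
  have K0 : 0 <= K by rewrite divr_ge0 ?(bnorm_ge0 Balg)// subr_ge0 ltW.
  apply: (@le0_geometric _ _ (2 * K) (N c)) => //; exists 0%N => n _.
  apply: le_trans (bnorm_triangle Bs (Bu n.+1) Bt) _.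
  rewrite bnorm_distC// uS opprD addrACA subrr add0r -mulrBr -uS.
  have BuS : B (u n - s) by exact: balgB.
  have := bnormM Balg Bc BuS; have := Hs n; have := Hs n.+1; rewrite exprS => h1 h2 h3.
  have h4 : N c * N (u n - s) <= N c * (K * N c ^+ n) by rewrite ler_wpM2l.
  have h5 : N c * (K * N c ^+ n) <= K * N c ^+ n.
    by apply: ler_piMl; [exact: mulr_ge0 K0 (exprn_ge0 n q0)|exact: ltW].
  by rewrite mulrCA in h1; lra.
have Bd : B (s - (1 + c * s)) by exact: balgB.
move=> h; have /(bnorm0_eq0 Balg Bd) : N (s - (1 + c * s)) = 0.
  by apply/eqP; rewrite eq_le h (bnorm_ge0 Balg).
move=> /(congr1 (fun f => f g)).
rewrite -[LHS]/(s g - (1 + c g * s g)) cg mul1r opprD addrCA subrr addr0 -[RHS]/(0 : R[i]).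
by move/eqP; rewrite oppr_eq0 oner_eq0.
Qed.

(** Expanding [a * (1 + x)] as [a + a * x] costs a factor [1 + N x]; estimating [N (1 + x)] instead
    would bring in [N 1]. *)
Lemma bnormMX1D a x n : B a -> B x -> N (a * (1 + x) ^+ n) <= N a * expR (N x *+ n).
Proof.
move=> Ba Bx; have B1 := balg1 Balg.
elim: n => [|n IH]; first by rewrite !expr0 mulr0n expR0 !mulr1.
have Bn : B (a * (1 + x) ^+ n) by apply: (balgM Balg) => //; apply: balgX; exact: (balgD Balg).
rewrite exprSr mulrA mulrDr mulr1 mulrSr expRD mulrA.
apply: le_trans (bnormD Balg Bn (balgM Balg Bn Bx)) _.
have := bnormM Balg Bn Bx; have := expR_ge1Dx (N x); have N0 := bnorm_ge0 Balg Bn.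
move=> h1 h2; apply: (@le_trans _ _ (N (a * (1 + x) ^+ n) * (1 + N x))).
  by rewrite mulrDr mulr1 lerD2l.
by apply: ler_pM => //; rewrite addr_ge0// (bnorm_ge0 Balg).
Qed.

Lemma nm_exprB_le (z w : R[i]) (r : R) n :
  nm z <= r -> nm w <= r -> 1 <= r ->
  nm (z ^+ n - w ^+ n) <= (nm (z - w) * r ^+ n) *+ n.
Proof.
move=> zr wr r1; rewrite subrXX nmM -mulrnAr ler_wpM2l ?nm_ge0//.
apply: le_trans (nm_sum _ _ _) _.
rewrite (_ : r ^+ n *+ n = \sum_(i < n) r ^+ n); last by rewrite sumr_const card_ord.
have r0 : 0 <= r by lra.
apply: ler_sum => i _; rewrite nmM !nmX.
apply: (@le_trans _ _ (r ^+ (n.-1 - i) * r ^+ i)).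
  by apply: ler_pM; rewrite ?exprn_ge0 ?nm_ge0// lerXn2r ?nnegrE ?nm_ge0.
rewrite -exprD subnK; last by have := ltn_ord i; lia.
by apply: ler_weXn2l => //; exact: leq_pred.
Qed.

(** [1 + z / m] and [cexp (z / m)] both have modulus at most [expR (|z| / m)], so their [m]-th
    powers differ by at most [m * expR |z|] times their own difference, which is quadratic in
    [z / m]. *)
Lemma cexp_approx (z : R[i]) m : (0 < m)%N -> nm z <= m%:R / 2 ->
  nm ((1 + (m%:R^-1)%:C * z) ^+ m - cexp z) <= 3 * nm z ^+ 2 * expR (nm z) / m%:R.
Proof.
move=> m0 zm; have mR : 0 < m%:R :> R by rewrite ltr0n.
pose y := (m%:R^-1)%:C * z.
have ny : nm y = nm z / m%:R.
  by rewrite nmM nm_real ger0_norm ?invr_ge0 ?ler0n// mulrC.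
have -> : cexp z = cexp y ^+ m.
  rewrite -cexpMn; congr cexp; rewrite -mulr_natr /y mulrAC -(rmorph_nat (real_complex R)).
  by rewrite -rmorphM mulVf ?gt_eqF// mul1r.
rewrite -/y.
have y1 : nm (1 + y) <= expR (nm y).
  by apply: le_trans (nmD _ _) _; rewrite nm1 expR_ge1Dx.
have y2 : nm (cexp y) <= expR (nm y).
  by rewrite nm_cexp ler_expR; apply: le_trans (ler_norm _) (abs_Re_le _).
have y3 : 1 <= expR (nm y) by rewrite -expR0 ler_expR nm_ge0.
apply: le_trans (nm_exprB_le m y1 y2 y3) _.
have yh : nm y <= 2^-1 by rewrite ny ler_pdivrMr// mulrC.
rewrite nm_distC opprD addrA -expRM_natr ny divfK ?gt_eqF//.
rewrite -mulr_natr.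
have h := cexp_sub_le yh.
apply: (@le_trans _ _ (3 * nm y ^+ 2 * expR (nm z) * m%:R)).
  by rewrite !ler_wpM2r ?expR_ge0.
rewrite ny le_eqVlt; apply/orP; left; apply/eqP; field; by rewrite gt_eqF.
Qed.

(* The powers converge geometrically: (1 + x / 2 ^ (n + 1)) ^ 2 and 1 + x / 2 ^ n
   differ by x ^ 2 / 4 ^ (n + 1). *)
Lemma fexp_approx x : B x ->
  [/\ B (fexp x), N (fexp x - 1 - x) <= N x ^+ 2 * expR (N x) &
    exists C, forall n, N ((1 + ((2 ^ n)%:R^-1 : R)%:C *: x) ^+ (2 ^ n) - fexp x)
      <= C * 2^-1 ^+ n].
Proof.
move=> Bx; have B1 := balg1 Balg; have Nx0 := bnorm_ge0 Balg Bx.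
pose y n : G -> R[i] := ((2 ^ n)%:R^-1 : R)%:C *: x.
have By n : B (y n) by exact: (balgZ Balg).
have Ny n : N (y n) = N x / (2 ^ n)%:R.
  by rewrite bnormZnm// nm_real ger0_norm ?invr_ge0 ?ler0n// mulrC.
pose u n := (1 + y n) ^+ (2 ^ n).
have Bu n : B (u n) by apply: balgX; exact: (balgD Balg).
have p2 n : 0 < (2 ^ n)%:R :> R by rewrite ltr0n expn_gt0.
pose K := N x ^+ 2 * expR (N x) / 4.
have K0 : 0 <= K by rewrite divr_ge0// mulr_ge0 ?expR_ge0 ?sqr_ge0.
have pE n : 2^-1 ^+ n = ((2 ^ n)%:R)^-1 :> R by rewrite exprVn natrX.
have step n : N (u n.+1 - u n) <= K * 2^-1 ^+ n.
  have yS : y n = y n.+1 + y n.+1.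
    rewrite /y -scalerDl -rmorphD /=; congr (_%:C *: _).
    by rewrite expnS natrM; field; rewrite gt_eqF.
  have sqE : (1 + y n.+1) ^+ 2 - (1 + y n) = y n.+1 ^+ 2 by rewrite yS; ring.
  rewrite /u expnS exprM subrXX sqE.
  set m := (2 ^ n)%N; rewrite mulr_sumr.
  have Bt (i : 'I_m) : B (y n.+1 ^+ 2 *
      (((1 + y n.+1) ^+ 2) ^+ (m.-1 - i) * (1 + y n) ^+ i)).
    apply: (balgM Balg); first exact: balgX.
    by apply: (balgM Balg); do 2?apply: balgX; exact: (balgD Balg).
  apply: le_trans (bnorm_sum _ Bt) _.
  (* Each term of the factored difference of powers carries [y n.+1 ^+ 2], of norm at most
     [N x ^ 2 / (4 m ^ 2)]. The exponents of the other factors, in units of [N x / m], add up to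
     [m - 1], so these contribute at most [expR (N x)]. *)
  apply: (@le_trans _ _ (\sum_(i < m) (N x ^+ 2 * expR (N x) / (4 * m%:R ^+ 2)))).
    apply: ler_sum => i _; rewrite mulrA -exprM.
    have Ba : B (y n.+1 ^+ 2 * (1 + y n.+1) ^+ (2 * (m.-1 - i))).
      by apply: (balgM Balg); apply: balgX => //; exact: (balgD Balg).
    apply: le_trans (bnormMX1D _ Ba (By n)) _.
    have h1 := bnormMX1D (2 * (m.-1 - i)) (balgX 2 (By n.+1)) (By n.+1).
    have h2 : N (y n.+1 ^+ 2) <= N (y n.+1) ^+ 2.
      by rewrite expr2; exact: (bnormM Balg).
    have h3 : N (y n.+1 ^+ 2 * (1 + y n.+1) ^+ (2 * (m.-1 - i))) <=
       N (y n.+1) ^+ 2 * expR (N (y n.+1) *+ (2 * (m.-1 - i))).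
      by apply: le_trans h1 _; rewrite ler_wpM2r ?expR_ge0.
    apply: (@le_trans _ _ (N (y n.+1) ^+ 2 *
        expR (N (y n.+1) *+ (2 * (m.-1 - i))) * expR (N (y n) *+ i))).
      by rewrite ler_wpM2r ?expR_ge0.
    rewrite -mulrA -expRD.
    have mR : 0 < m%:R :> R := p2 n.
    have NS : N (y n.+1) = N x / (2 * m%:R) by rewrite Ny expnS natrM.
    have -> : N (y n.+1) ^+ 2 = N x ^+ 2 / (4 * m%:R ^+ 2).
      by rewrite NS; field; rewrite gt_eqF.
    rewrite [leRHS]mulrAC ler_wpM2l//.
      by rewrite divr_ge0 ?sqr_ge0// mulr_ge0 ?sqr_ge0.
    have Nm : N (y n) = N x / m%:R := Ny n.
    rewrite ler_expR NS Nm -[_ *+ (2 * _)]mulr_natr -[_ *+ i]mulr_natr natrM.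
    have -> : N x / (2 * m%:R) * (2 * (m.-1 - i)%:R) + N x / m%:R * i%:R =
       N x * (((m.-1 - i)%:R + i%:R) / m%:R).
      by field; rewrite gt_eqF.
    rewrite ler_piMr// ler_pdivrMr// mul1r -natrD ler_nat.
    by have := ltn_ord i; lia.
  have pm : 2^-1 ^+ n = m%:R^-1 :> R := pE n.
  have mR : 0 < m%:R :> R := p2 n.
  rewrite sumr_const card_ord -mulr_natr pm /K.
  by rewrite le_eqVlt; apply/orP; left; apply/eqP; field; rewrite gt_eqF.
have [e Be He] := bnorm_geometric_cvg Bu (half01 R) K0 step.
(* Convergence in norm implies pointwise convergence, and pointwise the limit is known from
   [cexp_approx]. *)
have eE : e = fexp x.
  apply/funext => g; apply/eqP; rewrite -subr_eq0 -nm_eq0 eq_le nm_ge0 andbT.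
  apply: (@le0_geometric _ _ (K / (1 - 2^-1) + 3 * nm (x g) ^+ 2 * expR (nm (x g))) 2^-1).
    exact: half01.
  have h0 : (0 : R) < 2^-1 by lra.
  have [n0 Hn0] := small_geometric (nm_ge0 (x g)) (half01 R) h0.
  exists n0 => n /Hn0 hn.
  apply: le_trans (nm_triangle _ (u n g) _) _; rewrite mulrDl; apply: lerD.
    rewrite nm_distC; apply: le_trans _ (He n).
    have Bue : B (u n - e) by exact: balgB.
    exact: (nm_le_bnorm g Bue).
  rewrite pE; have := @cexp_approx (x g) (2 ^ n).
  rewrite expn_gt0 => /(_ isT); rewrite /u exprfctE; apply.
  by move: hn; rewrite pE ltr_pdivrMr ?p2//; lra.
rewrite -eE; split=> //; last by exists (K / (1 - 2^-1)).
(* At [n = 0] the approximant is [1 + x], so the rate of convergence becomes the remainder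
   estimate. *)
have := He 0%N; rewrite /u expn0 expr1 expr0 mulr1.
have -> : y 0%N = x by rewrite /y expn0 invr1 scale1r.
rewrite bnorm_distC//; last exact: (balgD Balg).
rewrite opprD addrA; move: K0; rewrite /K; set t := N x ^+ 2 * _.
  have -> : t / 4 / (1 - 2^-1) = t / 2 by field.
  lra.
Qed.

Lemma balg_fexp x : B x -> B (fexp x).
Proof. by case/fexp_approx. Qed.

End FunctionBanachAlgebra.

(** * Logarithms of elements close to 1, in norm and uniformly *)

Section BanachLogarithm.
Variables (R : realType) (G : topologicalZmodType).
Variables (B : set (G -> R[i])) (N : (G -> R[i]) -> R).
Hypothesis Badm : admissible B N.
Implicit Types (a b h u w : G -> R[i]).

Let Balg : is_banach_subalgebra B N := admissible_banach Badm.
Let B1 : B 1 := balg1 Balg.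

(* Newton's iteration for the logarithm: dividing 1 + w by exp w leaves a
   quadratic error. *)
Definition log_step w : G -> R[i] := (1 + w) * fexp (- w) - 1.

Lemma log_stepP w : B w -> N w <= 8^-1 ->
  B (log_step w) /\ N (log_step w) <= N w / 2.
Proof.
move=> Bw w8; have BNw := balgN Balg Bw; have [Be He _] := fexp_approx Balg BNw.
have Bw1 : B (1 + w) by exact: (balgD Balg).
split; first by apply: (balgB Balg) => //; exact: (balgM Balg).
rewrite (bnormN Balg)// opprK in He.
(* With [fexp (- w) = 1 - w + r] the linear terms of [log_step w] cancel, and both [r] and [w * w]
   are quadratic in [w]. *)
pose r := fexp (- w) - 1 + w; have Br : B r by apply: (balgD Balg) => //; exact: (balgB Balg).
have -> : log_step w = r + w * r - w * w by rewrite /log_step /r; ring.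
have Bwr : B (w * r) by exact: (balgM Balg).
have Bww : B (w * w) by exact: (balgM Balg).
apply: le_trans (bnormD Balg (balgD Balg Br Bwr) (balgN Balg Bww)) _.
rewrite (bnormN Balg)//.
have h1 := bnormD Balg Br Bwr; have h2 := bnormM Balg Bw Br.
have h3 := bnormM Balg Bw Bw.
have Nw0 := bnorm_ge0 Balg Bw; have Nr0 := bnorm_ge0 Balg Br.
have e2 : expR (N w) <= 2.
  have := @expR_sub_le R (N w); rewrite ger0_norm// => /(_ _)/andP[]; first by lra.
  move=> _; have : N w ^+ 2 <= 8^-1 * N w by rewrite expr2 ler_wpM2r.
  by lra.
have h4 : N r <= 2 * N w ^+ 2.
  apply: le_trans He _; rewrite mulrC ler_wpM2r ?sqr_ge0//.
have h5 : N w ^+ 2 <= 8^-1 * N w by rewrite expr2 ler_wpM2r.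
have h6 : N w * N r <= 8^-1 * N r by rewrite ler_wpM2r.
rewrite -expr2 in h3; lra.
Qed.

(** The partial sums [s n] of the Newton corrections satisfy [u = (1 + w n) * fexp (s n)] at every
    stage. The errors [w n] halve, so [s n] converges in [B] and the factor [1 + w n] tends to 1. *)
Lemma exists_flog u : B u -> N (u - 1) <= 8^-1 -> exists2 h, B h & u = fexp h.
Proof.
move=> Bu u8; pose w n := iter n log_step (u - 1).
have Bu1 : B (u - 1) by exact: (balgB Balg).
have Hw n : B (w n) /\ N (w n) <= 8^-1 * 2^-1 ^+ n.
  elim: n => [|n [IHB IH]]; first by rewrite expr0 mulr1.
  have : 2^-1 ^+ n <= 1 :> R by rewrite exprn_ile1; lra.
  move=> p1; have [|/= B' N'] := log_stepP IHB; first by lra.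
  by split=> //; rewrite exprS; lra.
pose s n := \sum_(i < n) w i.
have Bs n : B (s n) by apply: (balg_sum Balg) => i; have [] := Hw i.
have us n : u = (1 + w n) * fexp (s n).
  elim: n => [|n IH]; first by rewrite /s big_ord0 fexp0 mulr1 /= addrC subrK.
  have -> : 1 + w n.+1 = (1 + w n) * fexp (- w n) by rewrite addrC subrK.
  rewrite {1}IH /s big_ord_recr /= -mulrA -fexpD.
  by congr (_ * fexp _); rewrite addrCA addNr addr0.
have e0 : 0 <= 8^-1 :> R by lra.
have [n|h Bh Hh] := bnorm_geometric_cvg Balg Bs (half01 R) e0.
  by rewrite /s big_ord_recr /= addrAC subrr add0r; have [] := Hw n.
exists h => //; apply/funext => g.
have c0 := cexp_neq0 (h g).
suff : nm (u g / cexp (h g) - 1) <= 0.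
  move=> h0; have /eqP : nm (u g / cexp (h g) - 1) == 0 by rewrite eq_le h0 nm_ge0.
  by move=> /Normc.eq0_normc/eqP; rewrite subr_eq0 => /eqP/(canRL (divfK c0)); rewrite mul1r.
apply: (@le0_geometric _ _ 2 2^-1); first exact: half01.
exists 0%N => n _.
pose d := s n g - h g; pose q := 2^-1 ^+ n : R.
have nd : nm d <= 4^-1 * q.
  apply: le_trans (nm_le_bnorm Balg g (balgB Balg (Bs n) Bh)) _.
  apply: le_trans (Hh n) _.
  by rewrite (_ : 8^-1 / (1 - 2^-1) = 4^-1 :> R) //; field.
have nw : nm (w n g) <= 8^-1 * q.
  by apply: le_trans (nm_le_bnorm Balg g (Hw n).1) (Hw n).2.
have q1 : 0 <= q <= 1.
  by rewrite exprn_ge0 ?exprn_ile1//; lra.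
have /andP[q0 {}q1] := q1.
have -> : u g / cexp (h g) - 1 = (1 + w n g) * (cexp d - 1 - d) + (1 + w n g) * d + w n g.
  rewrite {1}(us n) -[((1 + w n) * fexp (s n)) g]/((1 + w n g) * cexp (s n g)).
  by rewrite /d cexpD cexpN; ring.
have nd2 : nm d <= 2^-1 by lra.
have hd := cexp_sub_le nd2.
have d2 : nm d ^+ 2 <= 4^-1 * nm d by rewrite expr2 ler_wpM2r ?nm_ge0//; lra.
have n1w : nm (1 + w n g) <= 2 by apply: le_trans (nmD _ _) _; rewrite nm1; lra.
apply: le_trans (nmD _ _) _; apply: le_trans (lerD (nmD _ _) (lexx _)) _.
rewrite !nmM.
have h1 : nm (1 + w n g) * nm (cexp d - 1 - d) <= 2 * nm (cexp d - 1 - d).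
  by rewrite ler_wpM2r ?nm_ge0.
have h2 : nm (1 + w n g) * nm d <= 2 * nm d by rewrite ler_wpM2r ?nm_ge0.
rewrite -/q; lra.
Qed.

Lemma inverse_closed a : B a -> (forall g, a g != 0) ->
  exists2 b, B b & a * b = 1.
Proof.
move=> Ba a0; have [|//] := @admissible_inverse_closed _ _ _ _ Badm a.
split=> //; split; first exact: (balg_continuous Balg).
exists (fun g => (a g)^-1).
  by move=> x; apply: cvgV; [exact: a0|exact: (balg_continuous Balg)].
by apply/funext => g; exact: mulfV.
Qed.

Lemma GL_neq0 (U : set (G -> R[i])) a g : GL U a -> a g != 0.
Proof.
move=> [_ [b _ /(congr1 (fun f => f g))]] ab.
apply/eqP => a0; move: ab; rewrite -[LHS]/(a g * b g) a0 mul0r => /eqP.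
by rewrite eq_sym oner_eq0.
Qed.

(** The second hypothesis makes the truth value of [P] locally constant, so [S] is open and closed
    in the connected segment. *)
Lemma connected_unit_segment (P : R -> Prop) : P 0 ->
  (forall t0, 0 <= t0 <= 1 -> exists2 e, 0 < e &
     forall t, 0 <= t <= 1 -> `|t - t0| < e -> (P t <-> P t0)) ->
  P 1.
Proof.
move=> P0 HP; have H := @segment_connected R 0 1.
pose S := [set t | t \in `[(0:R), 1] /\ P t].
pose O (Q : R -> Prop) := [set t : R | exists t0 e, [/\ 0 <= t0 <= 1, Q t0, 0 < e,
   `|t - t0| < e & forall t, 0 <= t <= 1 -> `|t - t0| < e -> (P t <-> P t0)]].
have Oopen Q : open (O Q).
  rewrite openE => t [t0 [e [t01 Q0 e0 te He]]].
  have d0 : 0 < e - `|t - t0| by rewrite subr_gt0.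
  exists (e - `|t - t0|) => // y /= ty.
  exists t0, e; split => //.
  rewrite -[y - t0](subrKA t); apply: le_lt_trans (ler_normD _ _) _.
  by rewrite distrC -ltrBrDr.
have mem t : (`[(0:R), 1]%classic t) = (0 <= t <= 1) :> Prop.
  by rewrite /mkset in_itv.
have SE : S = `[0, 1]%classic.
  apply: H.
  - by exists 0; split=> //; rewrite in_itv/= lexx ler01.
  - exists (O P) => //; apply/seteqP; split => t.
      move=> [t01 Pt]; split=> //; rewrite in_itv/= in t01.
      have [e e0 He] := HP _ t01; exists t, e; split=> //.
      by rewrite subrr normr0.
    move=> [t01 [t0 [e [h1 h2 h3 h4 h5]]]]; split=> //.
    by rewrite mem in t01; apply/(h5 t).
  - exists (~` (O (fun t => ~ P t))); first exact: open_closedC.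
    apply/seteqP; split => t.
      move=> [t01 Pt]; split=> // -[t0 [e [h1 h2 h3 h4 h5]]].
      by rewrite in_itv/= in t01; apply: h2; apply/(h5 t).
    move=> [t01 nO]; split=> //; apply: contrapT => nP; apply: nO.
    rewrite mem in t01; have [e e0 He] := HP _ t01; exists t, e; split=> //.
    by rewrite subrr normr0.
have : S 1 by rewrite SE mem ler01 lexx.
by case.
Qed.

(** The hypothesis says nothing about [N (a - 1)], so [exists_flog] cannot be applied to [a]. It
    does apply to the quotient of two nearby points of the segment from 1 to [a], hence having a
    logarithm in [B] is locally constant along the segment. *)
Lemma fexp_segment a : B a -> (forall g, nm (a g - 1) <= 2^-1) ->
  exists2 h, B h & a = fexp h.
Proof.
move=> Ba a2; pose u (t : R) : G -> R[i] := 1 + t%:C *: (a - 1).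
have Ba1 : B (a - 1) by exact: (balgB Balg).
have Bu t : B (u t) by apply: (balgD Balg) => //; exact: (balgZ Balg).
have u0 t g : 0 <= t <= 1 -> u t g != 0.
  move=> /andP[t0 t1]; rewrite -nm_gt0.
  have := nmD (u t g) (- (t%:C * (a g - 1))).
  rewrite -[u t g]/(1 + t%:C * (a g - 1)) addrK nm1 nmN nmM nm_real ger0_norm//.
  have := a2 g; have := nm_ge0 (a g - 1) => h1 h2.
  have : t * nm (a g - 1) <= 1 * nm (a g - 1) by rewrite ler_wpM2r.
  by lra.
suff [h Bh] : exists2 h, B h & u 1 = fexp h.
  by rewrite /u rmorph1 scale1r [1 + _]addrC subrK => E; exists h.
apply: (@connected_unit_segment (fun t => exists2 h, B h & u t = fexp h)).
  by exists 0; [exact: (balg0 Balg)|rewrite fexp0 /u scale0r addr0].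
move=> t0 t01.
have [v Bv uv] := inverse_closed (Bu t0) (fun g => u0 t0 g t01).
pose K := N (v * (a - 1)) + 1.
have Bva : B (v * (a - 1)) by exact: (balgM Balg).
have K0 : 0 < K by rewrite ltr_wpDl// (bnorm_ge0 Balg).
exists (8^-1 / K); first by rewrite divr_gt0.
move=> t tt tt0.
have diff : u t * v - 1 = (t - t0)%:C *: (v * (a - 1)).
  apply/funext => g.
  have uvg : (1 + t0%:C * (a g - 1)) * v g = 1 := congr1 (fun f => f g) uv.
  transitivity ((1 + t%:C * (a g - 1)) * v g - (1 + t0%:C * (a g - 1)) * v g).
    by rewrite uvg.
  by rewrite -[RHS]/((t - t0)%:C * (v g * (a g - 1))) rmorphB; ring.
have [||h Bh E] := @exists_flog (u t * v); first exact: (balgM Balg).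
  rewrite diff (bnormZnm Balg)// nm_real.
  move: tt0; rewrite ltr_pdivlMr// /K => tt0.
  apply: le_trans _ (ltW tt0); rewrite ler_wpM2l//.
  by rewrite lerDl.
have ut : u t = u t0 * fexp h by rewrite -E mulrCA uv mulr1.
split=> -[k Bk Ek].
  exists (k - h); first exact: (balgB Balg).
  by rewrite fexpD -Ek ut -mulrA fexpVr mulr1.
by exists (k + h); [exact: (balgD Balg)|rewrite fexpD -Ek].
Qed.

End BanachLogarithm.

(** * Fourier coefficients, L2 orthogonality and spectra *)

Section FourierCoefficients.
Variables (R : realType) (G : topologicalZmodType).
Variable mu : probability (borel G) R.
Variables (B : set (G -> R[i])) (N : (G -> R[i]) -> R).
Hypothesis G_compact : compact [set: G].
Hypothesis mu_haar : is_haar mu.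
Hypothesis Badm : admissible B N.
Implicit Types (a b f h p u v x : G -> R[i]) (j k : character R G) (e : R).
Implicit Types (S T U : set (character R G)).

Let Balg : is_banach_subalgebra B N := admissible_banach Badm.
Let B1 : B 1 := balg1 Balg.
Let BD := balgD Balg.
Let BB := balgB Balg.
Let BZ := balgZ Balg.
Let BM := balgM Balg.
Let BC := balg_continuous Balg.

Local Notation I := (cintegral mu).
Local Notation hat := (fourier_coef mu).

Lemma character0E g : (0 : character R G) g = 1. Proof. by []. Qed.

Lemma character_addE j k g : (j + k) g = j g * k g. Proof. by []. Qed.

Lemma character_oppE j g : (- j) g = (j g)^*.
Proof.
have j0 := character_neq0 j g.
apply: (mulfI j0); rewrite mulcJ_nm nm_character expr1n.
by rewrite -character_addE subrr.
Qed.

Lemma continuous_hat_integrand a j : continuous a -> continuous (fun g => a g * (j g)^*).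
Proof.
move=> ca; apply: (@continuousCM _ _ a (fun g => (j g)^*) ca).
exact: (continuous_conj (@character_continuous _ _ j)).
Qed.

Lemma hatD a b j : continuous a -> continuous b -> hat (a + b) j = hat a j + hat b j.
Proof.
move=> ca cb; rewrite /fourier_coef.
rewrite -(cintegralD _ G_compact (continuous_hat_integrand (j := j) ca)
  (continuous_hat_integrand (j := j) cb)).
by congr (cintegral mu _); apply/funext => g; rewrite -mulrDl.
Qed.

Lemma hatZ c a j : continuous a -> hat (c *: a) j = c * hat a j.
Proof.
move=> ca; rewrite /fourier_coef -(cintegralZ _ G_compact _ (continuous_hat_integrand (j := j) ca)).
by congr (cintegral mu _); apply/funext => g; rewrite -[RHS]/(c * _) mulrA.
Qed.

Lemma hatN a j : continuous a -> hat (- a) j = - hat a j.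
Proof. by move=> ca; rewrite -scaleN1r (hatZ _ _ ca) mulN1r. Qed.

Lemma hatB a b j : continuous a -> continuous b -> hat (a - b) j = hat a j - hat b j.
Proof. by move=> ca cb; rewrite (hatD _ ca (continuousCN cb)) (hatN _ cb). Qed.

Lemma hat0 j : hat 0 j = 0.
Proof.
have c0 : continuous (0 : G -> R[i]) := @continuousC_cst _ _ 0.
by rewrite -(scale0r (0 : G -> R[i])) (hatZ _ _ c0) mul0r.
Qed.

Lemma hat_sum (I : Type) (s : seq I) (F : I -> G -> R[i]) j :
  (forall i, continuous (F i)) ->
  hat (\sum_(i <- s) F i) j = \sum_(i <- s) hat (F i) j.
Proof.
move=> cF; elim: s => [|i s IH]; first by rewrite !big_nil hat0.
have cs : continuous (\sum_(k <- s) F k).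
  elim: s {IH} => [|k s IH]; first by rewrite big_nil; exact: (@continuousC_cst _ _ 0).
  by rewrite big_cons; exact: (continuousCD (cF k) IH).
by rewrite !big_cons (hatD _ (cF i) cs) IH.
Qed.

Lemma nm_hat_le a j e : continuous a -> (forall g, nm (a g) <= e) -> nm (hat a j) <= 2 * e.
Proof.
move=> ca ae; apply: (nm_cintegral_le_cst mu G_compact (continuous_hat_integrand (j := j) ca)).
by move=> g; rewrite nmM nm_conj nm_character mulr1.
Qed.

Lemma nm_hat_le_bnorm a j : B a -> nm (hat a j) <= 2 * N a.
Proof.
by move=> Ba; apply: (nm_hat_le j (BC Ba)) => g; exact: (nm_le_bnorm Balg).
Qed.

Lemma hat_character j k : hat k j = (k == j)%:R.
Proof.
rewrite /fourier_coef (_ : (fun g => _) = (k - j : character R G)); last first.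
  by apply/funext => g; rewrite -character_oppE.
have [->|kj] := eqVneq k j; first by rewrite subrr (@cintegral_cst _ _ mu 1).
by rewrite (cintegral_character G_compact mu_haar)// subr_eq0.
Qed.

Lemma character_in_algebra j : B j.
Proof.
apply: (admissible_dense Badm).1; exists [:: j], (fun=> 1) => g.
by rewrite big_seq1 mul1r.
Qed.

Lemma trig_poly_in_algebra p : trig_poly p -> B p.
Proof. exact: (admissible_dense Badm).1. Qed.

Lemma trig_polyE p : trig_poly p <-> exists (s : seq (character R G)) (c : character R G -> R[i]),
  p = \sum_(j <- s) c j *: (j : G -> R[i]).
Proof.
split=> -[s [c E]]; exists s, c.
  by apply/funext => g; rewrite E fct_sumE.
by move=> g; rewrite E fct_sumE.
Qed.

(** Attaching coefficients to occurrences instead of characters turns sums of trigonometric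
    polynomials into concatenations of lists. *)
Lemma trig_poly_pairs (s : seq (R[i] * character R G)) :
  trig_poly (\sum_(t <- s) t.1 *: (t.2 : G -> R[i])).
Proof.
apply/trig_polyE; exists (undup [seq t.2 | t <- s]), (fun j => \sum_(t <- s | t.2 == j) t.1).
apply: esym; under eq_bigr do rewrite scaler_suml.
rewrite (exchange_big_dep xpredT)//= big_seq [RHS]big_seq; apply: eq_bigr => t ts.
rewrite -big_filter (_ : [seq j <- _ | _] = [:: t.2]) ?big_seq1//.
rewrite (@eq_filter _ _ (pred1 t.2)) => [|j]; last by rewrite /= eq_sym.
by rewrite filter_pred1_uniq ?undup_uniq// mem_undup map_f.
Qed.

Lemma trig_poly_pairsE p : trig_poly p <-> exists s : seq (R[i] * character R G),
  p = \sum_(t <- s) t.1 *: (t.2 : G -> R[i]).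
Proof.
split=> [/trig_polyE[s [c ->]]|[s ->]]; last exact: trig_poly_pairs.
by exists [seq (c j, j) | j <- s]; rewrite big_map.
Qed.

Lemma trig_poly_character j : trig_poly (j : G -> R[i]).
Proof. by apply/trig_poly_pairsE; exists [:: (1, j)]; rewrite big_seq1 scale1r. Qed.

Lemma trig_polyD p u : trig_poly p -> trig_poly u -> trig_poly (p + u).
Proof.
move=> /trig_poly_pairsE[s ->] /trig_poly_pairsE[t ->].
by apply/trig_poly_pairsE; exists (s ++ t); rewrite big_cat.
Qed.

Lemma trig_polyZ (c : R[i]) p : trig_poly p -> trig_poly (c *: p).
Proof.
move=> /trig_poly_pairsE[s ->]; apply/trig_poly_pairsE.
exists [seq (c * t.1, t.2) | t <- s]; rewrite big_map scaler_sumr.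
by apply: eq_bigr => t _; rewrite scalerA.
Qed.

Lemma trig_poly_sum (J : Type) (s : seq J) (F : J -> G -> R[i]) :
  (forall i, trig_poly (F i)) -> trig_poly (\sum_(i <- s) F i).
Proof.
move=> tF; elim/big_rec: _ => [|i p _ tp]; last exact: trig_polyD.
by apply/trig_poly_pairsE; exists [::]; rewrite big_nil.
Qed.

Lemma trig_approx a e : B a -> 0 < e -> exists2 p, trig_poly p & N (a - p) < e.
Proof. by move=> Ba e0; have [p] := (admissible_dense Badm).2 _ Ba _ e0; exists p. Qed.

Lemma trig_restrict p S : trig_poly p -> exists p1 p2, [/\ trig_poly p1, trig_poly p2,
  p = p1 + p2 & forall j, (S j -> hat p2 j = 0) /\ (~ S j -> hat p1 j = 0)].
Proof.
move=> /trig_polyE[s [c ->]]; pose P j := `[< S j >].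
pose q (Q : pred (character R G)) := \sum_(j <- [seq j <- s | Q j]) c j *: (j : G -> R[i]).
have hq Q j : ~~ Q j -> hat (q Q) j = 0.
  move=> Qj; rewrite /q hat_sum; last first.
    by move=> i; exact: (@continuousCZ _ _ _ (c i) (@character_continuous _ _ i)).
  rewrite big_seq; apply: big1 => i; rewrite mem_filter => /andP[Qi _].
  rewrite (hatZ _ _ (@character_continuous _ _ i)) hat_character.
  by case: eqP => [ij|_]; rewrite ?mulr0//; move: Qj; rewrite -ij Qi.
exists (q P), (q (predC P)); split.
- by apply/trig_polyE; exists [seq j <- s | P j], c.
- by apply/trig_polyE; exists [seq j <- s | predC P j], c.
- by rewrite /q !big_filter (bigID P).
- by move=> j; split=> Sj; apply: hq; rewrite /= ?negbK; [exact/asboolP|exact/asboolPn].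
Qed.

Definition ip f h : R[i] := I (fun g => f g * (h g)^*).

Definition sqnorm f : R := complex.Re (I (fun g => (nm (f g) ^+ 2)%:C)).

Lemma continuous_ip f h : continuous f -> continuous h -> continuous (fun g => f g * (h g)^*).
Proof.
by move=> cf ch; exact: (@continuousCM _ _ f (fun g => (h g)^*) cf (continuous_conj ch)).
Qed.

Lemma continuous_sqr f : continuous f -> continuous (fun g => nm (f g) ^+ 2 : R).
Proof.
move=> cf g; rewrite /continuous_at.
by apply: (@cvgM _ _ _ _ _ (fun g => nm (f g))); exact: (continuous_nm cf).
Qed.

Lemma ipDl f1 f2 h : continuous f1 -> continuous f2 -> continuous h ->
  ip (f1 + f2) h = ip f1 h + ip f2 h.
Proof.
move=> c1 c2 ch; rewrite /ip -(cintegralD _ G_compact (continuous_ip c1 ch) (continuous_ip c2 ch)).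
by congr (I _); apply/funext => g; rewrite -mulrDl.
Qed.

Lemma ip_conj f h : continuous f -> continuous h -> ip h f = (ip f h)^*.
Proof.
move=> cf ch; rewrite /ip -(cintegral_conj _ G_compact (continuous_ip cf ch)).
by congr (I _); apply/funext => g; rewrite rmorphM /= conjCK mulrC.
Qed.

Lemma ipDr f h1 h2 : continuous f -> continuous h1 -> continuous h2 ->
  ip f (h1 + h2) = ip f h1 + ip f h2.
Proof.
move=> cf c1 c2; rewrite (ip_conj (continuousCD c1 c2) cf) (ipDl c1 c2 cf).
by rewrite rmorphD /= -(ip_conj c1 cf) -(ip_conj c2 cf).
Qed.

Lemma ip_sqnorm f : ip f f = I (fun g => (nm (f g) ^+ 2)%:C).
Proof. by congr (I _); apply/funext => g; rewrite mulcJ_nm. Qed.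

Lemma sqnormD f h : continuous f -> continuous h -> ip f h = 0 ->
  sqnorm (f + h) = sqnorm f + sqnorm h.
Proof.
move=> cf ch fh; rewrite /sqnorm -!ip_sqnorm (ipDl cf ch (continuousCD cf ch)).
rewrite (ipDr cf cf ch) (ipDr ch cf ch) fh (ip_conj cf ch) fh rmorph0 addr0 add0r.
exact: ReD.
Qed.

Lemma sqnorm_ge0 f : continuous f -> 0 <= sqnorm f.
Proof.
move=> cf; have c0 : continuous (cst (0 : R[i]) : G -> R[i]) := @continuousC_cst _ _ 0.
have := @Re_cintegral_le _ _ mu G_compact _ _ c0 (continuous_real_complex (continuous_sqr cf)).
by rewrite cintegral_cst; apply=> g; rewrite sqr_ge0.
Qed.

Lemma sqnorm_le f e : continuous f -> (forall g, nm (f g) <= e) -> sqnorm f <= e ^+ 2.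
Proof.
move=> cf fe; have ce : continuous (cst ((e ^+ 2)%:C) : G -> R[i]) := @continuousC_cst _ _ _.
have := @Re_cintegral_le _ _ mu G_compact _ _ (continuous_real_complex (continuous_sqr cf)) ce.
rewrite cintegral_cst; apply=> g /=.
have e0 : 0 <= e by apply: le_trans (fe g); exact: nm_ge0.
by rewrite lerXn2r ?nnegrE ?nm_ge0.
Qed.

Lemma ip_sum f (J : Type) (s : seq J) (F : J -> G -> R[i]) : continuous f ->
  (forall i, continuous (F i)) -> ip (\sum_(i <- s) F i) f = \sum_(i <- s) ip (F i) f.
Proof.
move=> cf cF; elim: s => [|i s IH].
  rewrite !big_nil /ip (_ : (fun g => _) = cst 0) ?cintegral_cst//.
  by apply/funext => g; rewrite mul0r.
have cs : continuous (\sum_(k <- s) F k).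
  elim: s {IH} => [|k s IH]; first by rewrite big_nil; exact: (@continuousC_cst _ _ 0).
  by rewrite big_cons; exact: (continuousCD (cF k) IH).
by rewrite !big_cons (ipDl (cF i) cs cf) IH.
Qed.

Lemma trig_poly_continuous p : trig_poly p -> continuous p.
Proof. by move=> /trig_poly_in_algebra/BC. Qed.

Lemma hat_ip f j : hat f j = ip f j. Proof. by []. Qed.

Lemma trig_hatE p : trig_poly p -> exists2 s : seq (character R G),
  uniq s & p = \sum_(j <- s) hat p j *: (j : G -> R[i]).
Proof.
move=> /trig_polyE[s [c pE]]; exists (undup s); first exact: undup_uniq.
pose c' j := c j *+ count_mem j s.
have pE' : p = \sum_(j <- undup s) c' j *: (j : G -> R[i]).
  rewrite pE -[LHS]big_undup_iterop_count; apply: eq_bigr => j _.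
  by rewrite /c' -scalerMnl.
rewrite {1}pE' big_seq [RHS]big_seq; apply: eq_bigr => j js; congr (_ *: _).
have cc i : continuous (c' i *: (i : G -> R[i])).
  exact: (@continuousCZ _ _ _ (c' i) (@character_continuous _ _ i)).
rewrite pE' (hat_sum _ _ cc) (bigD1_seq j) ?undup_uniq//= big1 => [|i ij].
  by rewrite (hatZ _ _ (@character_continuous _ _ j)) hat_character eqxx mulr1 addr0.
by rewrite (hatZ _ _ (@character_continuous _ _ i)) hat_character (negPf ij) mulr0.
Qed.

Lemma ip_trig u p : continuous u -> trig_poly p ->
  (forall j, hat u j = 0 \/ hat p j = 0) -> ip p u = 0.
Proof.
move=> cu tp H; have [s _ ->] := trig_hatE tp.
rewrite (ip_sum _ cu) => [|i]; last first.
  exact: (@continuousCZ _ _ _ (hat p i) (@character_continuous _ _ i)).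
apply: big1 => j _; have cj := @character_continuous _ _ j.
rewrite /ip (_ : (fun g => _) = hat p j *: (fun g => j g * (u g)^*)); last first.
  by apply/funext => g; rewrite -mulrA.
rewrite (cintegralZ _ G_compact _ (continuous_ip cj cu)) -/(ip _ _) (ip_conj cu cj).
by rewrite -hat_ip; have [->|->] := H j; rewrite ?rmorph0 ?mulr0 ?mul0r.
Qed.

(* For e > 0 choose a trigonometric polynomial p near u and drop the frequencies
   of p outside the spectrum of u; this does not increase the L2 distance to u. *)
Lemma ip_disjoint u v : B u -> continuous v ->
  (forall j, hat u j = 0 \/ hat v j = 0) -> ip u v = 0.
Proof.
move=> Bu cv H; have cu := BC Bu.
have [M HM] := compact_nm_bounded G_compact cv.
suff key e : 0 < e -> nm (ip u v) <= e * (1 + M ^+ 2).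
  apply: Normc.eq0_normc; apply/eqP; rewrite eq_le nm_ge0 andbT.
  have M0 : 0 < 1 + M ^+ 2 by rewrite ltr_wpDr// sqr_ge0.
  apply/ler_addgt0Pr => e e0; rewrite add0r.
  have := key (e / (1 + M ^+ 2)); rewrite divfK ?gt_eqF//; apply.
  by rewrite divr_gt0.
move=> e0; have [p tp up] := trig_approx Bu e0.
have [p1 [p2 [t1 t2 pE E12]]] := trig_restrict [set j | hat u j != 0] tp.
have [c1 c2] := (trig_poly_continuous t1, trig_poly_continuous t2).
have c3 : continuous (u - p1) := continuousCB cu c1.
have o1 : ip p2 (u - p1) = 0.
  apply: ip_trig => // j; rewrite (hatB _ cu c1).
  have [E1 E2] := E12 j; have [h|h] := eqVneq (hat u j) 0.
    by left; rewrite h E2 ?subrr// => /=; rewrite h eqxx.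
  by right; apply: E1.
have o2 : ip (u - p1) (- p2) = 0.
  rewrite (ip_conj (continuousCN c2) c3) -scaleN1r.
  rewrite /ip (_ : (fun g => _) = -1 *: (fun g => p2 g * ((u - p1) g)^*)); last first.
    by apply/funext => g; rewrite -[RHS]/(-1 * _) mulrA.
  by rewrite (cintegralZ _ G_compact _ (continuous_ip c2 c3)) -/(ip _ _) o1 mulr0 rmorph0.
have o3 : ip p1 v = 0.
  apply: ip_trig => // j; have [E1 E2] := E12 j.
  have [h|h] := eqVneq (hat u j) 0; first by right; apply: E2 => /=; rewrite h eqxx.
  by left; case: (H j) => // h'; rewrite h' eqxx in h.
have d1 : sqnorm (u - p1) <= e ^+ 2.
  apply: (@le_trans _ _ (sqnorm (u - p))).
    rewrite pE opprD addrA (sqnormD c3 (continuousCN c2) o2) lerDl.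
    exact: (sqnorm_ge0 (continuousCN c2)).
  apply: (sqnorm_le (continuousCB cu (trig_poly_continuous tp))) => g.
  apply: le_trans (ltW up); apply: (nm_le_bnorm Balg).
  exact: (BB Bu (trig_poly_in_algebra tp)).
have d2 : sqnorm v <= M ^+ 2 := sqnorm_le cv HM.
have -> : ip u v = ip (u - p1) v.
  by rewrite -{1}(subrK p1 u) (ipDl c3 c1 cv) o3 addr0.
(* Weighted arithmetic-geometric mean in place of Cauchy-Schwarz: [2 s t <= s ^ 2 / e + e t ^ 2].
   The first part integrates to at most [e], the second to at most [e M ^ 2], which explains the
   bound in [key]. *)
pose F (g : G) : R := ((nm ((u - p1) g) ^+ 2) / e + e * nm (v g) ^+ 2) / 2.
have FE : (fun g => (F g)%:C) =
    ((2^-1 / e)%:C : R[i]) *: (fun g => (nm ((u - p1) g) ^+ 2)%:C : R[i])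
    + ((e / 2)%:C : R[i]) *: (fun g => (nm (v g) ^+ 2)%:C : R[i]).
  apply/funext => g.
  rewrite -[RHS]/((2^-1 / e)%:C * (nm ((u - p1) g) ^+ 2)%:C +
    (e / 2)%:C * (nm (v g) ^+ 2)%:C).
  rewrite -!rmorphM -rmorphD; congr (_%:C); rewrite /F; field.
  by rewrite gt_eqF.
have cs3 := continuous_real_complex (continuous_sqr c3).
have csv := continuous_real_complex (continuous_sqr cv).
have cZ1 := @continuousCZ _ _ _ ((2^-1 / e)%:C : R[i]) cs3.
have cZ2 := @continuousCZ _ _ _ ((e / 2)%:C : R[i]) csv.
have cF : continuous F.
  by have := continuous_Re (continuousCD cZ1 cZ2); rewrite -FE.
have := nm_cintegral_le mu G_compact (continuous_ip c3 cv) cF.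
rewrite FE (cintegralD _ G_compact cZ1 cZ2) (cintegralZ _ G_compact _ cs3).
rewrite (cintegralZ _ G_compact _ csv) ReD !ReM_real -!/(sqnorm _) -/(ip _ _).
move=> h; apply: le_trans (h _) _ => [g|].
  rewrite nmM nm_conj /F.
  set s := nm _; set t := nm _.
  have : 0 <= (s - e * t) ^+ 2 / e by rewrite divr_ge0 ?sqr_ge0// ltW.
  have -> : (s - e * t) ^+ 2 / e = s ^+ 2 / e + e * t ^+ 2 - 2 * (s * t).
    by field; rewrite gt_eqF.
  lra.
have h1 : 2^-1 / e * sqnorm (u - p1) <= 2^-1 / e * e ^+ 2.
  by rewrite ler_wpM2l// divr_ge0// ltW.
have h2 : e / 2 * sqnorm v <= e / 2 * M ^+ 2.
  by rewrite ler_wpM2l// divr_ge0// ltW.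
have h3 : 2^-1 / e * e ^+ 2 = e / 2 by field; rewrite gt_eqF.
by rewrite h3 in h1; lra.
Qed.

(** An arbitrary set [S] lets the same closure lemmas serve [Gamma_plus], [Gamma_minus] and their
    strict versions. *)
Definition spec_in S a := B a /\ forall j, ~ S j -> hat a j = 0.

Lemma spec_inP S a : spec_in S a <-> B a /\ spectrum mu a `<=` S.
Proof.
split=> -[Ba H]; split=> // j.
  by move=> h; apply: contrapT => /H; apply/eqP.
by move=> nS; apply/eqP/negPn/negP => /H.
Qed.

Lemma spec_in_sub S T a : S `<=` T -> spec_in S a -> spec_in T a.
Proof. by move=> ST [Ba H]; split=> // j nT; apply: H => /ST. Qed.

Lemma spec_inD S a b : spec_in S a -> spec_in S b -> spec_in S (a + b).
Proof.
move=> [Ba Ha] [Bb Hb]; split; first exact: BD.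
by move=> j nS; rewrite (hatD _ (BC Ba) (BC Bb)) Ha// Hb// addr0.
Qed.

Lemma spec_inZ S c a : spec_in S a -> spec_in S (c *: a).
Proof.
move=> [Ba Ha]; split; first exact: BZ.
by move=> j nS; rewrite (hatZ _ _ (BC Ba)) Ha// mulr0.
Qed.

Lemma spec_inN S a : spec_in S a -> spec_in S (- a).
Proof. by move=> Sa; rewrite -scaleN1r; exact: spec_inZ. Qed.

Lemma spec_in_character S j : S j -> spec_in S j.
Proof.
move=> Sj; split=> [|k nS]; first exact: character_in_algebra.
by rewrite hat_character; case: eqP => // jk; rewrite jk in Sj.
Qed.

(** The coefficient of [a * b] at [j] is the pairing of [a] with [v = j * conj b], and the
    coefficient of [v] at [k] is the conjugate of that of [b] at [j - k]. If [j] is outside [U],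
    then [k] in [S] excludes [j - k] in [T], so the two spectra are disjoint. *)
Lemma spec_inM S T U a b : (forall j k, S j -> T k -> U (j + k)) ->
  spec_in S a -> spec_in T b -> spec_in U (a * b).
Proof.
move=> STU [Ba Ha] [Bb Hb]; split; first exact: BM.
move=> j nU; pose v : G -> R[i] := fun g => j g * (b g)^*.
have cj := @character_continuous _ _ j.
have cv : continuous v := continuous_ip cj (BC Bb).
have -> : hat (a * b) j = ip a v.
  congr (I _); apply/funext => g.
  by rewrite /v rmorphM /= conjCK -[LHS]/(a g * b g * (j g)^*) -mulrA [b g * _]mulrC.
apply: (ip_disjoint Ba cv) => k.
have [Sk|nSk] := pselect (S k); last by left; exact: Ha.
right; have nT : ~ T (j - k) by move=> /(STU _ _ Sk); rewrite addrC subrK.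
have := Hb _ nT; rewrite hat_ip => h.
have -> : hat v k = (ip b (j - k))^*.
  rewrite -(ip_conj (BC Bb) (@character_continuous _ _ (j - k))).
  congr (I _); apply/funext => g.
  by rewrite /v character_addE character_oppE mulrAC.
by rewrite h rmorph0.
Qed.

Lemma spec_in_lim S (u : nat -> G -> R[i]) a (C : R) : B a ->
  (forall n, spec_in S (u n)) -> (forall n, N (u n - a) <= C * 2^-1 ^+ n) ->
  spec_in S a.
Proof.
move=> Ba Su Hu; split=> // j nS.
apply: Normc.eq0_normc; apply/eqP; rewrite eq_le nm_ge0 andbT.
apply: (@le0_geometric _ _ (2 * C) 2^-1); first exact: half01.
exists 0%N => n _; have [Bu /(_ _ nS) h] := Su n.
have := nm_hat_le_bnorm j (BB Bu Ba).
rewrite (hatB _ (BC Bu) (BC Ba)) h sub0r nmN; have := Hu n; lra.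
Qed.

(** Subtracting 1 removes the frequency 0, which [S] need not contain; this matters when [S] is the
    set of strictly negative characters. The powers that approximate [fexp x] are treated by
    induction. *)
Lemma spec_in_fexp_sub1 S x : (forall j k, S j -> S k -> S (j + k)) ->
  spec_in S x -> spec_in S (fexp x - 1).
Proof.
move=> SS Sx; have [Bx _] := Sx; have [Be _ [C HC]] := fexp_approx Balg Bx.
apply: (@spec_in_lim _ (fun n => (1 + ((2 ^ n)%:R^-1 : R)%:C *: x) ^+ (2 ^ n) - 1) _ C).
- exact: BB.
- move=> n; move: (2 ^ n)%N => m; set y := _ *: x.
  have Sy : spec_in S y by exact: spec_inZ.
  clearbody y.
  elim: m => [|m IH].
    rewrite expr0 subrr; split; first exact: (balg0 Balg).
    by move=> j _; exact: hat0.
  have -> : (1 + y) ^+ m.+1 - 1 = ((1 + y) ^+ m - 1) + ((1 + y) ^+ m - 1) * y + y.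
    by rewrite exprS; ring.
  by apply: spec_inD => //; apply: spec_inD => //; exact: (spec_inM SS).
- by move=> n; rewrite opprB addrA subrK; exact: HC.
Qed.

End FourierCoefficients.

(** * Polynomial factors against geometric decay; central binomial coefficients *)

Section PolynomialGeometricDecay.
Variable R : realType.
Implicit Types (e q : R).

Lemma natS_geometric_le q (m : nat) : 0 <= q < 1 -> m.+1%:R * q ^+ m <= (1 - q)^-1.
Proof.
move=> /andP[q0 q1].
have -> : m.+1%:R * q ^+ m = \sum_(i < m.+1) q ^+ m.
  by rewrite sumr_const card_ord mulr_natl.
have h : \sum_(i < m.+1) q ^+ m <= \sum_(i < m.+1) q ^+ i.
  apply: ler_sum => i _; apply: ler_wiXn2l => //; first exact: ltW.
  by rewrite -ltnS.
apply: le_trans h _; rewrite -div1r ler_pdivlMr ?subr_gt0//.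
have := subrX1 q m.+1; set s := \sum_(i < _) _ => E.
have -> : s * (1 - q) = 1 - q ^+ m.+1 by rewrite -[RHS]opprB E; ring.
by rewrite gerBl exprn_ge0.
Qed.

(** Writing [q] as the square of [Num.sqrt q] leaves one geometric factor to absorb each power of
    [m.+1]. *)
Lemma poly_geometric_bounded (n : nat) q : 0 <= q < 1 ->
  exists2 C : R, 0 <= C & forall m : nat, m.+1%:R ^+ n * q ^+ m <= C.
Proof.
elim: n q => [|n IH] q q01.
  exists 1 => // m; rewrite expr0 mul1r.
  by have /andP[q0 q1] := q01; rewrite exprn_ile1// ltW.
have /andP[q0 q1] := q01.
have s01 : 0 <= Num.sqrt q < 1 by rewrite sqrtr_ge0 -[ltRHS]sqrtr1 ltr_sqrt.
have [C C0 HC] := IH _ s01.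
have /andP[s0 s1] := s01.
exists (C * (1 - Num.sqrt q)^-1) => [|m].
  by rewrite mulr_ge0// invr_ge0 subr_ge0 ltW.
have -> : q ^+ m = Num.sqrt q ^+ m * Num.sqrt q ^+ m.
  by rewrite -exprMn -expr2 sqr_sqrtr.
rewrite exprSr mulrACA; apply: ler_pM.
- by rewrite mulr_ge0 ?exprn_ge0.
- by rewrite mulr_ge0 ?exprn_ge0.
- exact: HC.
- exact: natS_geometric_le.
Qed.

(** Here [(m.*2.+1)%:R ^+ n] is the inverse of the lower bound for the mass of the torus kernel, and
    [q ^+ m] bounds the kernel away from its centre. *)
Lemma poly_geometric_small (n : nat) q e : 0 <= q < 1 -> 0 < e ->
  exists m : nat, (m.*2.+1)%:R ^+ n * q ^+ m < e.
Proof.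
move=> q01 e0; have /andP[q0 q1] := q01.
have s01 : 0 <= Num.sqrt q < 1 by rewrite sqrtr_ge0 -[ltRHS]sqrtr1 ltr_sqrt.
have /andP[s0 s1] := s01.
have [C C0 HC] := poly_geometric_bounded n s01.
have C20 : 0 <= 2 ^+ n * C by rewrite mulr_ge0// exprn_ge0.
have [m Hm] := small_geometric C20 s01 e0; exists m.
apply: le_lt_trans _ (Hm m (leqnn m)).
have -> : q ^+ m = Num.sqrt q ^+ m * Num.sqrt q ^+ m.
  by rewrite -exprMn -expr2 sqr_sqrtr.
rewrite mulrA ler_wpM2r ?exprn_ge0//.
apply: (@le_trans _ _ (2 ^+ n * (m.+1%:R ^+ n * Num.sqrt q ^+ m))).
  rewrite mulrA ler_wpM2r ?exprn_ge0// -exprMn lerXn2r ?nnegrE//.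
  by rewrite -natrM ler_nat; lia.
by rewrite ler_wpM2l// exprn_ge0.
Qed.

Lemma central_bin_rec (m : nat) :
  (m.+1 * 'C(m.+1.*2, m.+1) = 2 * m.*2.+1 * 'C(m.*2, m))%N.
Proof.
have h1 := mul_bin_diag m.+1.*2 m.
have h2 := mul_bin_diag m.*2.+1 m.
have h3 : 'C(m.*2.+1, m.+1) = 'C(m.*2.+1, m).
  by rewrite -bin_sub; [congr 'C(_, _); lia|lia].
move: h1 h2; rewrite doubleS /= h3 => h1 h2.
apply/eqP; rewrite -(@eqn_pmul2l m.+1)//; apply/eqP.
have -> : (m.+1 * (m.+1 * 'C(m.*2.+2, m.+1)) = m.*2.+2 * (m.+1 * 'C(m.*2.+1, m)))%N.
  by rewrite -h1; ring.
by rewrite -h2 (_ : m.*2.+2 = 2 * m.+1)%N; [ring|lia].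
Qed.

(** This is the mean of [((1 + cos t) / 2) ^ m] over the circle. *)
Definition central_bin_weight (m : nat) : R := 'C(m.*2, m)%:R / 4 ^+ m.

(** Consecutive weights have ratio [(2m + 1) / (2m + 2)]. The bound is far from sharp, but any
    polynomial loss is harmless against geometric decay. *)
Lemma central_bin_weight_ge (m : nat) : (m.*2.+1)%:R^-1 <= central_bin_weight m.
Proof.
rewrite /central_bin_weight; elim: m => [|m IH]; first by rewrite bin0 expr0 divr1 invr1.
have E : 'C(m.+1.*2, m.+1)%:R / 4 ^+ m.+1 =
    'C(m.*2, m)%:R / 4 ^+ m * ((m.*2.+1)%:R / (m.+1.*2)%:R) :> R.
  have h := congr1 (fun k => k%:R : R) (central_bin_rec m).
  rewrite !natrM in h; rewrite exprS.
  have -> : (m.+1.*2)%:R = 2 * m.+1%:R :> R by rewrite -muln2 natrM mulrC.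
  have m1 : m.+1%:R != 0 :> R by rewrite pnatr_eq0.
  have p4 : 4 ^+ m != 0 :> R by rewrite expf_neq0.
  apply: (mulfI m1); rewrite [LHS]mulrA. rewrite h.
  move: (m.+1%:R : R) m1 (4 ^+ m : R) p4 => x x0 y y0; field.
  by rewrite x0 y0.
rewrite E; apply: (@le_trans _ _ ((m.*2.+1)%:R^-1 * ((m.*2.+1)%:R / (m.+1.*2)%:R))).
  rewrite mulrA mulVf ?pnatr_eq0// mul1r lef_pV2 ?posrE ?ltr0n// ler_nat.
  by rewrite doubleS; lia.
by rewrite ler_wpM2r.
Qed.

End PolynomialGeometricDecay.

(** * A de la Vallee Poussin kernel on the torus spanned by independent characters *)

Section TorusKernel.
Variables (R : realType) (G : topologicalZmodType).
Variable mu : probability (borel G) R.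
Hypothesis G_compact : compact [set: G].
Hypothesis mu_haar : is_haar mu.
Variables (n : nat) (chi : 'I_n -> character R G).

Hypothesis chi_indep : independent chi.
Implicit Types (w : 'I_n -> R[i]) (m : nat).

Local Notation I := (cintegral mu).
Local Notation hat := (fourier_coef mu).

(* The factors are |(1 + z_i) / 2| ^ (2 m) for the unimodular z_i = chi_i(g) / w_i;
   the exponents of z_i run over f i - m with f i <= 2 m. *)
Definition torus_kernel m w (g : G) : R :=
  \prod_i ((1 + complex.Re (chi i g * (w i)^*)) / 2) ^+ m.

Definition kernel_freq m (f : {ffun 'I_n -> 'I_(m.*2.+1)}) : character R G :=
  \sum_i (chi i *+ f i - chi i *+ m).

Definition kernel_coef m (f : {ffun 'I_n -> 'I_(m.*2.+1)}) : R :=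
  \prod_i ('C(m.*2, f i)%:R / 4 ^+ m).

Lemma character_sumE (J : Type) (s : seq J) (F : J -> character R G) g :
  (\sum_(j <- s) F j) g = \prod_(j <- s) F j g.
Proof. by elim/big_rec2: _ => // j x y _ <-. Qed.

Lemma character_mulrnE (j : character R G) k g : (j *+ k) g = j g ^+ k.
Proof.
by elim: k => [|k IH]; rewrite ?mulr0n// mulrS character_addE IH exprS.
Qed.

Lemma kernel_freqE m f g :
  kernel_freq (m := m) f g = \prod_i (chi i g ^+ f i * (chi i g)^* ^+ m).
Proof.
rewrite character_sumE; apply: eq_bigr => i _.
by rewrite character_addE character_oppE !character_mulrnE rmorphXn.
Qed.

(** On the unit circle [(1 + Re z) / 2 = (1 + z) ^ 2 * conj z / 4]; the binomial theorem does the
    rest. *)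
Lemma unimodular_halfE (z : R[i]) m : nm z = 1 ->
  ((((1 + complex.Re z) / 2) ^+ m)%:C : R[i]) =
  \sum_(k < m.*2.+1) (('C(m.*2, k)%:R / 4 ^+ m : R)%:C) * (z ^+ k * z^* ^+ m).
Proof.
move=> z1; have zz : z * z^* = 1 by rewrite mulcJ_nm z1 expr1n.
rewrite rmorphXn /=.
have -> : (((1 + complex.Re z) / 2)%:C : R[i]) = (1 + z) ^+ 2 * z^* / 4.
  have -> : (1 + z) ^+ 2 * z^* / 4 = (z + z^* + 2 * (z * z^*) + z * (z * z^* - 1)) / 4 by ring.
  rewrite zz subrr !mulr0 addr0 mulr1 addcJ.
  have -> : (((1 + complex.Re z) / 2)%:C : R[i]) = (1 + (complex.Re z)%:C) / 2.
    by rewrite rmorphM rmorphD fmorphV /= rmorph1 (rmorph_nat (real_complex R)).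
  by field.
rewrite exprMn [((1 + z) ^+ 2 * z^*) ^+ m]exprMn -exprM mul2n exprVn exprDn.
rewrite !mulr_suml; apply: eq_bigr => k _.
rewrite expr1n mul1r rmorphM fmorphV rmorphXn /= !(rmorph_nat (real_complex R)).
by rewrite -mulr_natl; ring.
Qed.

Lemma torus_kernelE m w g : (forall i, nm (w i) = 1) ->
  (torus_kernel m w g)%:C = \sum_f (kernel_coef (m := m) f)%:C * kernel_freq f g *
    \prod_i ((w i)^* ^+ f i * w i ^+ m).
Proof.
move=> w1; rewrite /torus_kernel rmorph_prod.
have z1 i : nm (chi i g * (w i)^*) = 1 by rewrite nmM nm_conj nm_character w1 mulr1.
rewrite (eq_bigr _ (fun i _ => unimodular_halfE m (z1 i))).
rewrite bigA_distr_bigA; apply: eq_bigr => f _.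
rewrite /= kernel_freqE rmorph_prod -!big_split; apply: eq_bigr => i _ /=.
have -> : (chi i g * (w i)^*)^* = (chi i g)^* * w i by rewrite rmorphM /= conjCK.
by rewrite !exprMn; ring.
Qed.

Definition central_freq m : {ffun 'I_n -> 'I_(m.*2.+1)} := [ffun _ => inord m].

(** Independence of the characters enters here: only the central exponents give the frequency 0. *)
Lemma kernel_freq_eq0 m f : (kernel_freq (m := m) f == 0) = (f == central_freq m).
Proof.
have mm : (m < m.*2.+1)%N by lia.
apply/eqP/eqP => [f0|->].
  apply/ffunP => i; apply: val_inj; rewrite ffunE /= inordK//.
  have H : \sum_i chi i *~ ((f i)%:Z - m%:Z) = 0.
    by rewrite -[RHS]f0; apply: eq_bigr => k _; rewrite mulrzBr -!pmulrn.
  by have /eqP := chi_indep H i; rewrite subr_eq0 => /eqP[].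
by apply: big1 => i _; rewrite ffunE /= inordK// subrr.
Qed.

Lemma continuous_sumC (J : Type) (s : seq J) (F : J -> G -> R[i]) :
  (forall i, continuous (F i)) -> continuous (\sum_(i <- s) F i).
Proof.
move=> cF; elim: s => [|i s IH]; first by rewrite big_nil; exact: (@continuousC_cst _ _ 0).
by rewrite big_cons; exact: (continuousCD (cF i) IH).
Qed.

Lemma cintegral_sum (J : Type) (s : seq J) (F : J -> G -> R[i]) :
  (forall i, continuous (F i)) -> I (\sum_(i <- s) F i) = \sum_(i <- s) I (F i).
Proof.
move=> cF; elim: s => [|i s IH].
  by rewrite !big_nil; exact: (cintegral_cst mu 0).
by rewrite !big_cons (cintegralD _ G_compact (cF i) (continuous_sumC cF)) IH.
Qed.

Lemma torus_kernel_funE m w : (forall i, nm (w i) = 1) ->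
  (fun g => (torus_kernel m w g)%:C) = \sum_f ((kernel_coef (m := m) f)%:C *
    \prod_i ((w i)^* ^+ f i * w i ^+ m)) *: (kernel_freq f : G -> R[i]).
Proof.
move=> w1; apply/funext => g; rewrite torus_kernelE// fct_sumE.
by apply: eq_bigr => f _; rewrite -[RHS]/(_ * _) mulrAC.
Qed.

Lemma continuous_torus_kernel m w : (forall i, nm (w i) = 1) ->
  continuous (fun g => (torus_kernel m w g)%:C : R[i]).
Proof.
move=> w1; rewrite torus_kernel_funE//; apply: continuous_sumC => f.
exact: (@continuousCZ _ _ _ _ (@character_continuous _ _ (kernel_freq f))).
Qed.

(** Only the frequency 0 survives integration, and there the powers of [w i] and its conjugate
    cancel, so the mass does not depend on the centre. *)
Lemma cintegral_torus_kernel m w : (forall i, nm (w i) = 1) ->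
  I (fun g => (torus_kernel m w g)%:C) = (central_bin_weight R m ^+ n)%:C.
Proof.
move=> w1; rewrite torus_kernel_funE// cintegral_sum => [|f]; last first.
  exact: (@continuousCZ _ _ _ _ (@character_continuous _ _ (kernel_freq f))).
have mm : (m < m.*2.+1)%N by lia.
rewrite (bigD1 (central_freq m))//= [X in _ + X]big1 => [|f f0].
  rewrite addr0 (cintegralZ _ G_compact _ (@character_continuous _ _ _)).
  rewrite (eqP (_ : kernel_freq (central_freq m) == 0)) ?kernel_freq_eq0//.
  rewrite (@cintegral_cst _ _ mu 1) mulr1 big1 => [|i _].
    rewrite mulr1 /kernel_coef; congr (_%:C).
    under eq_bigr do rewrite ffunE /= inordK//.
    by rewrite prodr_const card_ord.
  rewrite ffunE /= inordK// -exprMn mulrC mulcJ_nm w1 expr1n expr1n//.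
rewrite (cintegralZ _ G_compact _ (@character_continuous _ _ _)).
by rewrite (cintegral_character G_compact mu_haar) ?mulr0// kernel_freq_eq0.
Qed.

Lemma nm_unimodular_sub1 (z : R[i]) : nm z = 1 ->
  nm (z - 1) ^+ 2 = 2 - 2 * complex.Re z.
Proof.
move=> z1; have := nm_sqr z; rewrite z1 expr1n nm_sqr.
by case: z {z1} => a b /=; rewrite oppr0 addr0 => h; rewrite sqrrB; lra.
Qed.

Lemma kernel_factor (z w : R[i]) : nm z = 1 -> nm w = 1 ->
  (1 + complex.Re (z * w^*)) / 2 = 1 - nm (z - w) ^+ 2 / 4.
Proof.
move=> z1 w1; have zw : nm (z * w^*) = 1 by rewrite nmM nm_conj z1 w1 mulr1.
have -> : nm (z - w) = nm (z * w^* - 1).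
  have ww : w * w^* = 1 by rewrite mulcJ_nm w1 expr1n.
  by rewrite -[1 in RHS]ww -mulrBl nmM nm_conj w1 mulr1.
by rewrite nm_unimodular_sub1//; lra.
Qed.

Lemma kernel_factor01 (z w : R[i]) : nm z = 1 -> nm w = 1 ->
  0 <= (1 + complex.Re (z * w^*)) / 2 <= 1.
Proof.
move=> z1 w1; rewrite {2}kernel_factor//; apply/andP; split; last first.
  by rewrite lerBlDr lerDl divr_ge0 ?sqr_ge0.
have := abs_Re_le (z * w^*); rewrite nmM nm_conj z1 w1 mulr1.
by rewrite ler_norml => /andP[h _]; lra.
Qed.

Lemma torus_kernel_ge0 m w g : (forall i, nm (w i) = 1) -> 0 <= torus_kernel m w g.
Proof.
move=> w1; apply: prodr_ge0 => i _; rewrite exprn_ge0//.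
by have /andP[] := kernel_factor01 (nm_character (chi i) g) (w1 i).
Qed.

Lemma torus_kernel_le m w g e : (forall i, nm (w i) = 1) -> 0 <= e ->
  (exists i, e <= nm (chi i g - w i)) -> torus_kernel m w g <= (1 - e ^+ 2 / 4) ^+ m.
Proof.
move=> w1 e0 [i ei]; rewrite /torus_kernel (bigD1 i)//=.
have f01 k := kernel_factor01 (nm_character (chi k) g) (w1 k).
apply: (@le_trans _ _ (((1 + complex.Re (chi i g * (w i)^*)) / 2) ^+ m)).
  rewrite ler_piMr ?exprn_ge0//; first by have /andP[] := f01 i.
  apply: prodr_ile1 => k _; have /andP[h0 h1] := f01 k.
  by rewrite exprn_ge0 ?exprn_ile1.
have /andP[h0 _] := f01 i; move: h0.
rewrite kernel_factor ?nm_character// => h0.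
have h : 1 - nm (chi i g - w i) ^+ 2 / 4 <= 1 - e ^+ 2 / 4.
  by rewrite lerD2l lerN2 ler_pM2r ?invr_gt0// lerXn2r ?nnegrE// nm_ge0.
by rewrite lerXn2r ?nnegrE//; exact: le_trans h0 h.
Qed.

Lemma torus_kernel_mass m : (((m.*2.+1)%:R ^+ n)^-1 : R) <= central_bin_weight R m ^+ n.
Proof.
rewrite -exprVn lerXn2r ?nnegrE ?invr_ge0 ?ler0n//.
  by rewrite divr_ge0// exprn_ge0.
exact: central_bin_weight_ge.
Qed.

(** If [w] were missed, compactness would keep every point of [G] at distance at least [r] from it
    in some coordinate. The kernel centred at [w] would be at most [q ^+ m] on all of [G], which is
    eventually below its mean. *)
Lemma independent_characters_onto w : (forall i, nm (w i) = 1) ->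
  exists g, forall i, chi i g = w i.
Proof.
move=> w1; apply: contrapT => H.
pose d : G -> R[i] := \sum_i (fun g => (nm (chi i g - w i))%:C).
have cd : continuous d.
  apply: continuous_sumC => i; apply: continuous_real_complex.
  exact: (continuous_nm (continuousCB (@character_continuous _ _ (chi i))
    (@continuousC_cst _ _ (w i)))).
have dE g : d g = (\sum_i nm (chi i g - w i))%:C.
  by rewrite /d fct_sumE rmorph_sum.
have [|e e0 He] := compact_nm_bounded_below G_compact cd.
  move=> g; rewrite dE; apply/eqP => /complexI/eqP.
  rewrite psumr_eq0 => [/allP h|i _]; last exact: nm_ge0.
  apply: H; exists g => i; apply/eqP; rewrite -subr_eq0 -nm_eq0.
  by apply: (h i); rewrite mem_index_enum.
have n0 : (0 < n)%N.
  rewrite lt0n; apply/eqP => n0; apply: H; exists 0 => i.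
  by have := ltn_ord i; rewrite {2}n0.
have nR : 0 < n%:R :> R by rewrite ltr0n.
(* If all [n] distances were below [e / n], their sum would be below [e]. *)
pose r := e / n%:R; have r0 : 0 < r by rewrite divr_gt0.
have far g : exists i, r <= nm (chi i g - w i).
  apply: contrapT => /forallNP h.
  have := He g; rewrite dE nm_real ger0_norm; last by apply: sumr_ge0 => i _; exact: nm_ge0.
  apply/negP; rewrite -ltNge.
  have -> : e = \sum_(i < n) r by rewrite sumr_const card_ord -mulr_natr divfK ?gt_eqF.
  apply: ltr_sum => [|i _]; first by apply/hasP; exists (Ordinal n0); rewrite // mem_index_enum.
  by rewrite ltNge; apply/negP/h.
pose q := 1 - r ^+ 2 / 4.
have [i1 hi1] := far 0.
have q01 : 0 <= q < 1.
  apply/andP; split; last by rewrite ltrBlDr ltrDl divr_gt0// exprn_gt0.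
  have : nm (chi i1 0 - w i1) <= 2.
    by apply: le_trans (nmD _ _) _; rewrite nmN nm_character w1; lra.
  move=> h2; have : r ^+ 2 <= 2 ^+ 2 by rewrite lerXn2r ?nnegrE ?(ltW r0) ?(le_trans hi1 h2).
  by rewrite /q; lra.
have [m Hm] := poly_geometric_small n q01 (@ltr01 R).
have cq : continuous (cst (q ^+ m)%:C : G -> R[i]) := @continuousC_cst _ _ _.
have := @Re_cintegral_le _ _ mu G_compact _ _ (continuous_torus_kernel (m := m) w1) cq.
rewrite cintegral_torus_kernel// cintegral_cst /= => /(_ _) h.
have {}h : central_bin_weight R m ^+ n <= q ^+ m.
  apply: h => g; apply: torus_kernel_le => //; exact: ltW.
have := le_trans (torus_kernel_mass m) h.
have pp : 0 < (m.*2.+1)%:R ^+ n :> R by rewrite exprn_gt0// ltr0n.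
rewrite -div1r ler_pdivrMr// mulrC => h'.
by have := le_lt_trans h' Hm; rewrite ltxx.
Qed.

(** Uniform continuity for the pseudometric of the coordinates [chi i]: a stand-in for being the
    pullback of a continuous function on the torus. *)
Definition chi_uniform (f : G -> R[i]) := forall e : R, 0 < e -> exists2 d : R, 0 < d &
  forall g h, (forall i, nm (chi i g - chi i h) <= d) -> nm (f g - f h) <= e.

(** The approximant is the average of [f] against the normalized kernel centred at the coordinates
    of [g]. Expanding the kernel shows that this average is a trigonometric polynomial in [g]. *)
Lemma chi_uniform_trig_approx f e : continuous f -> chi_uniform f -> 0 < e ->
  exists2 p, trig_poly p & forall g, nm (f g - p g) <= e.
Proof.
move=> cf uf e0.
have [L HL] := compact_nm_bounded G_compact cf.
have L0 : 0 <= L by apply: le_trans (HL 0); exact: nm_ge0.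
have e4 : 0 < e / 4 by rewrite divr_gt0.
have [d d0 Hd] := uf _ e4.
pose r := Num.min d 1; have r0 : 0 < r by rewrite lt_min d0 ltr01.
have r1 : r <= 1 by rewrite ge_min lexx orbT.
have rd : r <= d by rewrite ge_min lexx.
pose q := 1 - r ^+ 2 / 4.
have q01 : 0 <= q < 1.
  apply/andP; split; last by rewrite ltrBlDr ltrDl divr_gt0// exprn_gt0.
  have : r ^+ 2 <= 1 by rewrite exprn_ile1// ltW.
  by rewrite /q; lra.
(* Where the coordinates are within [d] the error is at most [e / 4] times the kernel, elsewhere at
   most [2 L q ^ m]. With the factor 2 of [nm_cintegral_le], this choice makes each contribute at
   most [e / 2] after division by the mass. *)
have eL : 0 < e / (8 * (L + 1)) by rewrite divr_gt0// mulr_gt0// ltr_wpDl.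
have [m Hm] := poly_geometric_small n q01 eL.
pose C := central_bin_weight R m ^+ n.
have pp : 0 < (m.*2.+1)%:R ^+ n :> R by rewrite exprn_gt0// ltr0n.
have C0 : 0 < C by apply: lt_le_trans (torus_kernel_mass m); rewrite invr_gt0.
pose w g i := chi i g; have w1 g i : nm (w g i) = 1 by exact: nm_character.
pose c (fr : {ffun 'I_n -> 'I_(m.*2.+1)}) : R[i] := (kernel_coef fr)%:C * hat f (kernel_freq fr).
pose s : G -> R[i] := \sum_fr c fr *: (kernel_freq fr : G -> R[i]).
pose K g h : R[i] := (torus_kernel m (w g) h)%:C.
have cK g : continuous (K g) := continuous_torus_kernel (m := m) (w1 g).
have cfK g : continuous (f * K g) := continuousCM cf (cK g).
(* K g h is real, so the expansion of the kernel may be conjugated. *)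
have sE g : s g = I (f * K g).
  have KE h : K g h = (\sum_(fr : {ffun 'I_n -> 'I_(m.*2.+1)})
      ((kernel_coef fr)%:C * kernel_freq fr g) * (kernel_freq fr h)^*).
    rewrite -[LHS]conjCK; have -> : (K g h)^* = K g h by exact: conjc_real.
    rewrite /K torus_kernelE//.
    transitivity (\sum_(fr : {ffun 'I_n -> 'I_(m.*2.+1)}) ((kernel_coef fr)%:C * kernel_freq fr h *
        \prod_i ((w g i)^* ^+ fr i * w g i ^+ m))^* : R[i]); first exact: rmorph_sum.
    apply: eq_bigr => fr _.
    rewrite !rmorphM /=.
    have -> : ((kernel_coef fr)%:C : R[i])^* = (kernel_coef fr)%:C by exact: conjc_real.
    have -> : (\prod_i ((w g i)^* ^+ fr i * w g i ^+ m))^* = kernel_freq fr g :> R[i].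
      rewrite kernel_freqE; etransitivity; first exact: rmorph_prod.
      by apply: eq_bigr => i _; rewrite rmorphM !rmorphXn /= conjCK.
    by rewrite mulrAC.
  have -> : f * K g = \sum_(fr : {ffun 'I_n -> 'I_(m.*2.+1)})
      ((kernel_coef fr)%:C * kernel_freq fr g) *: (fun h => f h * (kernel_freq fr h)^*).
    apply/funext => h; rewrite -[LHS]/(f h * K g h) KE mulr_sumr fct_sumE.
    by apply: eq_bigr => fr _; rewrite mulrCA.
  have cfr (fr : {ffun 'I_n -> 'I_(m.*2.+1)}) := continuous_hat_integrand (j := kernel_freq fr) cf.
  rewrite cintegral_sum => [|fr]; last exact: (@continuousCZ _ _ _ _ (cfr fr)).
  rewrite /s fct_sumE; apply: eq_bigr => fr _.
  by rewrite (cintegralZ _ G_compact _ (cfr fr)) -/(hat _ _) mulrAC.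
have CE g : I (K g) = C%:C := cintegral_torus_kernel m (w1 g).
have C0' : C%:C != 0 :> R[i] by apply/eqP => /complexI C00; rewrite C00 ltxx in C0.
have cKL : continuous (cst ((2 * L * q ^+ m)%:C) : G -> R[i]) := @continuousC_cst _ _ _.
exists (C%:C^-1 *: s).
  apply: trig_polyZ; apply: trig_poly_sum => fr; apply: trig_polyZ.
  exact: trig_poly_character.
move=> g; pose F : G -> R[i] := f * K g - f g *: K g.
have cfgK : continuous (f g *: K g) := @continuousCZ _ _ _ (f g) (cK g).
have cF : continuous F := continuousCB (cfK g) cfgK.
have -> : f g - (C%:C^-1 *: s) g = - (C%:C^-1 * I F).
  rewrite /F (cintegralB _ G_compact (cfK g) cfgK) (cintegralZ _ G_compact _ (cK g)) CE -sE.
  by rewrite -[(_ *: s) g]/(_ * s g); field.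
rewrite nmN nmM nmV nm_real gtr0_norm//.
pose u h : R := e / 4 * torus_kernel m (w g) h + 2 * L * q ^+ m.
have uE : (fun h => (u h)%:C : R[i]) = ((e / 4)%:C : R[i]) *: K g + cst ((2 * L * q ^+ m)%:C).
  by apply/funext => h; rewrite /u rmorphD rmorphM.
have cZK := @continuousCZ _ _ _ ((e / 4)%:C : R[i]) (cK g).
have cu : continuous u.
  by have := continuous_Re (continuousCD cZK cKL); rewrite -uE.
have q0 : 0 <= q by have /andP[] := q01.
have Fu h : nm (F h) <= u h.
  have -> : F h = (f h - f g) * K g h by rewrite mulrBl.
  have K0 := torus_kernel_ge0 m h (w1 g).
  rewrite nmM /K nm_real ger0_norm// /u.
  have [near|far] := pselect (forall i, nm (chi i h - chi i g) <= d).
    rewrite ler_wpDr ?mulr_ge0 ?exprn_ge0// ler_wpM2r//.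
    exact: Hd.
  apply: ler_wpDl; first by rewrite mulr_ge0// ltW.
  apply: ler_pM => //; first exact: nm_ge0.
    by apply: le_trans (nmD _ _) _; rewrite nmN; have := HL h; have := HL g; lra.
  apply: torus_kernel_le => //; first exact: ltW.
  apply: contrapT => /forallNP nh; apply: far => i.
  by apply: le_trans _ rd; apply: ltW; rewrite ltNge; apply/negP/nh.
have := nm_cintegral_le mu G_compact cF cu Fu.
rewrite uE (cintegralD _ G_compact cZK cKL) (cintegralZ _ G_compact _ (cK g)) CE cintegral_cst.
rewrite -rmorphM -rmorphD /= => h.
rewrite mulrC ler_pdivrMr//; apply: le_trans h _.
have hm : q ^+ m <= e / (8 * (L + 1)) * C.
  have h1 := torus_kernel_mass m; rewrite -/C in h1.
  apply: (@le_trans _ _ (e / (8 * (L + 1)) * ((m.*2.+1)%:R ^+ n)^-1)).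
    by rewrite ler_pdivlMr// mulrC ltW.
  by rewrite ler_wpM2l// ltW.
have hL : L * q ^+ m <= e / 8 * C.
  apply: le_trans (ler_wpM2l L0 hm) _; rewrite mulrA ler_wpM2r ?(ltW C0)//.
  have -> : e / 8 = (L + 1) * (e / (8 * (L + 1))) by field; lra.
  by rewrite ler_wpM2r ?(ltW eL)// lerDl.
by lra.
Qed.

End TorusKernel.

(** * Angles on the unit circle *)

Section UnitCircle.
Variable R : realType.
Implicit Types (s t : R) (z w : R[i]).

Definition imc t : R[i] := 0 +i* t.

Lemma imcD s t : imc (s + t) = imc s + imc t.
Proof. by rewrite /imc -[RHS]/(Complex _ _) addr0. Qed.

Lemma imcN t : imc (- t) = - imc t.
Proof. by rewrite /imc -[RHS]/(Complex _ _) oppr0. Qed.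

Lemma imcMz t (k : int) : imc (t *~ k) = imc t *~ k.
Proof.
have E n : imc (t *+ n) = imc t *+ n.
  by elim: n => [//|n IH]; rewrite !mulrS imcD IH.
by case: k => n; [rewrite -!pmulrn E|rewrite NegzE !mulrNz -!pmulrn imcN E].
Qed.

Lemma nm_imc t : nm (imc t) = `|t|.
Proof. by rewrite /imc /= expr0n add0r sqrtr_sqr. Qed.

Lemma nm_cexp_imc t : nm (cexp (imc t)) = 1.
Proof. by rewrite nm_cexp /= expR0. Qed.

Lemma nm_cexp_imcB s t : `|s - t| <= 1 -> nm (cexp (imc s) - cexp (imc t)) <= 2 * `|s - t|.
Proof.
move=> st1; have -> : cexp (imc s) - cexp (imc t) = cexp (imc t) * (cexp (imc (s - t)) - 1).
  by rewrite mulrBr mulr1 -cexpD -imcD [t + _]addrC subrK.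
rewrite nmM nm_cexp_imc mul1r; move: (s - t) st1 => u u1.
have -> : cexp (imc u) - 1 = (cos u - 1) +i* sin u.
  by rewrite /cexp /= expR0 mul1r -[LHS]/(Complex _ _) oppr0 addr0.
apply: le_trans (nm_le_Re_Im _) _ => /=.
have h1 := one_sub_cos_le u; have h2 := abs_sin_le u.
have : u ^+ 2 <= `|u|.
  by rewrite -[u ^+ 2]real_normK ?num_real// expr2 ler_piMl.
have := normr_ge0 u; lra.
Qed.

Lemma cexp_real t : cexp t%:C = (expR t)%:C.
Proof. by rewrite /cexp /= cos0 sin0; exact: mulr1. Qed.

Lemma exists_log z : z != 0 -> exists w, cexp w = z.
Proof.
move=> z0; have n0 : 0 < nm z by rewrite nm_gt0.
have [|t _ E] := @exists_angle R (z / (nm z)%:C).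
  by rewrite nmM nmV nm_real ger0_norm ?nm_ge0// divff ?gt_eqF.
exists ((ln (nm z))%:C + imc t); rewrite cexpD -E cexp_real lnK// mulrC divfK//.
by apply/eqP => /complexI h; rewrite h ltxx in n0.
Qed.

Lemma close_angles s t (e : R) : nm (cexp (imc s) - cexp (imc t)) <= e -> e <= 2^-1 ->
  exists (k : int) u, s = t + pi *+ 2 *~ k + u /\ `|u| <= 4 * e.
Proof.
move=> ste e2; pose z := cexp (imc (s - t)).
have z1 : nm (z - 1) <= e.
  apply: le_trans ste; rewrite -[leRHS]mulr1 -(nm_cexp_imc (- t)) -nmM mulrBl.
  by rewrite -!cexpD -!imcD subrr cexp0.
have [w wz w4] := exists_small_log (le_trans z1 e2).
have Rw : complex.Re w = 0.
  by apply: expR_inj; rewrite -nm_cexp wz nm_cexp_imc expR0.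
have wE : w = imc (complex.Im w) by case: (w) Rw => p q /= ->.
have : cexp (imc (s - t - complex.Im w)) = 1.
  rewrite imcD imcN -wE cexpD cexpN wz divff// /z; exact: cexp_neq0.
move=> /cexp_eq1[k [E]].
exists k, (complex.Im w); rewrite -E; split; first by ring.
by apply: le_trans (abs_Im_le w) _; lra.
Qed.

(** An arbitrary choice, with default 0 far from 1; where it is used the logarithm is so short that
    [cexp_small_inj] determines it. *)
Definition small_log z : R[i] :=
  if pselect (nm (z - 1) <= 2^-1) is left h then projT1 (cid2 (exists_small_log h)) else 0.

Lemma small_logP z : nm (z - 1) <= 2^-1 ->
  cexp (small_log z) = z /\ nm (small_log z) <= 4 * nm (z - 1).
Proof.
by rewrite /small_log; case: pselect => // h _; case: cid2.
Qed.

End UnitCircle.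

(** * Lifting the logarithm to the universal cover of the torus, and its periods *)

Section TorusLift.
Variables (R : realType) (n : nat).
Local Notation V := ('I_n -> R).
Implicit Types (x y z p : V) (k l : 'I_n -> int).

Definition near_by (e : R) x y := forall i, `|x i - y i| <= e.

Lemma near_by_refl e x : 0 <= e -> near_by e x x.
Proof. by move=> e0 i; rewrite subrr normr0. Qed.

Variables (P : V -> R[i]) (e : R).
Hypothesis e0 : 0 < e.
Hypothesis P0 : forall x, P x != 0.
Hypothesis P_ratio : forall x y, near_by e x y -> nm (P y / P x - 1) <= 32^-1.

Definition step_log x y := small_log (P y / P x).

(** The threshold 1/32 makes each step at most 1/8, so a sum of a few steps stays within the range
    of [cexp_small_inj]. *)
Lemma step_logP x y : near_by e x y ->
  cexp (step_log x y) = P y / P x /\ nm (step_log x y) <= 8^-1.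
Proof.
move=> xy; have h := P_ratio xy.
by have [|h1 h2] := @small_logP R (P y / P x); [|split=> //]; lra.
Qed.

Definition midpoint x y : V := fun i => (x i + y i) / 2.

(* The logarithm of P y / P x continued along the segment from x to y in 2 ^ m
   equal steps. *)
Fixpoint path_log (m : nat) x y : R[i] :=
  if m is m'.+1 then path_log m' x (midpoint x y) + path_log m' (midpoint x y) y
  else step_log x y.

Lemma near_by_midl m x y : near_by (2 ^+ m.+1 * e) x y -> near_by (2 ^+ m * e) x (midpoint x y).
Proof.
move=> h i; have := h i; rewrite /midpoint exprS => hi.
have -> : x i - (x i + y i) / 2 = (x i - y i) / 2 by field.
by rewrite normrM (ger0_norm (_ : 0 <= 2^-1)) ?invr_ge0//; lra.
Qed.

Lemma near_by_midr m x y : near_by (2 ^+ m.+1 * e) x y -> near_by (2 ^+ m * e) (midpoint x y) y.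
Proof.
move=> h i; have := h i; rewrite /midpoint exprS => hi.
have -> : (x i + y i) / 2 - y i = (x i - y i) / 2 by field.
by rewrite normrM (ger0_norm (_ : 0 <= 2^-1)) ?invr_ge0//; lra.
Qed.

Lemma path_logP m x y : near_by (2 ^+ m * e) x y -> cexp (path_log m x y) = P y / P x.
Proof.
elim: m x y => [|m IH] x y h /=.
  by rewrite expr0 mul1r in h; have [] := step_logP h.
rewrite cexpD (IH _ _ (near_by_midl h)) (IH _ _ (near_by_midr h)).
by field; rewrite !P0.
Qed.

(** For a single step both sides are short logarithms of the same number. In general the identity is
    added over the small quadrilaterals between the two subdivided segments, and the inner sides
    cancel. *)
Lemma path_log_shift m x y x' y' :
  near_by (2 ^+ m * e) x y -> near_by (2 ^+ m * e) x' y' ->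
  near_by e x x' -> near_by e y y' ->
  path_log m x' y' = path_log m x y + step_log y y' - step_log x x'.
Proof.
elim: m x y x' y' => [|m IH] x y x' y' h h' hx hy /=.
  rewrite !expr0 !mul1r in h h'.
  have [E1 b1] := step_logP h; have [E2 b2] := step_logP h'.
  have [E3 b3] := step_logP hx; have [E4 b4] := step_logP hy.
  apply: cexp_small_inj; first by lra.
    apply: le_lt_trans (nmD _ _) _; rewrite nmN.
    by have := nmD (step_log x y) (step_log y y'); lra.
  rewrite !cexpD cexpN E1 E2 E3 E4; field.
  by rewrite !P0.
have hm : near_by e (midpoint x y) (midpoint x' y').
  move=> i; rewrite /midpoint.
  have -> : (x i + y i) / 2 - (x' i + y' i) / 2 = ((x i - x' i) + (y i - y' i)) / 2 by field.
  rewrite normrM (ger0_norm (_ : 0 <= 2^-1)) ?invr_ge0//.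
  have := ler_normD (x i - x' i) (y i - y' i); have := hx i; have := hy i; lra.
rewrite (IH _ _ _ _ (near_by_midl h) (near_by_midl h') hx hm).
rewrite (IH _ _ _ _ (near_by_midr h) (near_by_midr h') hm hy).
by ring.
Qed.

Lemma path_log_refine m x y : near_by (2 ^+ m * e) x y -> path_log m.+1 x y = path_log m x y.
Proof.
elim: m x y => [|m IH] x y h.
  have hl : near_by (2 ^+ 1 * e) x y.
    by move=> i; have := h i; rewrite expr0 expr1; move: e0; lra.
  have h1 := near_by_midl hl; have h2 := near_by_midr hl.
  rewrite expr0 mul1r in h h1 h2.
  have [E1 b1] := step_logP h; have [E2 b2] := step_logP h1; have [E3 b3] := step_logP h2.
  rewrite /=; apply: cexp_small_inj; [|lra|].
    by apply: le_lt_trans (nmD _ _) _; lra.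
  rewrite cexpD E1 E2 E3; field.
  by rewrite !P0.
rewrite [LHS]/= -/(path_log m.+1 x _) -/(path_log m.+1 _ y).
by rewrite (IH _ _ (near_by_midl h)) (IH _ _ (near_by_midr h)).
Qed.

Lemma near_by_scale x y : exists m, near_by (2 ^+ m * e) x y.
Proof.
pose S := \sum_i `|x i - y i|.
have S0 : 0 <= S by apply: sumr_ge0 => i _.
have [m Hm] := small_geometric S0 (half01 R) e0; exists m => i.
have := Hm m (leqnn m); rewrite exprVn ltr_pdivrMr ?exprn_gt0// mulrC => /ltW.
apply: le_trans; rewrite /S (bigD1 i)//= lerDl; exact: sumr_ge0.
Qed.

(** Any larger depth gives the same value of [lift], by [liftE]. *)
Definition lift_depth x := projT1 (cid (near_by_scale 0 x)).

Lemma lift_depthP x : near_by (2 ^+ lift_depth x * e) 0 x.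
Proof. by rewrite /lift_depth; case: cid. Qed.

Definition lift x := path_log (lift_depth x) 0 x.

Lemma near_by_expn_le m m' x y : (m <= m')%N ->
  near_by (2 ^+ m * e) x y -> near_by (2 ^+ m' * e) x y.
Proof.
move=> mm h i; apply: le_trans (h i) _; rewrite ler_wpM2r ?(ltW e0)//.
by rewrite ler_eXn2l// ltr1n.
Qed.

Lemma liftE m x : (lift_depth x <= m)%N -> lift x = path_log m 0 x.
Proof.
move=> /subnKC <-; elim: (m - _)%N => [|d IH]; first by rewrite addn0.
rewrite addnS path_log_refine ?IH//.
by apply: near_by_expn_le (lift_depthP x); exact: leq_addr.
Qed.

Lemma cexp_lift x : cexp (lift x) = P x / P 0.
Proof. exact: path_logP (lift_depthP x). Qed.

Lemma step_log_refl x : step_log x x = 0.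
Proof.
have [E b] := step_logP (near_by_refl x (ltW e0)).
apply: cexp_eq1_small; [by rewrite E divff|lra].
Qed.

Lemma lift_step x y : near_by e x y -> lift y = lift x + step_log x y.
Proof.
move=> xy; set m := maxn (lift_depth x) (lift_depth y).
rewrite (@liftE m x) ?leq_maxl// (@liftE m y) ?leq_maxr//.
rewrite (@path_log_shift m 0 x 0 y) ?step_log_refl ?subr0//.
- by apply: near_by_expn_le (lift_depthP x); exact: leq_maxl.
- by apply: near_by_expn_le (lift_depthP y); exact: leq_maxr.
- exact: near_by_refl (ltW e0).
Qed.

Hypothesis P_period : forall x k, P (fun i => x i + pi *+ 2 *~ k i) = P x.

Definition translate x k : V := fun i => x i + pi *+ 2 *~ k i.

Lemma step_log_translate x y k : step_log (translate x k) (translate y k) = step_log x y.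
Proof. by rewrite /step_log !P_period. Qed.

Lemma near_by_translate d x y k : near_by d x y -> near_by d (translate x k) (translate y k).
Proof. by move=> h i; rewrite /translate opprD addrACA subrr addr0. Qed.

Definition winding k := lift (translate 0 k) - lift 0.

(** The increment [D] under the translation does not change between points at distance [e], since
    [step_log] is periodic; a chain of [2 ^ m] such moves leads from 0 to [x]. *)
Lemma lift_translate x k : lift (translate x k) = lift x + winding k.
Proof.
pose D y := lift (translate y k) - lift y.
have Dloc y z : near_by e y z -> D z = D y.
  move=> h; rewrite /D (lift_step h) (lift_step (near_by_translate k h)).
  by rewrite step_log_translate; ring.
have [m Hm] := near_by_scale 0 x.
pose s : R := (2 ^+ m)^-1.
have s0 : 0 < 2 ^+ m :> R by rewrite exprn_gt0.
have chain j : D (fun i => j%:R * s * x i) = D 0.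
  elim: j => [|j IH]; first by congr D; apply/funext => i; rewrite !mul0r.
  rewrite -IH; apply: Dloc => i.
  have -> : j%:R * s * x i - j.+1%:R * s * x i = - (s * x i).
    by rewrite -natr1; ring.
  have h : `|x i| <= 2 ^+ m * e.
    by have := Hm i; rewrite -[X in `|X|]/(0 - x i) sub0r normrN.
  rewrite normrN normrM [`|s|]ger0_norm ?invr_ge0 ?(ltW s0)//.
  by rewrite mulrC ler_pdivrMr// mulrC.
have := chain (2 ^ m)%N.
rewrite (_ : (fun i => _) = x); last first.
  by apply/funext => i; rewrite natrX /s divff ?mul1r ?gt_eqF.
by rewrite /D /winding => <-; rewrite addrC subrK.
Qed.

Lemma windingD k l : winding (k + l) = winding k + winding l.
Proof.
have E : translate 0 (k + l) = translate (translate 0 l) k.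
  by apply/funext => i; rewrite /translate mulrzDr addrA addrAC.
by rewrite /winding E lift_translate /winding; ring.
Qed.

Lemma winding_int k : exists j : int, winding k = imc (pi *+ 2 *~ j).
Proof.
apply: cexp_eq1; rewrite cexpD cexpN !cexp_lift P_period.
by rewrite !divff ?invr1 ?mulr1// mulf_neq0 ?invr_eq0.
Qed.

Lemma winding0 : winding 0 = 0.
Proof. by apply: (addrI (winding 0)); rewrite -windingD !addr0. Qed.

Lemma windingMz k (j : int) : winding (k *~ j) = winding k *~ j.
Proof.
have WN l : winding (- l) = - winding l.
  by apply: (addrI (winding l)); rewrite -windingD !subrr winding0.
have E d : winding (k *+ d) = winding k *+ d.
  by elim: d => [|d IH]; rewrite ?mulr0n ?winding0// !mulrS windingD IH.
by case: j => d; [rewrite -!pmulrn E|rewrite NegzE !mulrNz -!pmulrn WN E].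
Qed.

(** [winding] is additive with values in the multiples of [2 pi i], hence given by its values on the
    unit vectors. The integers [c i] become the exponents of the character that is split off. *)
Lemma winding_linear : exists c : 'I_n -> int,
  forall k, winding k = imc (pi *+ 2 *~ (\sum_i c i * k i)).
Proof.
pose d i : 'I_n -> int := fun j => (i == j)%:Z.
have [c Hc] := choice (fun i => winding_int (d i)).
exists c => k.
have kE : k = \sum_i d i *~ k i.
  apply/funext => j; rewrite fct_sumE (bigD1 j)//= big1 => [|i ij].
    have -> : (d j *~ k j) j = d j j *~ k j.
      by case: (k j) => q; rewrite ?NegzE ?mulrNz -?pmulrn natmulfctE.
    by rewrite /d eqxx addr0 -mulrzr mul1r intz.
  have -> : (d i *~ k i) j = d i j *~ k i.
    by case: (k i) => q; rewrite ?NegzE ?mulrNz -?pmulrn natmulfctE.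
  by rewrite /d (negPf ij) mul0rz.
rewrite {1}kE (big_morph winding windingD winding0) mulrz_sumr.
rewrite (big_morph (@imc R) (@imcD R) (erefl (0 : R[i]))); apply: eq_bigr => i _.
by rewrite windingMz Hc -imcMz mulrzA.
Qed.

End TorusLift.

(** * Splitting a function on the torus into a character and an exponential *)

Section TorusFactorization.
Variables (R : realType) (G : topologicalZmodType).
Variables (n : nat) (chi : 'I_n -> character R G).
Hypothesis chi_onto : forall w : 'I_n -> R[i], (forall i, nm (w i) = 1) ->
  exists g, forall i, chi i g = w i.

Lemma character_mulrzE (j : character R G) (k : int) g : (j *~ k) g = j g ^ k.
Proof.
case: k => m; first by rewrite -pmulrn character_mulrnE.
rewrite NegzE mulrNz character_oppE -pmulrn character_mulrnE -exprnN.
have j0 : j g ^+ m.+1 != 0 by rewrite expf_neq0// character_neq0.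
apply: (mulfI j0); rewrite divff// mulcJ_nm nmX nm_character !expr1n//.
Qed.

(** Pull [a] back to a periodic function [P] on the universal cover and lift its logarithm.
    Subtracting the linear form with the same periods leaves a function that does not see the choice
    of angles. *)
Lemma chi_uniform_factorization (a : G -> R[i]) (d : R) : 0 < d ->
  (forall g, d <= nm (a g)) -> chi_uniform chi a ->
  exists (j : character R G) (f : G -> R[i]), chi_uniform chi f /\
    forall g, a g = j g * cexp (f g).
Proof.
move=> d0 da ua.
have pt (x : 'I_n -> R) : exists g, forall i, chi i g = cexp (imc (x i)).
  by apply: chi_onto => i; exact: nm_cexp_imc.
pose g_ x := projT1 (cid (pt x)).
have g_P x i : chi i (g_ x) = cexp (imc (x i)) by rewrite /g_; case: cid.
pose P x := a (g_ x).
have a_neq0 g : a g != 0 by rewrite -nm_gt0; apply: lt_le_trans (da g).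
(* Uniformity implies that [a g] depends only on the values [chi i g], so [P] is independent of the
   chosen preimages [g_]. *)
have aP g x : (forall i, chi i g = cexp (imc (x i))) -> a g = P x.
  move=> gx; apply/eqP; rewrite -subr_eq0 -nm_eq0 eq_le nm_ge0 andbT.
  apply/ler_addgt0Pr => e e0; rewrite add0r; have [r r0 Hr] := ua _ e0.
  by apply: Hr => i; rewrite g_P gx subrr nm0 ltW.
have ratio g h e : nm (a g - a h) <= d * e -> nm (a g / a h - 1) <= e.
  move=> ghe; have -> : a g / a h - 1 = (a g - a h) / a h by rewrite mulrBl divff.
  have e0 : 0 <= e by rewrite -(pmulr_rge0 _ d0) (le_trans _ ghe)// nm_ge0.
  rewrite nmM nmV ler_pdivrMr ?nm_gt0//; apply: le_trans ghe _.
  by rewrite mulrC ler_wpM2l// da.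
have d32 : 0 < d * 32^-1 by rewrite mulr_gt0.
have [r r0 Hr] := ua _ d32.
(* [nm_cexp_imcB] needs angles at distance at most 1 and doubles that distance. *)
pose e := Num.min 1 (r / 2).
have e0 : 0 < e by rewrite lt_min ltr01 divr_gt0.
have e1 : e <= 1 by rewrite ge_min lexx.
have er : e <= r / 2 by rewrite ge_min lexx orbT.
have P0 x : P x != 0 by exact: a_neq0.
have P_ratio x y : near_by e x y -> nm (P y / P x - 1) <= 32^-1.
  move=> xy; apply: ratio; apply: Hr => i; rewrite !g_P.
  have h := xy i; apply: le_trans (nm_cexp_imcB _) _; rewrite distrC; first by lra.
  by lra.
have P_period x (k : 'I_n -> int) : P (fun i => x i + pi *+ 2 *~ k i) = P x.
  apply: aP => i; rewrite g_P imcD imcMz cexpD cexpMz.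
  by rewrite [cexp (imc (pi *+ 2))]cexp_2pi exp1rz mulr1.
have ang g : exists x : 'I_n -> R, forall i, chi i g = cexp (imc (x i)).
  have : forall i, exists t, chi i g = cexp (imc t).
    by move=> i; have [t _ E] := exists_angle (nm_character (chi i) g); exists t.
  by move=> /choice[x Hx]; exists x.
have [x_ x_P] := choice ang.
have [c Hc] := winding_linear e0 P0 P_ratio P_period.
have [c0 Hc0] := exists_log (P0 0).
pose F := lift P e0.
pose f g := F (x_ g) - \sum_i imc (x_ g i) *~ c i + c0.
exists (\sum_i chi i *~ c i), f; split; last first.
  move=> g; rewrite (aP g (x_ g))// /f !cexpD cexpN Hc0 cexp_lift//.
  rewrite character_sumE cexp_sum.
  have -> : \prod_i (chi i *~ c i) g = \prod_i cexp (imc (x_ g i) *~ c i).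
    by apply: eq_bigr => i _; rewrite character_mulrzE cexpMz -x_P.
  have : \prod_i cexp (imc (x_ g i) *~ c i) != 0.
    by apply/prodf_neq0 => i _; exact: cexp_neq0.
  set q := \prod_i _ => q0; field; by rewrite q0 P0.
move=> e' e'0.
pose C := 1 + \sum_i `|(c i)%:~R : R|.
have C0 : 0 < C by rewrite ltr_wpDr// sumr_ge0.
have de0 : 0 < d * (e' / 8) by rewrite mulr_gt0// divr_gt0.
have [r1 r10 Hr1] := ua _ de0.
(* In order: [r1] makes the step logarithm at most [e' / 2]; 1/2 is the range of [close_angles];
   [e / 4] makes the angles [e]-close up to periods, as [close_angles] loses a factor 4; the last
   term bounds the linear form by [e' / 2]. *)
pose t := Num.min (Num.min r1 2^-1) (Num.min (e / 4) (e' / (8 * C))).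
have t0 : 0 < t by rewrite !lt_min r10 invr_gt0 ltr0n !divr_gt0// mulr_gt0.
have tr1 : t <= r1 by rewrite !ge_min lexx.
have t2 : t <= 2^-1 by rewrite !ge_min lexx ?orbT.
have te : t <= e / 4 by rewrite !ge_min lexx ?orbT.
have te' : t <= e' / (8 * C) by rewrite !ge_min lexx ?orbT.
exists t => // g h gh.
have : forall i, exists ku : int * R,
    x_ g i = x_ h i + pi *+ 2 *~ ku.1 + ku.2 /\ `|ku.2| <= 4 * t.
  move=> i; have := gh i; rewrite !x_P => hi.
  by have [k [u [E b]]] := close_angles hi t2; exists (k, u).
move=> /choice[ku Hku].
pose k i := (ku i).1; pose u i := (ku i).2.
have nearby : near_by e (translate (x_ h) k) (x_ g).
  move=> i; have [-> b] := Hku i; rewrite /translate -/(k i) opprD addNKr normrN.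
  by apply: le_trans b _; lra.
have Pg : P (x_ g) = a g by rewrite -(aP g (x_ g)).
have Ph : P (translate (x_ h) k) = a h by rewrite P_period -(aP h (x_ h)).
have agh : nm (a g / a h - 1) <= e' / 8.
  by apply: ratio; apply: Hr1 => i; apply: le_trans (gh i) tr1.
have step : nm (step_log P (translate (x_ h) k) (x_ g)) <= e' / 2.
  rewrite /step_log Pg Ph; have [|_ b] := @small_logP R (a g / a h); last by lra.
  by have := P_ratio _ _ nearby; rewrite Pg Ph; lra.
(* The periods by which the two families of angles differ contribute [winding k] here and also to
   the lift, so they cancel in [f g - f h]. *)
have sumE : \sum_i imc (x_ g i) *~ c i =
    \sum_i imc (x_ h i) *~ c i + winding P e0 k + \sum_i imc (u i) *~ c i.
  have H i := (Hku i).1; rewrite Hc; move: (pi *+ 2 : R) H => p2 H.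
  rewrite mulrz_sumr (big_morph (@imc R) (@imcD R) (erefl (0 : R[i]))).
  rewrite -!big_split; apply: eq_bigr => i _ /=.
  rewrite H !imcD !mulrzDl; congr (_ + _ + _).
  by rewrite -imcMz -mulrzA [c i * _]mulrC.
have -> : f g - f h = step_log P (translate (x_ h) k) (x_ g) - \sum_i imc (u i) *~ c i.
  rewrite /f /F (lift_step e0 P0 P_ratio nearby) (lift_translate e0 P0 P_ratio P_period) sumE.
  by ring.
apply: le_trans (nmD _ _) _; rewrite nmN.
have : nm (\sum_i imc (u i) *~ c i) <= e' / 2; last by lra.
apply: le_trans (nm_sum _ _ _) _.
apply: (@le_trans _ _ (\sum_i (4 * t) * `|(c i)%:~R : R|)).
  apply: ler_sum => i _; rewrite -imcMz nm_imc -mulrzr normrM ler_wpM2r//.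
  exact: (Hku i).2.
rewrite -mulr_sumr; apply: (@le_trans _ _ (4 * t * C)).
  by rewrite ler_wpM2l ?mulr_ge0 ?(ltW t0)// /C lerDr.
move: te'; rewrite ler_pdivlMr ?mulr_gt0//; lra.
Qed.

End TorusFactorization.

(** * Functions uniform in the coordinates *)

Section Uniformity.
Variables (R : realType) (G : topologicalZmodType).
Variables (n : nat) (chi : 'I_n -> character R G).
Implicit Types (f : G -> R[i]) (j k : character R G) (e : R).

Lemma nm_characterDB j k (g h : G) :
  nm ((j + k) g - (j + k) h) <= nm (j g - j h) + nm (k g - k h).
Proof.
have -> : (j + k) g - (j + k) h = (j g - j h) * k g + j h * (k g - k h).
  by rewrite !character_addE; ring.
by apply: le_trans (nmD _ _) _; rewrite !nmM !nm_character mulr1 mul1r.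
Qed.

Lemma nm_characterMzB j (m : int) (g h : G) :
  nm ((j *~ m) g - (j *~ m) h) <= `|m%:~R| * nm (j g - j h).
Proof.
have E (d : nat) : nm ((j *+ d) g - (j *+ d) h) <= d%:R * nm (j g - j h).
  elim: d => [|d IH]; first by rewrite mulr0n subrr nm0 mul0r.
  rewrite mulrS; apply: le_trans (nm_characterDB _ _ _ _) _.
  by rewrite -nat1r mulrDl mul1r lerD2l.
case: m => d; first by rewrite -pmulrn (ger0_norm (ler0n _ _)).
rewrite NegzE mulrNz -pmulrn !character_oppE -rmorphB nm_conj.
by rewrite mulrNz normrN (ger0_norm (ler0n _ _)).
Qed.

Lemma nm_character_sumB (s : seq 'I_n) (F : 'I_n -> character R G) (g h : G) :
  nm ((\sum_(i <- s) F i) g - (\sum_(i <- s) F i) h) <= \sum_(i <- s) nm (F i g - F i h).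
Proof.
elim: s => [|i s IH]; first by rewrite !big_nil subrr nm0.
rewrite !big_cons; apply: le_trans (nm_characterDB _ _ _ _) _.
by rewrite lerD2l.
Qed.

Lemma chi_uniform_character (k : 'I_n -> int) :
  chi_uniform chi (\sum_i chi i *~ k i : character R G).
Proof.
move=> e e0; pose C := 1 + \sum_i `|(k i)%:~R : R|.
have C0 : 0 < C by rewrite ltr_wpDr// sumr_ge0.
exists (e / C); first by rewrite divr_gt0.
move=> g h H; apply: le_trans (nm_character_sumB _ _ _ _) _.
apply: (@le_trans _ _ (\sum_i `|(k i)%:~R : R| * (e / C))).
  apply: ler_sum => i _; apply: le_trans (nm_characterMzB _ _ _ _) _.
  by rewrite ler_wpM2l.
rewrite -mulr_suml mulrC mulrAC ler_pdivrMr// ler_wpM2l ?(ltW e0)//.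
by rewrite /C lerDr.
Qed.

Lemma chi_uniformD f (h : G -> R[i]) :
  chi_uniform chi f -> chi_uniform chi h -> chi_uniform chi (f + h).
Proof.
move=> uf uh e e0; have e2 : 0 < e / 2 by rewrite divr_gt0.
have [d d0 Hd] := uf _ e2; have [r r0 Hr] := uh _ e2.
exists (Num.min d r); first by rewrite lt_min d0.
move=> x y H; have -> : (f + h) x - (f + h) y = (f x - f y) + (h x - h y).
  by rewrite addrACA -opprD.
have h1 : nm (f x - f y) <= e / 2 by apply: Hd => i; have := H i; rewrite le_min => /andP[].
have h2 : nm (h x - h y) <= e / 2 by apply: Hr => i; have := H i; rewrite le_min => /andP[].
by apply: le_trans (nmD _ _) _; lra.
Qed.

Lemma chi_uniformZ (c : R[i]) f : chi_uniform chi f -> chi_uniform chi (c *: f).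
Proof.
move=> uf e e0; have c0 : 0 < nm c + 1 by rewrite ltr_wpDl// nm_ge0.
have [d d0 Hd] := uf _ (divr_gt0 e0 c0); exists d => // x y /Hd H.
have -> : (c *: f) x - (c *: f) y = c * (f x - f y) by rewrite mulrBr.
move: H; rewrite ler_pdivlMr// nmM => H; apply: le_trans _ H.
by rewrite mulrC ler_wpM2l ?nm_ge0// lerDl.
Qed.

Lemma chi_uniform_sum (J : eqType) (s : seq J) (F : J -> G -> R[i]) :
  (forall i, i \in s -> chi_uniform chi (F i)) -> chi_uniform chi (\sum_(i <- s) F i).
Proof.
elim: s => [|i s IH] H.
  by rewrite big_nil => e e0; exists 1 => // x y _; rewrite subrr nm0 ltW.
rewrite big_cons; apply: chi_uniformD; first by apply: H; rewrite mem_head.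
by apply: IH => k ks; apply: H; rewrite in_cons ks orbT.
Qed.

Lemma chi_uniform_continuous f : chi_uniform chi f -> continuous f.
Proof.
move=> uf; apply/continuousCP => x e e0.
have e2 : 0 < e / 2 by rewrite divr_gt0.
have [d d0 Hd] := uf _ e2.
have H : \forall y \near x, forall i, nm (chi i x - chi i y) < d.
  apply: filter_forall => i.
  by have /continuousCP := @character_continuous _ _ (chi i); apply.
apply: filterS H => y Hy; apply: le_lt_trans (Hd x y _) _; last by lra.
by move=> i; exact: ltW.
Qed.

End Uniformity.

(** * Units are characters times exponentials *)

Section LogarithmsOfUnits.
Variables (R : realType) (G : topologicalZmodType).
Variable mu : probability (borel G) R.
Variables (B : set (G -> R[i])) (N : (G -> R[i]) -> R).
Hypothesis G_compact : compact [set: G].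
Hypothesis mu_haar : is_haar mu.
Hypothesis Badm : admissible B N.
Variable le : rel (character R G).
Hypothesis le_order : is_group_order le.
Implicit Types (a b f h p u v x : G -> R[i]) (j k : character R G) (e : R).

Let Balg : is_banach_subalgebra B N := admissible_banach Badm.
Let B1 : B 1 := balg1 Balg.
Let BD := balgD Balg.
Let BB := balgB Balg.
Let BN := balgN Balg.
Let BM := balgM Balg.
Let BC := balg_continuous Balg.
Let BE := balg_fexp Balg.
Let Bchar := character_in_algebra Badm.

Local Notation I := (cintegral mu).
Local Notation hat := (fourier_coef mu).

(* The Bohr-van Kampen theorem, with the logarithm in B. *)
Theorem unit_character_exponential a : GL B a ->
  exists j h, B h /\ a = (j : G -> R[i]) * fexp h.
Proof.
move=> [Ba [b Bb ab]].
have Nb0 := bnorm_ge0 Balg Bb.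
(* This tolerance makes [b * p] within 1/8 of 1 in norm, so that [p] is [a] times an exponential in
   [B]. *)
have e0 : 0 < 8^-1 / (N b + 1) by rewrite divr_gt0// ltr_wpDl.
have [p tp ap] := trig_approx Badm Ba e0.
have Bp := trig_poly_in_algebra Badm tp.
have [||h0 Bh0 bp] := exists_flog Badm (u := b * p); first exact: BM.
  have -> : b * p - 1 = - (b * (a - p)) by rewrite mulrBr [b * a]mulrC ab opprB.
  rewrite (bnormN Balg); last by apply: BM => //; exact: BB.
  apply: le_trans (bnormM Balg Bb (BB Ba Bp)) _.
  move: (ltW ap); rewrite ler_pdivlMr ?ltr_wpDl// => h.
  by have := bnorm_ge0 Balg (BB Ba Bp); lra.
have pE : p = a * fexp h0 by rewrite -bp mulrA ab mul1r.
have [s _ sE] := trig_hatE G_compact mu_haar tp.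
have [n [chi [chi_indep gen]]] := exists_independent_generators le_order s.
have onto := independent_characters_onto G_compact mu_haar chi_indep.
have a0 g : a g != 0 by exact: (@GL_neq0 _ _ B a g (conj Ba (ex_intro2 _ _ b Bb ab))).
have p0 g : p g != 0 by rewrite pE mulf_neq0 ?cexp_neq0.
have [d d0 pd] := compact_nm_bounded_below G_compact (BC Bp) p0.
have up : chi_uniform chi p.
  rewrite sE; apply: chi_uniform_sum => i /gen[k ->].
  by apply: chi_uniformZ; exact: chi_uniform_character.
have [j [f [uf fE]]] := chi_uniform_factorization onto d0 pd up.
have [q tq fq] := chi_uniform_trig_approx G_compact mu_haar chi_indep
  (chi_uniform_continuous uf) uf (e := 8^-1) (ltac:(by rewrite invr_gt0 ltr0n)).
have Bq := trig_poly_in_algebra Badm tq.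
have jj : (j : G -> R[i]) * ((- j : character R G) : G -> R[i]) = 1.
  by apply/funext => g; rewrite -[LHS]/((j + - j) g) subrr.
(* The lift [f] is not known to lie in [B]. Replacing it by the uniformly close [q] gives
   [r = exp (f - q)], which is in [B] and uniformly close to 1, as [fexp_segment] requires. *)
pose r := p * ((- j : character R G) : G -> R[i]) * fexp (- q).
have rE g : r g = cexp (f g - q g).
  rewrite cexpD -[LHS]/(p g * (- j) g * cexp (- q g)) fE; congr (_ * _).
  by rewrite mulrAC -[j g * _]/((j + - j) g) subrr mul1r.
have [||h1 Bh1 rh1] := fexp_segment Badm (a := r).
- by apply: BM; [exact: BM|apply: BE; exact: BN].
- move=> g; rewrite rE; have := nm_cexp_sub1_le (fq g) (lexx _); lra.
exists j, (h1 + q - h0); split; first by apply: BB => //; exact: BD.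
have -> : a = p * fexp (- h0) by rewrite pE -mulrA fexpVr mulr1.
rewrite fexpD mulrA; congr (_ * _).
rewrite fexpD -rh1 /r -mulrA [fexp (- q) * _]mulrC -mulrA fexpVr mulr1.
by rewrite mulrCA jj mulr1.
Qed.

End LogarithmsOfUnits.

(** * Integrals of real continuous functions *)

Section RealIntegral.
Variables (R : realType) (G : topologicalZmodType).
Variable mu : probability (borel G) R.
Hypothesis G_compact : compact [set: G].
Implicit Types (u v : G -> R) (f : G -> R[i]).

Definition rint u : R := complex.Re (cintegral mu (fun g => (u g)%:C)).

Lemma rint_le u v : continuous u -> continuous v -> (forall g, u g <= v g) -> rint u <= rint v.
Proof.
by move=> cu cv; exact: (Re_cintegral_le mu G_compact (continuous_real_complex cu)
  (continuous_real_complex cv)).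
Qed.

Lemma rint_cst (c : R) : rint (cst c) = c.
Proof. by rewrite /rint (cintegral_cst mu c%:C). Qed.

Lemma rint_linear (c : R) u v : continuous u -> continuous v ->
  rint (fun g => c * u g + v g) = c * rint u + rint v.
Proof.
move=> cu cv; have [cu' cv'] := (continuous_real_complex cu, continuous_real_complex cv).
rewrite /rint (_ : (fun g => _) = c%:C *: (fun g => (u g)%:C : R[i]) + (fun g => (v g)%:C : R[i])).
  rewrite (cintegralD _ G_compact (@continuousCZ _ _ _ c%:C cu') cv').
  by rewrite (cintegralZ _ G_compact _ cu') ReD ReM_real.
by apply/funext => g; rewrite rmorphD rmorphM.
Qed.

Lemma continuous_linear (c : R) u v : continuous u -> continuous v ->
  continuous (fun g => c * u g + v g).
Proof.
move=> cu cv x; apply: (@cvgD _ _ _ _ _ (fun g => c * u g) v); last exact: cv.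
by apply: (@cvgM _ _ _ _ (cst c) u); [exact: cvg_cst|exact: cu].
Qed.

Lemma sqnorm_rint f : sqnorm mu f = rint (fun g => nm (f g) ^+ 2).
Proof. by []. Qed.

End RealIntegral.

(** * One-sided spectra under exponentials and logarithms *)

Section OneSidedLogarithms.
Variables (R : realType) (G : topologicalZmodType).
Variable mu : probability (borel G) R.
Variables (B : set (G -> R[i])) (N : (G -> R[i]) -> R).
Hypothesis G_compact : compact [set: G].
Hypothesis mu_haar : is_haar mu.
Hypothesis Badm : admissible B N.
Variable le : rel (character R G).
Hypothesis le_order : is_group_order le.
Implicit Types (a b f h p u v x : G -> R[i]) (j k : character R G) (e : R).

Let Balg : is_banach_subalgebra B N := admissible_banach Badm.
Let B1 : B 1 := balg1 Balg.
Let BB := balgB Balg.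
Let BN := balgN Balg.
Let BM := balgM Balg.
Let BC := balg_continuous Balg.
Let BE := balg_fexp Balg.

Local Notation I := (cintegral mu).
Local Notation hat := (fourier_coef mu).
Local Notation Gp := (Gamma_plus le).
Local Notation Gm := (Gamma_minus le).
Local Notation spec := (spec_in mu B).

Lemma group_order_add_ge0 j k : Gp j -> Gp k -> Gp (j + k).
Proof.
rewrite /Gamma_plus /= => j0 k0; apply: (group_order_trans le_order k0).
by have := group_order_add le_order k j0; rewrite add0r.
Qed.

Lemma group_order_oppr j : le 0 (- j) = le j 0.
Proof.
apply/idP/idP => h.
  by have := group_order_add le_order j h; rewrite add0r addNr.
by have := group_order_add le_order (- j) h; rewrite add0r subrr.
Qed.

Lemma Gamma_minusN j : Gm j <-> Gp (- j).
Proof. by rewrite /Gamma_minus /Gamma_plus /= group_order_oppr. Qed.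

Lemma group_order_add_le0 j k : Gm j -> Gm k -> Gm (j + k).
Proof.
by rewrite !Gamma_minusN opprD; exact: group_order_add_ge0.
Qed.

Lemma not_Gamma_plus j : ~ Gp j <-> Gm j /\ j <> 0.
Proof.
rewrite /Gamma_plus /Gamma_minus /=; split=> [/negP h|[j0 jn0] h].
  have /orP[h'|h'] := group_order_total le_order 0 j; first by rewrite h' in h.
  by split=> // j0; move: h; rewrite j0 (group_order_refl le_order).
by apply: jn0; apply: (group_order_anti le_order); rewrite h j0.
Qed.

Lemma not_Gamma_plusD j k : ~ Gp j -> ~ Gp k -> ~ Gp (j + k).
Proof.
move=> /not_Gamma_plus[j0 jn0] /not_Gamma_plus[k0 kn0].
apply/not_Gamma_plus; split; first exact: group_order_add_le0.
move=> jk; apply: jn0; apply: (group_order_anti le_order); rewrite j0/=.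
by rewrite (_ : j = - k) ?group_order_oppr//; apply/eqP; rewrite -subr_eq0 opprK jk.
Qed.

Lemma spec_in1 : spec Gp 1.
Proof.
apply: (@spec_in_character _ _ mu B N G_compact mu_haar Badm Gp 0).
exact: (group_order_refl le_order).
Qed.

Lemma spec_plusM a b : spec Gp a -> spec Gp b -> spec Gp (a * b).
Proof. by apply: (spec_inM G_compact mu_haar Badm); exact: group_order_add_ge0. Qed.

Lemma spec_plus_fexp x : spec Gp x -> spec Gp (fexp x).
Proof.
move=> Sx; rewrite -(subrK 1 (fexp x)); apply: (spec_inD G_compact Badm); last exact: spec_in1.
by apply: (spec_in_fexp_sub1 G_compact mu_haar Badm) => //; exact: group_order_add_ge0.
Qed.

Lemma GL_fexp_plus x : Bplus mu le B x -> GL (Bplus mu le B) (fexp x).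
Proof.
move=> /spec_inP Sx; split; first by apply/spec_inP; exact: spec_plus_fexp.
exists (fexp (- x)); last exact: fexpVr.
by apply/spec_inP; apply: spec_plus_fexp; exact: (spec_inN G_compact Badm).
Qed.

(** The frequency 0 goes to [p1], so [p2] is strictly negative: it has mean zero and shares no
    frequency with its conjugate. *)
Lemma trig_split p : trig_poly p -> exists p1 p2, [/\ trig_poly p1, trig_poly p2,
  p = p1 + p2, spec Gp p1 & spec (~` Gp) p2].
Proof.
move=> tp; have [p1 [p2 [t1 t2 E H]]] := trig_restrict G_compact mu_haar Gp tp.
exists p1, p2; split=> //; split; try exact: (trig_poly_in_algebra Badm).
  by move=> j /(H j).2.
by move=> j /contrapT/(H j).1.
Qed.

Lemma spec_not_plus a : spec (~` Gp) a -> spec Gm a.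
Proof. by apply: spec_in_sub => j /not_Gamma_plus[]. Qed.

(* Pairing r x with x gives the integral of r |x|^2, whose real part is positive. *)
Lemma spectrum_overlap a x : B a -> B x -> (forall g, nm (a g - 1) <= 2^-1) ->
  (forall g, x g != 0) -> ~ (forall j, hat (a * x) j = 0 \/ hat x j = 0).
Proof.
move=> Ba Bx a2 x0 H.
have cx := BC Bx; have cax := BC (BM Ba Bx).
have := ip_disjoint G_compact mu_haar Badm (BM Ba Bx) cx H.
have [d d0 xd] := compact_nm_bounded_below G_compact cx x0.
have cd : continuous (cst (d ^+ 2 / 2)%:C : G -> R[i]) := @continuousC_cst _ _ _.
have := Re_cintegral_le mu G_compact cd (continuous_ip cax cx).
rewrite cintegral_cst -/(ip mu _ _) => h h0; move: h; rewrite h0 => /(_ _)h.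
suff : d ^+ 2 / 2 <= 0 by apply/negP; rewrite -ltNge divr_gt0// exprn_gt0.
apply: h => g /=.
have -> : (a * x) g * (x g)^* = (nm (x g) ^+ 2)%:C * a g.
  by rewrite -mulcJ_nm -[(a * x) g]/(a g * x g); ring.
rewrite ReM_real.
have ar : 2^-1 <= complex.Re (a g).
  have := abs_Re_le (a g - 1); rewrite ReD ReN /= ler_norml => /andP[h1 _].
  by have := a2 g; lra.
have xx : d ^+ 2 <= nm (x g) ^+ 2 by rewrite lerXn2r ?nnegrE ?nm_ge0// ltW.
by apply: ler_pM => //; rewrite ?invr_ge0// exprn_ge0// ltW.
Qed.

(* With s a trigonometric polynomial near h, the unit r = exp (h - s) is close to 1
   and r = (am exp (- s2)) j (ap exp (- s1)); if j > 0 and x is the inverse of the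
   first factor, then x and r x have disjoint spectra. *)
Lemma factor_index_not_gt0 h am ap (am' : G -> R[i]) j : B h ->
  spec Gm am -> spec Gm am' -> am * am' = 1 -> spec Gp ap ->
  (forall x, spec Gm x -> spec Gm (fexp x)) ->
  (forall x y, spec Gm x -> spec Gm y -> spec Gm (x * y)) ->
  fexp h = am * (j : G -> R[i]) * ap -> ~ (Gp j /\ j <> 0).
Proof.
move=> Bh Sam Sam' amam' Sap Gmexp GmM hE [j0 jn0].
have e0 : 0 < 8^-1 :> R by rewrite invr_gt0.
have [s ts hs] := trig_approx Badm Bh e0.
have Bs := trig_poly_in_algebra Badm ts.
have [s1 [s2 [_ _ sE Ss1 /spec_not_plus Ss2]]] := trig_split ts.
pose r := fexp (h - s).
pose x := am' * fexp s2.
have Sx : spec Gm x by apply: GmM => //; exact: Gmexp.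
have Br : B r by apply: BE; exact: BB.
apply: (@spectrum_overlap r x Br Sx.1).
- move=> g; have := @nm_cexp_sub1_le R ((h - s) g) 8^-1.
  have b := le_trans (nm_le_bnorm Balg g (BB Bh Bs)) (ltW hs).
  by move=> /(_ b (lexx _)); rewrite /r /fexp; lra.
- move=> g; rewrite mulf_neq0 ?cexp_neq0//; apply/eqP => a0.
  have := congr1 (fun f => f g) amam'.
  by rewrite -[X in X = _]/(am g * am' g) a0 mulr0 => /eqP; rewrite eq_sym oner_eq0.
have rxE : r * x = (j : G -> R[i]) * (ap * fexp (- s1)).
  rewrite /r /x sE opprD addrA !fexpD hE.
  transitivity ((am * am') * (fexp s2 * fexp (- s2)) * ((j : G -> R[i]) * (ap * fexp (- s1)))).
    by ring.
  by rewrite amam' fexpVr !mul1r.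
have Srx : spec [set k | Gp k /\ k <> 0] (r * x).
  rewrite rxE; apply: (@spec_inM _ _ _ _ _ G_compact mu_haar Badm [set j] Gp).
  - move=> k l -> l0; split; first exact: group_order_add_ge0.
    move=> jl; apply: jn0; apply: (group_order_anti le_order).
    have jE : j = - l by apply/eqP; rewrite -subr_eq0 opprK jl.
    apply/andP; split; last exact: j0.
    by rewrite jE -group_order_oppr opprK.
  - exact: (spec_in_character G_compact mu_haar Badm).
  - apply: spec_plusM => //; apply: spec_plus_fexp.
    exact: (spec_inN G_compact Badm).
move=> k; have [Gk|Gk] := pselect (Gm k); last by right; exact: Sx.2.
left; apply: Srx.2 => -[k0 kn0]; apply: kn0.
by apply: (group_order_anti le_order); rewrite Gk k0.
Qed.

Lemma sqr_le_add1 (c d : R) : 0 <= c -> 0 <= d -> c <= d + 1 -> c ^+ 2 <= 2 * d ^+ 2 + 2.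
Proof.
move=> c0 d0 cd; apply: (@le_trans _ _ ((d + 1) ^+ 2)).
  by rewrite lerXn2r ?nnegrE// addr_ge0.
by have := sqr_ge0 (d - 1); rewrite sqrrB sqrrD; lra.
Qed.

(** In use [d] is the squared L2 norm of [E - 1], which reappears on the right; for [e <= 1/8] its
    coefficient is at most 1/8 and can be absorbed. *)
Lemma absorb_sqr (c d e : R) : 0 <= c -> 0 <= d -> 0 < e -> e <= 8^-1 ->
  c + d <= 8 * e ^+ 2 * d + 8 * e ^+ 2 -> d <= 16 * e ^+ 2.
Proof.
move=> c0 d0 e0 e8 cd; have ee : e ^+ 2 <= 8^-1 * 8^-1 by rewrite expr2 ler_pM// ltW.
have : 8 * e ^+ 2 * d <= 8^-1 * d by rewrite ler_wpM2r//; lra.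
by have := sqr_ge0 e; lra.
Qed.

(** The term [-1 * c] disappears after integration when [c] has mean zero, so the L1 norm is
    controlled by [q ^ 2]. For [c >= 0] one has [c <= q] and [2 q <= q ^ 2 / e + e]; for [c < 0] the
    bound is immediate. *)
Lemma abs_le_of_log_bound (c q e : R) : 0 < e -> 0 <= q -> expR c <= q + 1 ->
  `|c| <= e^-1 * q ^+ 2 + (-1 * c + e).
Proof.
move=> e0 q0 cq; have eq0 : 0 <= e^-1 * q ^+ 2 by rewrite mulr_ge0 ?sqr_ge0// invr_ge0 ltW.
have [c0|c0] := ger0P c; last by lra.
have h1 := expR_ge1Dx c.
have : 0 <= (q - e) ^+ 2 * e^-1 by rewrite mulr_ge0 ?sqr_ge0// invr_ge0 ltW.
have -> : (q - e) ^+ 2 * e^-1 = e^-1 * q ^+ 2 + e - 2 * q by field; rewrite gt_eqF.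
lra.
Qed.

(* For a trigonometric polynomial s within e of h, with s2 its strictly negative
   part and E = exp s2, the spectra of A = exp h exp (s2 - s) and E - 1 are disjoint
   and A is within O(e) |E| of E, so E - 1 = O(e) in L2. As Re s2 = log |E| <= |E| - 1
   has mean zero, Re s2 = O(e) in L1, which bounds the coefficients of s2. *)
Lemma log_spec_plus h : B h -> spec Gp (fexp h) -> spec Gp h.
Proof.
move=> Bh Seh; split=> // j nGj.
apply: Normc.eq0_normc; apply/eqP; rewrite eq_le nm_ge0 andbT.
(* The constant is [2 + 2 * 34]: 2 for replacing [h] by [s], and 34 for the coefficient of [Re s2],
   which enters twice and is at most [2 * 17 e]. *)
suff key e : 0 < e -> e <= 8^-1 -> nm (hat h j) <= 70 * e.
  apply/ler_addgt0Pr => e e0; rewrite add0r.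
  have m0 : 0 < Num.min 8^-1 (e / 70) by rewrite lt_min invr_gt0 ltr0n divr_gt0.
  have m1 : Num.min 8^-1 (e / 70) <= 8^-1 by rewrite ge_min lexx.
  have m2 : Num.min 8^-1 (e / 70) <= e / 70 by rewrite ge_min lexx orbT.
  by apply: le_trans (key _ m0 m1) _; lra.
move=> e0 e8.
have [s ts hs] := trig_approx Badm Bh e0.
have Bs := trig_poly_in_algebra Badm ts.
have [s1 [s2 [t1 t2 sE Ss1 Ss2]]] := trig_split ts.
have [Bs1 _] := Ss1; have [Bs2 _] := Ss2.
pose E := fexp s2; pose A := fexp h * fexp (- s1); pose r := fexp (h - s).
have BE' : B E := BE Bs2.
have BA : B A by apply: BM; apply: BE => //; exact: BN.
have BE1 : B (E - 1) by exact: BB.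
have BA1 : B (A - 1) by exact: BB.
have AE : A = r * E.
  rewrite /A /r /E sE opprD addrA !fexpD -[RHS]mulrA [fexp (- s2) * _]mulrC fexpVr mulr1 //.
have SA1 : spec Gp (A - 1).
  apply: (spec_inD G_compact Badm); last by apply: (spec_inN G_compact Badm); exact: spec_in1.
  apply: spec_plusM => //; apply: spec_plus_fexp; exact: (spec_inN G_compact Badm).
have SE1 : spec (~` Gp) (E - 1).
  by apply: (spec_in_fexp_sub1 G_compact mu_haar Badm) => //; exact: not_Gamma_plusD.
have r1 g : nm (r g - 1) <= 2 * e.
  apply: nm_cexp_sub1_le => //.
  exact: le_trans (nm_le_bnorm Balg g (BB Bh Bs)) (ltW hs).
have [cE1 cA1] := (BC BE1, BC BA1).
(* By orthogonality the squared norms of [A - 1] and [E - 1] add up to that of their difference, so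
   the latter controls [E - 1]. *)
have o : ip mu (A - 1) (- (E - 1)) = 0.
  apply: (ip_disjoint G_compact mu_haar Badm BA1 (continuousCN cE1)) => k.
  have [Gk|Gk] := pselect (Gp k); last by left; exact: SA1.2.
  by right; rewrite (hatN _ G_compact _ cE1) SE1.2 ?oppr0//; apply.
have sq0 : 0 <= sqnorm mu (A - 1) := sqnorm_ge0 mu G_compact cA1.
have sqAE := sqnormD G_compact cA1 (continuousCN cE1) o.
have sqN : sqnorm mu (- (E - 1)) = sqnorm mu (E - 1).
  by congr (rint mu _); apply/funext => g; rewrite -[(- (E - 1)) g]/(- ((E - 1) g)) nmN.
have csE := continuous_sqr cE1.
have cst1 (c : R) : continuous (cst c : G -> R) by exact: cst_continuous.
(* The difference is [(r - 1) * E], where [|r - 1| <= 2 e] and [|E| ^ 2 <= 2 |E - 1| ^ 2 + 2]; hence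
   both factors [8 e ^ 2]. *)
have sqle : sqnorm mu (A - 1 - (E - 1)) <= 8 * e ^+ 2 * sqnorm mu (E - 1) + 8 * e ^+ 2.
  have L := rint_linear mu G_compact (8 * e ^+ 2) csE (cst1 (8 * e ^+ 2)).
  rewrite (rint_cst mu) -sqnorm_rint in L; rewrite -L sqnorm_rint.
  apply: (rint_le mu G_compact (continuous_sqr (continuousCB cA1 cE1))).
    exact: (@continuous_linear _ _ (8 * e ^+ 2) _ _ csE (cst1 (8 * e ^+ 2))).
  move=> g; rewrite (_ : (A - 1 - (E - 1)) g = (r g - 1) * E g); last first.
    by rewrite AE -[LHS]/(r g * E g - 1 - (E g - 1)); ring.
  rewrite nmM exprMn /cst.
  have h1 : nm (r g - 1) ^+ 2 <= (2 * e) ^+ 2.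
    by rewrite lerXn2r ?nnegrE ?nm_ge0// mulr_ge0// ltW.
  have h2 : nm (E g) <= nm ((E - 1) g) + 1.
    by rewrite -[E g](subrK 1) -nm1; exact: nmD.
  have h3 := sqr_le_add1 (nm_ge0 _) (nm_ge0 _) h2.
  have -> : 8 * e ^+ 2 * nm ((E - 1) g) ^+ 2 + 8 * e ^+ 2 =
    (2 * e) ^+ 2 * (2 * nm ((E - 1) g) ^+ 2 + 2) by ring.
  by apply: ler_pM => //; exact: sqr_ge0.
have sqE : sqnorm mu (E - 1) <= 16 * e ^+ 2.
  rewrite sqAE sqN in sqle.
  exact: (absorb_sqr sq0 (sqnorm_ge0 mu G_compact cE1) e0 e8 sqle).
pose y g := complex.Re (s2 g).
have cs2 := BC Bs2.
have cy : continuous y := continuous_Re cs2.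
pose u g := e^-1 * nm ((E - 1) g) ^+ 2 + (-1 * y g + e).
have cyu := @continuous_linear _ _ (-1) _ _ cy (cst1 e).
have cu : continuous u := @continuous_linear _ _ e^-1 _ _ csE cyu.
have y0 : rint mu y = 0.
  have <- : complex.Re (I s2) = rint mu y by rewrite /rint /=.
  have := Ss2.2 0; rewrite /fourier_coef (_ : (fun g => _) = s2).
    by move=> ->// /(_ (group_order_refl le_order 0)).
  by apply/funext => g; rewrite character0E rmorph1 mulr1.
have uI : rint mu u <= 17 * e.
  rewrite /u (rint_linear mu G_compact _ csE cyu).
  rewrite (rint_linear mu G_compact _ cy (cst1 e)) y0 mulr0 add0r (rint_cst mu) -sqnorm_rint.
  have : e^-1 * sqnorm mu (E - 1) <= e^-1 * (16 * e ^+ 2).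
    by rewrite ler_wpM2l// invr_ge0 ltW.
  have -> : e^-1 * (16 * e ^+ 2) = 16 * e by field; rewrite gt_eqF.
  by rewrite (_ : 17 * e = 16 * e + e) ?lerD2r//; ring.
have yu g : `|y g| <= u g.
  apply: abs_le_of_log_bound => //; first exact: nm_ge0.
  rewrite -(nm_cexp (s2 g)) -[cexp _]/(E g) -[E g](subrK 1) -nm1; exact: nmD.
pose v g : R[i] := (y g)%:C.
have cv : continuous v := continuous_real_complex cy.
have hv : nm (hat v j) <= 34 * e.
  have := nm_cintegral_le mu G_compact (continuous_hat_integrand (j := j) cv) cu.
  move=> /(_ _)H; apply: le_trans (H _) _ => [g|].
    by rewrite nmM nm_conj nm_character mulr1 /v nm_real.
  by rewrite -/(rint mu u) (_ : 34 * e = 2 * (17 * e)) ?ler_pM2l//; ring.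
(* The conjugate of [s2] has strictly positive spectrum, so at the negative [j] the coefficient of
   [2 Re s2] is that of [s2]. *)
have vE : 2 *: v = s2 + (fun g => (s2 g)^*).
  apply/funext => g; rewrite -[RHS]/(s2 g + (s2 g)^*) -[LHS]/(2 * v g).
  by rewrite /v /y -addcJ.
have hs2 : hat s2 j = 2 * hat v j.
  have cc := continuous_conj cs2.
  rewrite -(hatZ mu G_compact _ _ cv) vE (hatD mu G_compact _ cs2 cc).
  have -> : hat (fun g => (s2 g)^*) j = (hat s2 (- j))^*.
    rewrite /fourier_coef -(cintegral_conj _ G_compact (continuous_hat_integrand (j := - j) cs2)).
    congr (I _); apply/funext => g.
    by rewrite -(character_oppE j) -[in LHS](conjCK ((- j : character R G) g)) -rmorphM.
  rewrite (Ss2.2 (- j)) ?rmorph0 ?addr0//.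
  by move=> nn; apply: nn; rewrite /Gamma_plus /= group_order_oppr; have /not_Gamma_plus[] := nGj.
have hsj : hat s j = hat s2 j.
  by rewrite sE (hatD mu G_compact _ (BC Bs1) cs2) Ss1.2// add0r.
have hd := nm_hat_le_bnorm mu G_compact Badm j (BB Bh Bs).
rewrite (hatB mu G_compact _ (BC Bh) (BC Bs)) hsj hs2 in hd.
have := nmD (hat h j - 2 * hat v j) (2 * hat v j).
rewrite subrK nmM (_ : nm (2 : R[i]) = 2); last first.
  by rewrite -(rmorph_nat (real_complex R)) nm_real ger0_norm.
move=> H; apply: le_trans H _; rewrite (_ : 70 * e = 2 * e + 2 * (34 * e)); last by ring.
apply: lerD; last by rewrite ler_pM2l.
by apply: le_trans hd _; rewrite ler_pM2l// ltW.
Qed.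

End OneSidedLogarithms.

(** [Gamma_plus] of the reversed order is [Gamma_minus] by conversion, so the results on [Bplus]
    yield those on [Bminus]. *)
Lemma reverse_group_order (T : zmodType) (le : rel T) :
  is_group_order le -> is_group_order (fun x y => le y x).
Proof.
move=> [r a t s add]; split => //.
- by move=> x y; rewrite andbC; exact: a.
- by move=> y x z yx zy; exact: t zy yx.
- by move=> x y z; exact: add.
Qed.

(** The values of [f] are periods of [cexp]; by [cexp_eq1_small] distinct ones are at least 4 apart,
    so [f] is locally constant. *)
Lemma connected_fexp_eq1 (R : realType) (G : topologicalZmodType) (f : G -> R[i]) :
  connected [set: G] -> continuous f -> fexp f = 1 -> exists c, f = cst c.
Proof.
move=> G_connected /continuousCP cf f1; exists (f 0).
have loc g : \forall y \near g, f y = f g.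
  apply: filterS (cf g 4 (ltr0n _ 4)) => y fy.
  apply/eqP; rewrite -subr_eq0; apply/eqP; apply: cexp_eq1_small; last by rewrite nm_distC.
  have E x : cexp (f x) = 1 := congr1 (fun h => h x) f1.
  by rewrite cexpD cexpN !E divr1.
pose A := [set g | f g = f 0].
have Aopen : open A.
  by rewrite openE => g Ag; apply: filterS (loc g) => y; rewrite /A /= => ->.
have Copen : open (~` A).
  by rewrite openE => g nAg; apply: filterS (loc g) => y fy Ay; apply: nAg; rewrite /A /= -fy.
have AT : A = [set: G].
  apply: G_connected.
  - by exists 0.
  - by exists A; rewrite ?setTI.
  - by exists A; rewrite ?setTI// -[A]setCK; exact: open_closedC.
by apply/funext => g; have : A g by rewrite AT.
Qed.

(** * Factorable units: density and the criterion *)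

Section Factorization.
Variables (R : realType) (G : topologicalZmodType).
Variable mu : probability (borel G) R.
Variables (B : set (G -> R[i])) (N : (G -> R[i]) -> R).
Hypothesis G_compact : compact [set: G].
Hypothesis mu_haar : is_haar mu.
Hypothesis Badm : admissible B N.
Variable le : rel (character R G).
Hypothesis le_order : is_group_order le.
Implicit Types (a b f h : G -> R[i]) (j k : character R G).

Let Balg : is_banach_subalgebra B N := admissible_banach Badm.
Let ge_order := reverse_group_order le_order.
Let BD := balgD Balg.
Let BB := balgB Balg.
Let BM := balgM Balg.
Let BN := balgN Balg.
Let BE := balg_fexp Balg.

Lemma GL_fexp_minus a : Bminus mu le B a -> GL (Bminus mu le B) (fexp a).
Proof. exact: (GL_fexp_plus G_compact mu_haar Badm ge_order). Qed.

Lemma GL_sub (U V : set (G -> R[i])) a : U `<=` V -> GL U a -> GL V a.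
Proof. by move=> UV [Ua [b Ub ab]]; split; [exact: UV|exists b => //; exact: UV]. Qed.

Lemma GL_plus_sub a : GL (Bplus mu le B) a -> GL B a.
Proof. by apply: GL_sub => b []. Qed.

Lemma GL_minus_sub a : GL (Bminus mu le B) a -> GL B a.
Proof. by apply: GL_sub => b []. Qed.

(** A negative index is positive for the reversed order, which exchanges the roles of [am] and
    [ap]. *)
Lemma factor_index_eq0 h am ap j : B h -> GL (Bminus mu le B) am ->
  GL (Bplus mu le B) ap -> fexp h = am * (j : G -> R[i]) * ap -> j = 0.
Proof.
move=> Bh [/spec_inP Sam [am' /spec_inP Sam' amE]] [/spec_inP Sap [ap' /spec_inP Sap' apE]] hE.
apply: contrapT => j0; have /orP[jp|jm] := group_order_total le_order 0 j.
  apply: (factor_index_not_gt0 G_compact mu_haar Badm le_order Bh Sam Sam' amE Sap _ _ hE) => //.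
  - by move=> x Sx; exact: (spec_plus_fexp G_compact mu_haar Badm ge_order Sx).
  - by move=> x y Sx Sy; exact: (spec_plusM G_compact mu_haar Badm ge_order Sx Sy).
have hE' : fexp h = ap * (j : G -> R[i]) * am by rewrite hE; ring.
apply: (factor_index_not_gt0 G_compact mu_haar Badm ge_order Bh Sap Sap' apE Sam _ _ hE') => //.
- by move=> x Sx; exact: (spec_plus_fexp G_compact mu_haar Badm le_order Sx).
- by move=> x y Sx Sy; exact: (spec_plusM G_compact mu_haar Badm le_order Sx Sy).
Qed.

Lemma character_fun0 : ((0 : character R G) : G -> R[i]) = 1.
Proof. by []. Qed.

Lemma character_mulN j : (j : G -> R[i]) * ((- j : character R G) : G -> R[i]) = 1.
Proof. by apply/funext => g; rewrite -[LHS]/((j + - j) g) subrr. Qed.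

(** From [a = j exp h] one gets [exp h = 1 * (- j) * a], a factorization with left factor 1; so the
    index [- j] is 0, and [log_spec_plus] applies to [h]. *)
Lemma GL_plus_log a : GL (Bplus mu le B) a -> exists2 h, Bplus mu le B h & a = fexp h.
Proof.
move=> Ga; have [j [h [Bh aE]]] :=
  unit_character_exponential G_compact mu_haar Badm le_order (GL_plus_sub Ga).
have G1 : GL (Bminus mu le B) 1.
  have S1 : Bminus mu le B 1 by apply/spec_inP; exact: (spec_in1 G_compact mu_haar Badm ge_order).
  by split=> //; exists 1; rewrite ?mulr1.
have j0 : - j = 0.
  apply: (factor_index_eq0 Bh G1 Ga).
  by rewrite aE mul1r mulrA [_ * (j : G -> R[i])]mulrC character_mulN mul1r.
have {}aE : a = fexp h.
  by rewrite aE -(opprK j) j0 oppr0 character_fun0 mul1r.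
exists h => //; apply/spec_inP; apply: (log_spec_plus G_compact mu_haar Badm le_order Bh).
by rewrite -aE; apply/spec_inP; case: Ga.
Qed.

Lemma GLF_sub_GL : GLF mu le B `<=` GL B.
Proof.
move=> a [Ba [am [ap [j [/GL_minus_sub[Bam [am' Bam' amE]] /GL_plus_sub[Bap [ap' Bap' apE]] aE]]]]].
split=> //; exists (am' * ((- j : character R G) : G -> R[i]) * ap').
  by apply: BM => //; apply: BM => //; exact: (character_in_algebra Badm).
have -> : a = am * (j : G -> R[i]) * ap by apply/funext => g; rewrite aE.
transitivity ((am * am') * ((j : G -> R[i]) * ((- j : character R G) : G -> R[i])) * (ap * ap')).
  by ring.
by rewrite amE apE character_mulN !mulr1.
Qed.

Lemma GLF_fexp j p m : Bplus mu le B p -> Bminus mu le B m ->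
  GLF mu le B ((j : G -> R[i]) * fexp (p + m)).
Proof.
move=> Bp Bm; have [Bp' _] := Bp; have [Bm' _] := Bm.
split; first by apply: BM; [exact: (character_in_algebra Badm)|apply: BE; exact: BD].
exists (fexp m), (fexp p), j; split.
- exact: GL_fexp_minus.
- exact: (GL_fexp_plus G_compact mu_haar Badm le_order).
- by move=> g; rewrite fexpD -[LHS]/(j g * (fexp p g * fexp m g)); ring.
Qed.

Lemma bnorm_fexp_sub1 a : B a -> N a <= 8^-1 -> N (fexp a - 1) <= 2 * N a.
Proof.
move=> Ba a8; have [Be He _] := fexp_approx Balg Ba.
have Na0 := bnorm_ge0 Balg Ba.
have B1 := balg1 Balg.
have -> : fexp a - 1 = (fexp a - 1 - a) + a by rewrite subrK.
apply: le_trans (bnormD Balg (BB (BB Be B1) Ba) Ba) _.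
have e2 : expR (N a) <= 2.
  have h2 : `|N a| <= 2^-1 by rewrite ger0_norm//; lra.
  have /andP[_] := expR_sub_le h2.
  have : N a ^+ 2 <= 8^-1 * N a by rewrite expr2 ler_wpM2r.
  lra.
have : N a ^+ 2 * expR (N a) <= 8^-1 * N a * 2.
  by apply: ler_pM; rewrite ?sqr_ge0 ?expR_ge0// expr2 ler_wpM2r.
lra.
Qed.

Lemma GLF_dense : dense_in N (GLF mu le B) (GL B).
Proof.
split; first exact: GLF_sub_GL.
move=> a Ga e e0; have [Ba _] := Ga.
have [j [h [Bh aE]]] := unit_character_exponential G_compact mu_haar Badm le_order Ga.
have Na0 := bnorm_ge0 Balg Ba.
have Na1 : 0 < 2 * (N a + 1) by rewrite mulr_gt0// ltr_wpDl.
(* The error is [a * (fexp w - 1)] with [w = s - h]: the bound 1/8 gives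
   [N (fexp w - 1) <= 2 * N w], and the second term of the minimum then makes the product less than
   [e]. *)
have d0 : 0 < Num.min 8^-1 (e / (2 * (N a + 1))).
  by rewrite lt_min invr_gt0 ltr0n divr_gt0.
have [s ts] := trig_approx Badm Bh d0; rewrite lt_min => /andP[/ltW w8 we].
have Bs := trig_poly_in_algebra Badm ts.
have [s1 [s2 [_ _ sE Ss1 Ss2]]] := trig_split G_compact mu_haar Badm le ts.
exists ((j : G -> R[i]) * fexp s).
  rewrite sE; apply: GLF_fexp; first exact/spec_inP.
  by apply/spec_inP; exact: (spec_not_plus le_order).
pose w := - (h - s); have Bw : B w by apply: BN; exact: BB.
have Nw : N w = N (h - s) by rewrite (bnormN Balg)//; exact: BB.
have -> : a - (j : G -> R[i]) * fexp s = - (a * (fexp w - 1)).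
  have -> : s = h + w by rewrite /w opprB addrC subrK.
  by rewrite fexpD mulrA -aE mulrBr mulr1 opprB.
have Bew : B (fexp w - 1) by apply: BB; [exact: BE|exact: (balg1 Balg)].
rewrite (bnormN Balg); last exact: BM.
apply: le_lt_trans (bnormM Balg Ba Bew) _.
have h1 : N (fexp w - 1) <= 2 * N w by apply: bnorm_fexp_sub1 => //; rewrite Nw.
move: we; rewrite -Nw ltr_pdivlMr// => we.
have h2 : N a * N (fexp w - 1) <= N a * (2 * N w) by rewrite ler_wpM2l.
have Nw0 := bnorm_ge0 Balg Bw.
lra.
Qed.

Lemma decomposing_GLF_eq : decomposing mu le B -> GLF mu le B = GL B.
Proof.
move=> D; apply/seteqP; split; first exact: GLF_sub_GL.
move=> a Ga; have [j [h [Bh ->]]] :=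
  unit_character_exponential G_compact mu_haar Badm le_order Ga.
by move: Bh; rewrite {1}D => -[p Bp [m Bm <-]]; exact: GLF_fexp.
Qed.

End Factorization.

Lemma GLF_eq_decomposing (R : realType) (G : topologicalZmodType)
    (mu : probability (borel G) R) (le : rel (character R G))
    (B : set (G -> R[i])) (N : (G -> R[i]) -> R) :
  compact [set: G] -> connected [set: G] -> is_haar mu -> is_group_order le ->
  admissible B N -> GLF mu le B = GL B -> decomposing mu le B.
Proof.
move=> G_compact G_connected mu_haar le_order Badm E.
have Balg := admissible_banach Badm.
apply/seteqP; split=> f; last first.
  by move=> [p [Bp _] [m [Bm _] <-]]; exact: (balgD Balg).
move=> Bf; have Gf : GL B (fexp f).
  split; first exact: (balg_fexp Balg).
  by exists (fexp (- f)); [exact: (balg_fexp Balg (balgN Balg Bf))|exact: fexpVr].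
rewrite -E in Gf; have [_ [am [ap [j [Gam Gap fE]]]]] := Gf.
have {}fE : fexp f = am * (j : G -> R[i]) * ap by apply/funext => g; rewrite fE.
have j0 := factor_index_eq0 G_compact mu_haar Badm le_order Bf Gam Gap fE.
have [p Bp pE] := GL_plus_log G_compact mu_haar Badm le_order Gap.
have [m Bm mE] := GL_plus_log G_compact mu_haar Badm (reverse_group_order le_order) Gam.
have Bpm : B (p + m) := balgD Balg Bp.1 Bm.1.
have [||c cE] := @connected_fexp_eq1 _ _ (f - (p + m)) G_connected.
- exact: (balg_continuous Balg (balgB Balg Bf Bpm)).
- rewrite fexpD fE j0 character_fun0 mulr1 mE pE [fexp m * _]mulrC -fexpD.
  exact: fexpVr.
(* A constant has spectrum in [{0}], so the ambiguity of the logarithm can be put into the plus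
   part. *)
have Bc : Bplus mu le B (cst c).
  have -> : cst c = c *: (1 : G -> R[i]).
    by apply/funext => g; rewrite -[RHS]/(c * 1) mulr1.
  apply/spec_inP; apply: (spec_inZ G_compact Badm).
  exact: (spec_in1 G_compact mu_haar Badm le_order).
exists (p + cst c).
  by apply/spec_inP; apply: (spec_inD G_compact Badm); exact/spec_inP.
exists m; first exact: Bm.
by rewrite -cE; ring.
Qed.

Theorem theorem7p1 (R : realType) (G : topologicalZmodType)
    (mu : probability (borel G) R) (le : rel (character R G))
    (B : set (G -> R[i])) (N : (G -> R[i]) -> R)
    (G_hausdorff : hausdorff_space G)
    (G_compact : compact [set: G])
    (G_connected : connected [set: G])
    (mu_haar : is_haar mu)
    (le_order : is_group_order le)
    (B_admissible : admissible B N) :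
  dense_in N (GLF mu le B) (GL B) /\
  (GLF mu le B = GL B <-> decomposing mu le B).
Proof.
split; first exact: (GLF_dense G_compact mu_haar B_admissible le_order).
split; first exact: (GLF_eq_decomposing G_compact G_connected mu_haar le_order B_admissible).
exact: (decomposing_GLF_eq G_compact mu_haar B_admissible le_order).
Qed.
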